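(* Let $N=5$, $\chi=\left(\frac{5}{\cdot}\right)$ and $\epsilon=+1$. Assume that for each $k'\in\{0,2\}$ and every integer $m$ for which the reduced modular form $f$ of order $m$ in $A^{\epsilon}(5,k',\chi)$ exists, $s(m)f$ has integral Fourier coefficients. Let $m<0$ be an integer for which the reduced modular form $f_m$ of order $m$ in $A^{\epsilon}(5,0,\chi)$ exists. Then the weight of the Borcherds lift $\Psi_{f_m}$ is divisible by $5$.
   Context: For $k\in\mathbb Z$, $A(5,k,\chi)$ is the space of functions $f$ holomorphic on the upper half plane, meromorphic at the cusps, with $f\left(\frac{a\tau+b}{c\tau+d}\right)=\chi(d)(c\tau+d)^kf(\tau)$ for all $\begin{pmatrix}a&b\\c&d\end{pmatrix}\in\Gamma_0(5)$; write $f=\sum_n a(n)q^n$ with $q=e^{2\pi i\tau}$. For $\epsilon=+1$, $A^{\epsilon}(5,k,\chi)$ consists of those $f=\sum_n a(n)q^n\in A(5,k,\chi)$ with $a(n)=0$ whenever $\chi(n)=-1$. For $m\in\mathbb Z$, $s(m)=2$ if $5\mid m$ and $s(m)=1$ otherwise. A reduced modular form of order $m\in\mathbb Z$ in $A^\epsilon(5,k,\chi)$ is a form $f_m=\sum_n a_m(n)q^n=\frac{1}{s(m)}q^m+O(q^{m+1})$ in $A^\epsilon(5,k,\chi)$ such that for each $n>m$ with $a_m(n)\ne0$ there is no $g\in A^\epsilon(5,k,\chi)$ with $g=q^n+O(q^{n+1})$. It is unique if it exists. Borcherds lift (Borcherds; Bruinier–Bundschuh): let $F=\mathbb Q(\sqrt5)$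 with ring of integers $\mathcal O_F$, different $\mathfrak d$, and conjugation $\lambda\mapsto\lambda'$. If $f=\sum_n a(n)q^n\in A^{\epsilon}(5,0,\chi)$ satisfies $s(n)a(n)\in\mathbb Z$ for all $n<0$, then its Borcherds lift $\Psi_f$ is the meromorphic Hilbert modular form (with a multiplier system of finite order, unique up to a nonzero constant multiple) for $\mathrm{SL}_2(\mathcal O_F)$, of parallel weight $s(0)a(0)/2=a(0)$, whose divisor is $\sum_{n<0}s(n)a(n)\,T(-n)$. Here, for $j>0$, $T(j)$ is the Hirzebruch–Zagier divisor $\sum\{(z_1,z_2)\in\mathbb H^2: az_1z_2+\lambda z_1+\lambda' z_2+b=0\}$, the sum being over $(a,b,\lambda)\in(\mathbb Z\times\mathbb Z\times\mathfrak d^{-1})/\{\pm1\}$ with $ab-\lambda\lambda'=j/5$. *)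

(* Defs.v *)
From Stdlib Require Import Reals ZArith QArith Qreals List.
From Coquelicot Require Import Coquelicot.
Import ListNotations.
Open Scope R_scope.

Definition CZ (n : Z) : C := RtoC (IZR n).

Definition Cpow_Z (z : C) (k : Z) : C :=
  match k with
  | Z0 => RtoC 1
  | Zpos p => Cpow z (Pos.to_nat p)
  | Zneg p => Cinv (Cpow z (Pos.to_nat p))
  end.

(* e(z) = exp(2 pi i z) *)
Definition e2pi (z : C) : C :=
  (exp (- 2 * PI * Im z) * cos (2 * PI * Re z),
   exp (- 2 * PI * Im z) * sin (2 * PI * Re z)).

(* The argument in (-pi, pi]; only used for w <> 0. *)
Definition Carg (w : C) : R :=
  if Rle_dec 0 (Im w) then acos (Re w / Cmod w) else - acos (Re w / Cmod w).

(* w ^ r on the principal branch, for w <> 0 and real r *)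
Definition Cpow_R (w : C) (r : R) : C :=
  (Rpower (Cmod w) r * cos (r * Carg w), Rpower (Cmod w) r * sin (r * Carg w)).

(** * Weakly holomorphic modular forms of level 5 *)

(* Functions on the upper half plane H are total functions C -> C; only their
   values on H matter. *)
Definition inH (tau : C) : Prop := 0 < Im tau.

(* The Kronecker symbol (5/n), which equals the Legendre symbol (n/5). *)
Definition chi (n : Z) : Z :=
  match (n mod 5)%Z with
  | 1%Z | 4%Z => 1%Z
  | 2%Z | 3%Z => (-1)%Z
  | _ => 0%Z
  end.

Definition s (m : Z) : Z := if Z.eqb (m mod 5) 0 then 2%Z else 1%Z.

Definition cocyc (c d : Z) (tau : C) : C := (CZ c * tau + CZ d)%C.

Definition mobius (a b c d : Z) (tau : C) : C :=
  ((CZ a * tau + CZ b) / cocyc c d tau)%C.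

(* g(tau) = sum_n a(n) e(n tau / h) on H, with finitely many n < 0 *)
Definition has_expansion (h : Z) (g : C -> C) (a : Z -> C) : Prop :=
  exists n0 : Z,
    (forall n : Z, (n < n0)%Z -> a n = RtoC 0) /\
    forall tau : C, inH tau ->
      is_series (K := C_AbsRing) (V := C_NormedModule)
        (fun j : nat =>
           let n := (n0 + Z.of_nat j)%Z in
           (a n * e2pi (CZ n * tau / CZ h))%C)
        (g tau).

(* f = sum_n a(n) q^n *)
Definition qexp (f : C -> C) (a : Z -> C) : Prop := has_expansion 1 f a.

Definition holomorphic_H (f : C -> C) : Prop :=
  forall tau : C, inH tau ->
    ex_derive (K := C_AbsRing) (V := C_NormedModule) f tau.

Definition slash (k : Z) (f : C -> C) (a b c d : Z) (tau : C) : C :=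
  (Cpow_Z (cocyc c d tau) (- k) * f (mobius a b c d tau))%C.

(* f is expanded at the cusp gamma(oo) for each gamma in SL_2(Z); the matrix
   gamma (1 5; 0 1) gamma^-1 is congruent to 1 mod 5, so e(tau / 5) is a local
   parameter at each of them. *)
Definition meromorphic_at_cusps (k : Z) (f : C -> C) : Prop :=
  forall a b c d : Z, (a * d - b * c = 1)%Z ->
    exists coef : Z -> C, has_expansion 5 (slash k f a b c d) coef.

(* A(5,k,chi) *)
Definition A5 (k : Z) (f : C -> C) : Prop :=
  holomorphic_H f /\
  meromorphic_at_cusps k f /\
  forall a b c d : Z, (a * d - b * c = 1)%Z -> (5 | c)%Z ->
    forall tau : C, inH tau ->
      f (mobius a b c d tau) = (CZ (chi d) * Cpow_Z (cocyc c d tau) k * f tau)%C.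

(* f = sum_n a(n) q^n belongs to A^eps(5,k,chi) with eps = +1. *)
Definition A5plus (k : Z) (f : C -> C) (a : Z -> C) : Prop :=
  A5 k f /\ qexp f a /\ forall n : Z, chi n = (-1)%Z -> a n = RtoC 0.

Definition reduced (k m : Z) (f : C -> C) (a : Z -> C) : Prop :=
  A5plus k f a /\
  (forall n : Z, (n < m)%Z -> a n = RtoC 0) /\
  a m = (RtoC 1 / CZ (s m))%C /\
  forall n : Z, (m < n)%Z -> a n <> RtoC 0 ->
    ~ exists (g : C -> C) (b : Z -> C),
        A5plus k g b /\
        (forall i : Z, (i < n)%Z -> b i = RtoC 0) /\ b n = RtoC 1.

(** * The field Q(sqrt 5) *)

(* F is identified with its image in R x R under its two real embeddings, so
   that conjugation swaps the components and the field operations are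
   componentwise. *)
Definition inF (x : R * R) : Prop :=
  exists p q : Q, x = (Q2R p + Q2R q * sqrt 5, Q2R p - Q2R q * sqrt 5).

Definition algebraic_integer (x : R) : Prop :=
  exists l : list Z,
    fold_right (fun c v => IZR c + x * v) 0 l + x ^ length l = 0.

Definition inOF (x : R * R) : Prop := inF x /\ algebraic_integer (fst x).

(* The inverse different: the dual of O_F under the trace form. *)
Definition in_inv_different (l : R * R) : Prop :=
  inF l /\
  forall x : R * R, inOF x ->
    exists n : Z, fst l * fst x + snd l * snd x = IZR n.

(** * Meromorphic functions and divisors on H x H *)

Definition inH2 (z : C * C) : Prop := inH (fst z) /\ inH (snd z).

Definition C2 : NormedModule C_AbsRing :=
  prod_NormedModule C_AbsRing C_NormedModule C_NormedModule.

Definition locally2 (p : C * C) (P : C * C -> Prop) : Prop :=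
  locally (T := C2) p P.

(* Complex (Frechet) differentiability at z *)
Definition cdiff (u : C * C -> C) (z : C * C) : Prop :=
  ex_filterdiff (K := C_AbsRing) (U := C2) (V := C_NormedModule) u
    (locally (T := C2) z).

Definition holomorphic_near (u : C * C -> C) (p : C * C) : Prop :=
  locally2 p (cdiff u).

(* Locally a quotient g / h of holomorphic functions, with h vanishing
   identically on no open set.  The values of psi where h = 0 are irrelevant. *)
Definition meromorphic_H2 (psi : C * C -> C) : Prop :=
  forall p : C * C, inH2 p ->
    exists g h : C * C -> C,
      locally2 p (fun z =>
        cdiff g z /\ cdiff h z /\
        ~ locally2 z (fun w => h w = RtoC 0) /\
        (h z <> RtoC 0 -> psi z = (g z / h z)%C)).

(* div(psi) is the locally finite sum, over the indices i with supp i, of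
   mult i times the divisor of the holomorphic function eqn i: near each p,
   psi is a nonvanishing holomorphic function times the product of the
   (eqn i) ^ (mult i) over those i with eqn i p = 0. *)
Definition has_divisor {I : Type} (supp : I -> Prop) (eqn : I -> C * C -> C)
    (mult : I -> Z) (psi : C * C -> C) : Prop :=
  forall p : C * C, inH2 p ->
    exists (l : list I) (u : C * C -> C),
      NoDup l /\
      (forall i : I, In i l <-> supp i /\ eqn i p = RtoC 0) /\
      locally2 p (fun z =>
        cdiff u z /\ u z <> RtoC 0 /\
        ((forall i : I, In i l -> eqn i z <> RtoC 0) ->
         psi z =
           (u z * fold_right (fun i v => Cpow_Z (eqn i z) (mult i) * v)
                    (RtoC 1) l)%C)).

(** * Hilbert modular forms for SL_2(O_F) *)

Definition cocyc_R (c d : R) (z : C) : C := (RtoC c * z + RtoC d)%C.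

Definition mobius_R (a b c d : R) (z : C) : C :=
  ((RtoC a * z + RtoC b) / cocyc_R c d z)%C.

Definition mobius2 (a b c d : R * R) (z : C * C) : C * C :=
  (mobius_R (fst a) (fst b) (fst c) (fst d) (fst z),
   mobius_R (snd a) (snd b) (snd c) (snd d) (snd z)).

(* Matrices (a b; c d) in SL_2(O_F) *)
Definition inSL2OF (a b c d : R * R) : Prop :=
  inOF a /\ inOF b /\ inOF c /\ inOF d /\
  fst a * fst d - fst b * fst c = 1 /\
  snd a * snd d - snd b * snd c = 1.

(* Meromorphic Hilbert modular forms of parallel real weight with a multiplier
   system of finite order.  The transformation law is an identity of
   meromorphic functions; since the values at poles are arbitrary, it is
   required at the points where both sides are holomorphic, which form a dense
   open set.  No condition at the cusps is needed (Goetzky-Koecher). *)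
Record hilbert_form : Type := {
  hfun :> C * C -> C;
  hweight : R;
  hfun_mero : meromorphic_H2 hfun;
  hfun_transf :
    exists (sigma : R * R -> R * R -> R * R -> R * R -> C) (N : nat),
      (0 < N)%nat /\
      forall a b c d : R * R, inSL2OF a b c d ->
        Cpow (sigma a b c d) N = RtoC 1 /\
        forall z : C * C, inH2 z ->
          holomorphic_near hfun z ->
          holomorphic_near hfun (mobius2 a b c d z) ->
          hfun (mobius2 a b c d z) =
            (sigma a b c d
             * Cpow_R (cocyc_R (fst c) (fst d) (fst z)) hweight
             * Cpow_R (cocyc_R (snd c) (snd d) (snd z)) hweight
             * hfun z)%C
}.

(** * Hirzebruch-Zagier divisors and Borcherds lifts *)

(* Triples (a, b, lambda) *)
Definition HZvec : Type := (Z * Z * (R * R))%type.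

Definition HZeqn (v : HZvec) (z : C * C) : C :=
  let '(a, b, (l, l')) := v in
  (CZ a * fst z * snd z + RtoC l * fst z + RtoC l' * snd z + CZ b)%C.

(* The components of T(j).  The last clause selects one vector from each pair
   {v, -v}: when a = 0 and j > 0, lambda lambda' < 0, so lambda is nonzero. *)
Definition T (j : Z) (v : HZvec) : Prop :=
  let '(a, b, (l, l')) := v in
  in_inv_different (l, l') /\
  IZR a * IZR b - l * l' = IZR j / 5 /\
  ((0 < a)%Z \/ a = 0%Z /\ 0 < l).

(* Psi is the Borcherds lift of sum_n a(n) q^n, with c n = s(n) a(n) for n < 0;
   the divisor is indexed by the pairs (j, v) with v a component of T(j). *)
Definition is_borcherds_lift (a : Z -> C) (Psi : hilbert_form) : Prop :=
  RtoC (hweight Psi) = (CZ (s 0) * a 0%Z / RtoC 2)%C /\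
  exists c : Z -> Z,
    (forall n : Z, (n < 0)%Z -> (CZ (s n) * a n)%C = CZ (c n)) /\
    has_divisor
      (fun i : Z * HZvec =>
         (0 < fst i)%Z /\ c (- fst i)%Z <> 0%Z /\ T (fst i) (snd i))
      (fun i => HZeqn (snd i))
      (fun i => c (- fst i)%Z)
      Psi.

(* Main.v *)
Require Import Defs.
From Stdlib Require Import Reals ZArith Lra Lia Psatz.
From Coquelicot Require Import Coquelicot.

Open Scope R_scope.

(** Write [a n] for the coefficients of [f], [q] for [e (tau)], and let [E] be the
    Eisenstein series of weight 2 and character [chi] which is nonzero at infinity and
    vanishes at the cusp 0.  The form [F = f E] has weight 2 and trivial character for
    [Gamma_0(5)], and the differential [F d tau] is holomorphic away from the two cusps
    of the modular curve.  Its residues there cancel: the constant term of [F] at infinity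
    plus 5 times the one at 0, a cusp of width 5, vanishes ([constant_terms]).

    Both constant terms can be computed.  Up to the factor [- 1 / sqrt 5], the expansion of
    [E] at infinity is [1 - 5 sum_N (sum_(n | N) chi n * n) q^N] and at 0 it is
    [- sqrt 5 sum_N (sum_(n | N) chi (N / n) * n) q^(N/5)]
    ([wp_E_expansion], [wp_E_expansion_zero]).  The vanishing of [a n] for [chi n = -1]
    determines the expansion of [f] at 0: it is [sqrt 5 sum_n a (5 n) q^(n/5)]
    ([fricke_plus]).  This gives ([constant_term_formula])
    [a 0 = 5 sum_(M > 0) a (- M) * w M], where
    [w M = sum_(d | M) chi d * d + 5 sum_(d | M/5) chi (M / (5 d)) * d] and the second sum
    is present only when 5 divides [M].  In that case [w M] is even, because it is
    congruent modulo 2 to [sum_(d | M/5) (chi d + chi (M / (5 d))) * d] ([lambert_even]).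
    Since [s n * a n] is an integer for [n < 0], every [a (- M) * w M] is an integer
    ([isZ_weight_term]), and the weight [a 0] is divisible by 5.

    The residue theorem is replaced by an argument with a primitive [G] of [F], obtained
    by integrating the [q]-expansion termwise.  For [g] in [Gamma_0(5)], [G (g z) - G z] is
    a constant, which is 0 when [g] has a fixed point.  The product of two elements of
    order 2 is the generator of the stabilizer of the cusp 0 times a translation, and
    evaluating the constants gives the relation.

    The modularity of [E] comes from Weierstrass functions: [E] is, up to a factor, the
    difference of their values at the points [1/5] and [2/5] of order 5.  Summing over the
    lattice [Z tau + Z] along rows gives, by the partial fractions of
    [pi^2 / sin^2 (pi z)] ([gfun_partial_fractions]), a series with an evident behaviour
    under [tau -> tau + 1]; summing along columns gives the same series at [- 1 / tau].
    The two sums agree by absolute convergence once opposite lattice points are grouped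
    ([wp_diff_inv]). *)

(** * Series of complex numbers *)

Definition Csum (a : nat -> C) (l : C) : Prop :=
  is_series (K := C_AbsRing) (V := C_NormedModule) a l.

(** The sum of the first [n] terms: a strict bound makes cutting a sum in two and
    reindexing it free of boundary terms. *)
Fixpoint csum (a : nat -> C) (n : nat) : C :=
  match n with O => RtoC 0 | S m => csum a m + a m end.

Lemma csum_sum_n (a : nat -> C) n :
  sum_n (G := NormedModule.AbelianMonoid C_AbsRing C_NormedModule) a n = csum a (S n).
Proof.
  induction n as [|n IH]; [rewrite sum_O; simpl; ring|].
  rewrite sum_Sn, IH; reflexivity.
Qed.

Lemma csum_ext a b n : (forall k, (k < n)%nat -> a k = b k) -> csum a n = csum b n.
Proof.
  intros H; induction n as [|n IH]; simpl; [reflexivity|].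
  rewrite IH, H; auto with arith.
Qed.

Lemma csum_plus a b n : csum (fun k => a k + b k)%C n = (csum a n + csum b n)%C.
Proof. induction n as [|n IH]; simpl; [ring | rewrite IH; ring]. Qed.

Lemma csum_scal c a n : csum (fun k => c * a k)%C n = (c * csum a n)%C.
Proof. induction n as [|n IH]; simpl; [ring | rewrite IH; ring]. Qed.

Lemma csum_add a m n :
  csum a (m + n) = (csum a m + csum (fun k => a (m + k)%nat) n)%C.
Proof.
  induction n as [|n IH]; [rewrite Nat.add_0_r; simpl; ring|].
  rewrite Nat.add_succ_r; simpl; rewrite IH; ring.
Qed.

Lemma csum_rev a n : csum a n = csum (fun k => a (n - 1 - k)%nat) n.
Proof.
  induction n as [|n IH]; [reflexivity|].
  change (S n) with (1 + n)%nat at 3; rewrite csum_add; simpl csum.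
  rewrite Cplus_0_l, Nat.sub_0_r, Nat.sub_0_r, IH, Cplus_comm; f_equal.
  apply csum_ext; intros k Hk; f_equal; lia.
Qed.

Lemma Cmod_csum_le a B n :
  (forall k, (k < n)%nat -> Cmod (a k) <= B) -> Cmod (csum a n) <= INR n * B.
Proof.
  intros H; induction n as [|n IH]; [simpl; rewrite Cmod_0; lra|].
  rewrite S_INR; simpl csum; eapply Rle_trans; [apply Cmod_triangle|].
  specialize (H n ltac:(lia)) as Hn.
  assert (Cmod (csum a n) <= INR n * B) by (apply IH; intros; apply H; lia).
  lra.
Qed.

Lemma Re_csum (a : nat -> C) n : Re (csum a (S n)) = sum_n (fun k => Re (a k)) n.
Proof.
  induction n as [|n IH]; [rewrite sum_O; simpl; apply Rplus_0_l|].
  rewrite sum_Sn, <- IH; reflexivity.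
Qed.

Lemma Im_csum (a : nat -> C) n : Im (csum a (S n)) = sum_n (fun k => Im (a k)) n.
Proof.
  induction n as [|n IH]; [rewrite sum_O; simpl; apply Rplus_0_l|].
  rewrite sum_Sn, <- IH; reflexivity.
Qed.

Lemma Csum_lim a l :
  Csum a l <-> filterlim (csum a) eventually (locally (T := C_NormedModule) l).
Proof.
  split; intros H.
  - intros P HP; destruct (H P HP) as [N HN].
    exists (S N); intros [|n] Hn; [lia|].
    rewrite <- csum_sum_n; apply HN; lia.
  - apply filterlim_ext with (fun n => csum a (S n));
      [intros n; symmetry; apply csum_sum_n|].
    intros P HP; destruct (H P HP) as [N HN].
    exists N; intros n Hn; apply HN; lia.
Qed.

Lemma Csum_iff a l :
  Csum a l <->
  is_series (fun n => Re (a n)) (Re l) /\ is_series (fun n => Im (a n)) (Im l).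
Proof.
  rewrite Csum_lim; split.
  - intros H; split.
    + apply filterlim_ext with (1 := Re_csum a).
      intros P [eps HP].
      destruct (H (fun y => P (Re y))) as [N HN];
        [exists eps; intros y [Hy _]; apply HP, Hy|].
      exists N; intros n Hn; apply HN; lia.
    + apply filterlim_ext with (1 := Im_csum a).
      intros P [eps HP].
      destruct (H (fun y => P (Im y))) as [N HN];
        [exists eps; intros y [_ Hy]; apply HP, Hy|].
      exists N; intros n Hn; apply HN; lia.
  - intros [H1 H2] P [eps HP].
    assert (E1 := H1 _ (locally_ball (Re l) eps)).
    assert (E2 := H2 _ (locally_ball (Im l) eps)).
    destruct E1 as [n1 E1], E2 as [n2 E2].
    exists (S (max n1 n2)); intros [|n] Hn; [lia|]; apply HP; split.
    + specialize (E1 n ltac:(lia)); rewrite <- Re_csum in E1; exact E1.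
    + specialize (E2 n ltac:(lia)); rewrite <- Im_csum in E2; exact E2.
Qed.

Lemma Csum_ext a b l : (forall n, a n = b n) -> Csum a l -> Csum b l.
Proof. intros H; apply is_series_ext, H. Qed.

Lemma Csum_unique a l l' : Csum a l -> Csum a l' -> l = l'.
Proof.
  intros H1%Csum_iff H2%Csum_iff.
  destruct H1 as [H1 H1'], H2 as [H2 H2'], l as [x y], l' as [x' y']; simpl in *.
  rewrite <- (is_series_unique _ _ H1), <- (is_series_unique _ _ H1').
  rewrite (is_series_unique _ _ H2), (is_series_unique _ _ H2'); reflexivity.
Qed.

Lemma Csum_plus a b l m :
  Csum a l -> Csum b m -> Csum (fun n => a n + b n)%C (l + m)%C.
Proof. apply (is_series_plus (V := C_NormedModule)). Qed.

Lemma Csum_scal c a l : Csum a l -> Csum (fun n => c * a n)%C (c * l)%C.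
Proof. apply (is_series_scal (V := C_NormedModule)). Qed.

Lemma Csum_scal_r c a l : Csum a l -> Csum (fun n => a n * c)%C (l * c)%C.
Proof.
  intros H; rewrite Cmult_comm.
  apply Csum_ext with (fun n => c * a n)%C; [intros n; ring|].
  now apply Csum_scal.
Qed.

Lemma Csum_minus a b l m :
  Csum a l -> Csum b m -> Csum (fun n => a n - b n)%C (l - m)%C.
Proof. apply (is_series_minus (V := C_NormedModule)). Qed.

Lemma Csum_decr a l : Csum (fun n => a (S n)) l -> Csum a (a O + l)%C.
Proof.
  intros H; rewrite Cplus_comm.
  apply (is_series_decr_1 (V := C_NormedModule) a).
  replace (plus _ _) with l; [exact H|].
  unfold plus, opp; simpl; ring.
Qed.

Lemma Csum_incr a l : Csum a l -> Csum (fun n => a (S n)) (l - a O)%C.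
Proof.
  intros H; apply (is_series_incr_1 (V := C_NormedModule) a).
  replace (plus _ _) with l; [exact H|].
  unfold plus; simpl; ring.
Qed.

Lemma Csum_abs a : ex_series (fun n => Cmod (a n)) -> exists l, Csum a l.
Proof.
  intros H.
  assert (H1 : ex_series (fun n => Re (a n))).
  { apply (ex_series_le (V := R_CompleteNormedModule) _ (fun n => Cmod (a n)));
      [intros n; apply re_le_Cmod | exact H]. }
  assert (H2 : ex_series (fun n => Im (a n))).
  { apply (ex_series_le (V := R_CompleteNormedModule) _ (fun n => Cmod (a n)));
      [|exact H].
    intros n; eapply Rle_trans; [|apply Rmax_Cmod]; apply Rmax_r. }
  destruct H1 as [x H1], H2 as [y H2].
  exists (x, y); apply Csum_iff; split; assumption.
Qed.

Lemma Csum_abs_le a b :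
  (forall n, Cmod (a n) <= b n) -> ex_series b -> exists l, Csum a l.
Proof.
  intros H Hb; apply Csum_abs.
  apply (ex_series_le (V := R_CompleteNormedModule) _ b); [|exact Hb].
  intros n; unfold norm; simpl; unfold abs; simpl.
  rewrite Rabs_pos_eq by apply Cmod_ge_0; apply H.
Qed.

Lemma Csum_finite (a : nat -> C) N : (forall n, (N <= n)%nat -> a n = 0%C) -> Csum a (csum a N).
Proof.
  intros H; apply Csum_lim.
  apply filterlim_ext_loc with (fun _ => csum a N); [|apply filterlim_const].
  exists N; intros n Hn; induction Hn as [|n Hn IH]; [reflexivity|].
  simpl; rewrite <- IH, H by lia; ring.
Qed.

(** A convergent series keeps its sum when only some of its partial sums are
    known, since these form a subsequence. *)
Lemma Csum_subseq a (phi : nat -> nat) (u : nat -> C) l :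
  (exists m, Csum a m) -> (forall n, (phi n < phi (S n))%nat) ->
  (forall n, csum a (phi n) = u n) ->
  filterlim u eventually (locally (T := C_NormedModule) l) -> Csum a l.
Proof.
  intros [m Hm] Hphi Hu Hl.
  replace l with m; [exact Hm|].
  apply (filterlim_locally_unique (F := eventually) (V := C_NormedModule) u);
    [|exact Hl].
  apply filterlim_ext with (1 := Hu).
  apply filterlim_comp with (g := csum a) (2 := proj1 (Csum_lim a m) Hm).
  apply eventually_subseq, Hphi.
Qed.

Lemma is_series_Rabs_le (a b : nat -> R) la lb :
  is_series a la -> is_series b lb -> (forall n, Rabs (a n) <= b n) -> Rabs la <= lb.
Proof.
  intros Ha Hb Hab.
  rewrite <- (is_series_unique _ _ Ha), <- (is_series_unique _ _ Hb).
  eapply Rle_trans; [apply Series_Rabs|].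
  - apply (ex_series_le (V := R_CompleteNormedModule) _ b); [|now exists lb].
    intros n; change (Rabs (Rabs (a n)) <= b n); now rewrite Rabs_Rabsolu.
  - apply Series_le; [|now exists lb].
    intros n; split; [apply Rabs_pos | apply Hab].
Qed.

Lemma is_series_sum_n (x : nat -> nat -> R) (c : nat -> R) n :
  (forall i, is_series (x i) (c i)) ->
  is_series (fun j => sum_n (fun i => x i j) n) (sum_n c n).
Proof.
  intros H; induction n as [|n IH].
  - rewrite sum_O; apply is_series_ext with (x O); [intros j; now rewrite sum_O|].
    apply H.
  - rewrite sum_Sn.
    apply is_series_ext with (fun j => plus (sum_n (fun i => x i j) n) (x (S n) j)).
    + intros j; now rewrite sum_Sn.
    + apply (is_series_plus (V := R_NormedModule) (fun j => sum_n (fun i => x i j) n));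
        [exact IH | apply H].
Qed.

(** The sum over the first rows is the series of truncated columns, and the
    remaining part of the columns is at most the tail of [sum u] times [sum v]. *)
Lemma Rfubini (x : nat -> nat -> R) (u v r c : nat -> R) (l : R) :
  (forall i j, Rabs (x i j) <= u i * v j) -> ex_series u -> ex_series v ->
  (forall i, is_series (x i) (r i)) -> (forall j, is_series (fun i => x i j) (c j)) ->
  is_series c l -> is_series r l.
Proof.
  intros Hx [U HU] [V HV] Hr Hc Hl.
  apply (filterlim_locally (F := eventually)); intros eps.
  assert (Hlim : is_lim_seq (fun n => (U - sum_n u n) * V) 0).
  { replace (Finite 0) with (Rbar_mult (U - U) V) by (simpl; f_equal; ring).
    apply is_lim_seq_scal_r, is_lim_seq_minus'; [apply is_lim_seq_const | exact HU]. }
  apply is_lim_seq_spec in Hlim; destruct (Hlim eps) as [N HN].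
  exists N; intros n Hn; specialize (HN n Hn); rewrite Rminus_0_r in HN.
  change (Rabs (sum_n r n - l) < eps).
  eapply Rle_lt_trans; [|apply Rle_lt_trans with (1 := Rle_abs _), HN].
  rewrite Rabs_minus_sym.
  apply (is_series_Rabs_le (fun j => c j - sum_n (fun i => x i j) n)
           (fun j => (U - sum_n u n) * v j)).
  - apply (is_series_minus c); [exact Hl | now apply is_series_sum_n].
  - apply (is_series_scal (U - sum_n u n) v V HV).
  - intros j.
    apply (is_series_Rabs_le (fun k => x (S n + k)%nat j) (fun k => u (S n + k)%nat * v j)).
    + apply (is_series_incr_n (fun i => x i j)); [lia|].
      replace (plus _ _) with (c j); [apply Hc|].
      change (@eq R (c j) (c j - sum_n (fun i => x i j) n + sum_n (fun i => x i j) n)%R); lra.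
    + apply is_series_ext with (fun k => v j * u (S n + k)%nat); [intros k; apply Rmult_comm|].
      rewrite Rmult_comm.
      apply (is_series_scal (V := R_NormedModule) (v j) (fun k => u (S n + k)%nat)).
      apply is_series_incr_n; [lia|].
      replace (plus _ _) with U; [exact HU|].
      change (@eq R U (U - sum_n u n + sum_n u n)); lra.
    + intros k; apply Hx.
Qed.

Lemma Csum_fubini (x : nat -> nat -> C) (u v : nat -> R) r c l :
  (forall i j, Cmod (x i j) <= u i * v j) -> ex_series u -> ex_series v ->
  (forall i, Csum (x i) (r i)) -> (forall j, Csum (fun i => x i j) (c j)) ->
  Csum c l -> Csum r l.
Proof.
  intros Hx Hu Hv Hr Hc Hl.
  apply Csum_iff in Hl; destruct Hl as [Hl1 Hl2].
  apply Csum_iff; split.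
  - apply (Rfubini (fun i j => Re (x i j)) u v _ (fun j => Re (c j))); trivial.
    + intros i j; eapply Rle_trans; [apply re_le_Cmod | apply Hx].
    + intros i; apply (proj1 (Csum_iff _ _) (Hr i)).
    + intros j; apply (proj1 (Csum_iff _ _) (Hc j)).
  - apply (Rfubini (fun i j => Im (x i j)) u v _ (fun j => Im (c j))); trivial.
    + intros i j; eapply Rle_trans; [|apply Hx].
      eapply Rle_trans; [|apply Rmax_Cmod]; apply Rmax_r.
    + intros i; apply (proj1 (Csum_iff _ _) (Hr i)).
    + intros j; apply (proj1 (Csum_iff _ _) (Hc j)).
Qed.

(** * Estimates for trigonometric and hyperbolic functions *)

Lemma ge0_of_deriv (f df : R -> R) B :
  (forall x, 0 <= x <= B -> is_derive f x (df x)) ->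
  (forall x, 0 <= x <= B -> 0 <= df x) -> f 0 = 0 ->
  forall x, 0 <= x <= B -> 0 <= f x.
Proof.
  intros Hd Hp H0 x Hx.
  destruct (MVT_gen f 0 x df) as [c [Hc E]].
  - intros y Hy; rewrite Rmin_left, Rmax_right in Hy by lra; apply Hd; lra.
  - intros y Hy; rewrite Rmin_left, Rmax_right in Hy by lra.
    apply continuity_pt_filterlim, (ex_derive_continuous (V := R_NormedModule) f).
    exists (df y); apply Hd; lra.
  - rewrite Rmin_left, Rmax_right in Hc by lra.
    specialize (Hp c ltac:(lra)); nra.
Qed.

Lemma sin_le_id x : 0 <= x -> sin x <= x.
Proof.
  intros Hx.
  enough (0 <= x - sin x) by lra.
  apply (ge0_of_deriv (fun x => x - sin x) (fun x => 1 - cos x) x); try lra.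
  - intros y Hy; auto_derive; [easy | ring].
  - intros y Hy; pose proof (COS_bound y); lra.
  - rewrite sin_0; ring.
Qed.

Lemma cos_ge_quad x : 0 <= x -> 0 <= cos x - 1 + x ^ 2 / 2.
Proof.
  intros Hx.
  apply (ge0_of_deriv (fun x => cos x - 1 + x ^ 2 / 2) (fun x => x - sin x) x); try lra.
  - intros y Hy; auto_derive; [easy | field].
  - intros y Hy; pose proof (sin_le_id y ltac:(lra)); lra.
  - rewrite cos_0; field.
Qed.

Lemma sin_ge_cubic x : 0 <= x -> 0 <= sin x - x + x ^ 3 / 6.
Proof.
  intros Hx.
  apply (ge0_of_deriv (fun x => sin x - x + x ^ 3 / 6)
           (fun x => cos x - 1 + x ^ 2 / 2) x); try lra.
  - intros y Hy; auto_derive; [easy | field].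
  - intros y Hy; apply cos_ge_quad; lra.
  - rewrite sin_0; field.
Qed.

Lemma cos_le_quartic x : 0 <= x -> 0 <= 1 - x ^ 2 / 2 + x ^ 4 / 24 - cos x.
Proof.
  intros Hx.
  apply (ge0_of_deriv (fun x => 1 - x ^ 2 / 2 + x ^ 4 / 24 - cos x)
           (fun x => sin x - x + x ^ 3 / 6) x); try lra.
  - intros y Hy; auto_derive; [easy | field].
  - intros y Hy; apply sin_ge_cubic; lra.
  - rewrite cos_0; field.
Qed.

Lemma cosh_0 : cosh 0 = 1.
Proof. unfold cosh; rewrite Ropp_0, exp_0; field. Qed.

Lemma sinh_0 : sinh 0 = 0.
Proof. unfold sinh; rewrite Ropp_0, exp_0; field. Qed.

Lemma cosh_ge_1 x : 0 <= cosh x - 1.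
Proof.
  unfold cosh; pose proof (exp_pos x); pose proof (exp_pos (- x)).
  assert (exp x * exp (- x) = 1) by (rewrite <- exp_plus, Rplus_opp_r; apply exp_0).
  apply Rmult_le_reg_l with (1 := H).
  pose proof (Rle_0_sqr (exp x - 1)); unfold Rsqr in *; nra.
Qed.

Lemma sinh_ge_id x : 0 <= x -> 0 <= sinh x - x.
Proof.
  intros Hx.
  apply (ge0_of_deriv (fun x => sinh x - x) (fun x => cosh x - 1) x); try lra.
  - intros y Hy; unfold sinh, cosh; auto_derive; [easy | field].
  - intros y Hy; apply cosh_ge_1.
  - rewrite sinh_0; ring.
Qed.

Lemma cosh_ge_quad x : 0 <= x -> 0 <= cosh x - 1 - x ^ 2 / 2.
Proof.
  intros Hx.
  apply (ge0_of_deriv (fun x => cosh x - 1 - x ^ 2 / 2) (fun x => sinh x - x) x); try lra.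
  - intros y Hy; unfold sinh, cosh; auto_derive; [easy | field].
  - intros y Hy; apply sinh_ge_id; lra.
  - rewrite cosh_0; field.
Qed.

Lemma cosh_le_2 x : 0 <= x <= 1 -> cosh x <= 2.
Proof.
  intros Hx; unfold cosh.
  assert (exp x <= 3).
  { eapply Rle_trans; [|apply exp_le_3].
    destruct (proj2 Hx) as [H| ->]; [left; now apply exp_increasing | lra]. }
  assert (exp (- x) <= 1).
  { destruct (proj1 Hx) as [H1| <-]; [|rewrite Ropp_0, exp_0; lra].
    left; rewrite <- exp_0; apply exp_increasing; lra. }
  lra.
Qed.

Lemma sinh_le_2 x : 0 <= x <= 1 -> 0 <= 2 * x - sinh x.
Proof.
  intros Hx.
  apply (ge0_of_deriv (fun x => 2 * x - sinh x) (fun x => 2 - cosh x) 1); try lra.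
  - intros y Hy; unfold sinh, cosh; auto_derive; [easy | field].
  - intros y Hy; pose proof (cosh_le_2 y Hy); lra.
  - rewrite sinh_0; ring.
Qed.

Lemma cosh_le_quad x : 0 <= x <= 1 -> 0 <= 1 + x ^ 2 - cosh x.
Proof.
  intros Hx.
  apply (ge0_of_deriv (fun x => 1 + x ^ 2 - cosh x) (fun x => 2 * x - sinh x) 1); try lra.
  - intros y Hy; unfold sinh, cosh; auto_derive; [easy | field].
  - intros y Hy; pose proof (sinh_le_2 y Hy); lra.
  - rewrite cosh_0; field.
Qed.

Lemma sinh_le_cubic x : 0 <= x <= 1 -> 0 <= x + x ^ 3 / 3 - sinh x.
Proof.
  intros Hx.
  apply (ge0_of_deriv (fun x => x + x ^ 3 / 3 - sinh x) (fun x => 1 + x ^ 2 - cosh x) 1);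
    try lra.
  - intros y Hy; unfold sinh, cosh; auto_derive; [easy | field].
  - intros y Hy; pose proof (cosh_le_quad y Hy); lra.
  - rewrite sinh_0; field.
Qed.

Lemma cosh_le_quartic x : 0 <= x <= 1 -> 0 <= 1 + x ^ 2 / 2 + x ^ 4 / 12 - cosh x.
Proof.
  intros Hx.
  apply (ge0_of_deriv (fun x => 1 + x ^ 2 / 2 + x ^ 4 / 12 - cosh x)
           (fun x => x + x ^ 3 / 3 - sinh x) 1); try lra.
  - intros y Hy; unfold sinh, cosh; auto_derive; [easy | field].
  - intros y Hy; pose proof (sinh_le_cubic y Hy); lra.
  - rewrite cosh_0; field.
Qed.

(** The two components of [2 cos (x + i t) - 2 + (x + i t)^2]. *)
Lemma cos_taylor_re x t : 0 <= x -> 0 <= t <= 1 ->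
  Rabs (2 * cosh t * cos x - 2 + x ^ 2 - t ^ 2) <= (x ^ 2 + t ^ 2) ^ 2.
Proof.
  intros Hx Ht.
  pose proof (cosh_le_quartic t Ht); pose proof (cosh_ge_quad t ltac:(lra)).
  pose proof (cosh_le_quad t Ht); pose proof (cosh_ge_1 t).
  pose proof (cos_ge_quad x Hx); pose proof (cos_le_quartic x Hx).
  pose proof (COS_bound x).
  replace (2 * cosh t * cos x - 2 + x ^ 2 - t ^ 2) with
    (- (2 * (cosh t - 1) * (1 - cos x)) + 2 * (cosh t - 1 - t ^ 2 / 2)
     + 2 * (cos x - 1 + x ^ 2 / 2)) by field.
  assert (0 <= (cosh t - 1) * (1 - cos x) <= t ^ 2 * (x ^ 2 / 2)).
  { split; [apply Rmult_le_pos; lra|]. apply Rmult_le_compat; lra. }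
  assert (0 <= x ^ 4) by (apply pow_le; lra).
  assert (0 <= t ^ 4) by (apply pow_le; lra).
  assert (0 <= t ^ 2 * x ^ 2) by (apply Rmult_le_pos; apply pow_le; lra).
  apply Rabs_le; split; nra.
Qed.

Lemma cos_taylor_im x t : 0 <= x -> 0 <= t <= 1 ->
  Rabs (2 * x * t - 2 * sinh t * sin x) <= (x ^ 2 + t ^ 2) ^ 2.
Proof.
  intros Hx Ht.
  pose proof (sinh_le_cubic t Ht); pose proof (sinh_ge_id t ltac:(lra)).
  pose proof (sinh_le_2 t Ht).
  pose proof (sin_ge_cubic x Hx); pose proof (sin_le_id x Hx).
  replace (2 * x * t - 2 * sinh t * sin x) with
    (- (2 * (x * (sinh t - t))) + 2 * (sinh t * (x - sin x))) by ring.
  assert (0 <= x * (sinh t - t) <= x * (t ^ 3 / 3)).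
  { split; [apply Rmult_le_pos; lra | apply Rmult_le_compat_l; lra]. }
  assert (0 <= sinh t * (x - sin x) <= 2 * t * (x ^ 3 / 6)).
  { split; [apply Rmult_le_pos; lra | apply Rmult_le_compat; lra]. }
  assert (0 <= x * t) by nra.
  assert (0 <= t * t * (x * t) <= t ^ 4 + x ^ 2 * t ^ 2).
  { assert (0 <= x * t * (t * t)) by (apply Rmult_le_pos; nra).
    pose proof (Rmult_le_pos _ _ (Rle_0_sqr t) (Rle_0_sqr (x - t))); unfold Rsqr in *.
    assert (0 <= t * t * (x * x)) by nra.
    split; nra. }
  assert (0 <= x * x * (x * t) <= x ^ 4 + x ^ 2 * t ^ 2).
  { assert (0 <= x * t * (x * x)) by (apply Rmult_le_pos; nra).
    pose proof (Rmult_le_pos _ _ (Rle_0_sqr x) (Rle_0_sqr (x - t))); unfold Rsqr in *.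
    assert (0 <= x * x * (t * t)) by nra.
    split; nra. }
  assert (0 <= x ^ 4) by (apply pow_le; lra).
  assert (0 <= t ^ 4) by (apply pow_le; lra).
  apply Rabs_le; split; nra.
Qed.

(** The right-hand side is the modulus of [2 cos (x + i t) - 2].  The bound on [x] is a
    little larger than [PI], which leaves room for arguments slightly outside of a
    period centred at 0. *)
Lemma cos_far_from_1 x t : 0 <= x <= 15 / 4 -> 0 <= t ->
  (x ^ 2 + t ^ 2) / 8 <= 2 * cosh t - 2 * cos x.
Proof.
  intros Hx Ht.
  pose proof (cosh_ge_quad t Ht).
  pose proof (sin_ge_cubic (x / 2) ltac:(lra)).
  assert (E : cos x = 1 - 2 * sin (x / 2) * sin (x / 2)).
  { rewrite <- cos_2a_sin; f_equal; field. }
  assert (2 / 5 * (x / 2) <= sin (x / 2)).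
  { assert (0 <= x / 2 * (3 / 5 - (x / 2) ^ 2 / 6)) by (apply Rmult_le_pos; nra).
    nra. }
  assert (x * x / 25 <= sin (x / 2) * sin (x / 2)) by nra.
  rewrite E; nra.
Qed.

(** * The exponential and the square of the cosecant *)

Lemma C_eq (z w : C) : Re z = Re w -> Im z = Im w -> z = w.
Proof. destruct z, w; simpl; congruence. Qed.

Lemma e2pi_plus z w : e2pi (z + w) = (e2pi z * e2pi w)%C.
Proof.
  destruct z as [a b], w as [c d]; unfold e2pi; simpl.
  replace (-2 * PI * (b + d)) with (-2 * PI * b + -2 * PI * d) by ring.
  replace (2 * PI * (a + c)) with (2 * PI * a + 2 * PI * c) by ring.
  rewrite exp_plus, cos_plus, sin_plus.
  apply C_eq; simpl; ring.
Qed.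

Lemma e2pi_0 : e2pi 0 = 1%C.
Proof.
  unfold e2pi; simpl; rewrite !Rmult_0_r, exp_0, cos_0, sin_0.
  apply C_eq; simpl; ring.
Qed.

Lemma e2pi_opp_mult z : (e2pi z * e2pi (- z))%C = 1%C.
Proof. rewrite <- e2pi_plus, <- e2pi_0; f_equal; ring. Qed.

Lemma e2pi_neq_0 z : e2pi z <> 0%C.
Proof.
  intros H; apply C1_nz; rewrite <- (e2pi_opp_mult z), H; ring.
Qed.

Lemma e2pi_opp z : e2pi (- z) = (/ e2pi z)%C.
Proof.
  pose proof (e2pi_neq_0 z); pose proof (e2pi_opp_mult z) as E.
  rewrite <- (Cmult_1_l (/ _)), <- E; field; assumption.
Qed.

Lemma Cmod_e2pi z : Cmod (e2pi z) = exp (- 2 * PI * Im z).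
Proof.
  unfold e2pi, Cmod; cbn [fst snd].
  set (e := exp _); set (t := 2 * PI * Re z).
  replace (_ + _) with (e ^ 2 * ((sin t)² + (cos t)²)) by (unfold Rsqr; ring).
  rewrite sin2_cos2, Rmult_1_r; apply sqrt_pow2.
  left; apply exp_pos.
Qed.

Lemma e2pi_nat n z : e2pi (RtoC (INR n) * z) = (e2pi z ^ n)%C.
Proof.
  induction n as [|n IH]; [simpl; rewrite <- e2pi_0; f_equal; ring|].
  rewrite S_INR, RtoC_plus; simpl Cpow.
  rewrite <- IH, <- e2pi_plus; f_equal; ring.
Qed.

Lemma e2pi_1 : e2pi 1 = 1%C.
Proof.
  unfold e2pi; simpl; rewrite !Rmult_0_r, !Rmult_1_r, exp_0, cos_2PI, sin_2PI.
  apply C_eq; simpl; ring.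
Qed.

Lemma CZ_nat n : CZ (Z.of_nat n) = RtoC (INR n).
Proof. unfold CZ; now rewrite INR_IZR_INZ. Qed.

Lemma CZ_plus m n : CZ (m + n) = (CZ m + CZ n)%C.
Proof. unfold CZ; now rewrite plus_IZR, RtoC_plus. Qed.

Lemma CZ_opp n : CZ (- n) = (- CZ n)%C.
Proof. unfold CZ; now rewrite opp_IZR, RtoC_opp. Qed.

Lemma CZ_minus m n : CZ (m - n) = (CZ m - CZ n)%C.
Proof. unfold Z.sub; rewrite CZ_plus, CZ_opp; reflexivity. Qed.

Lemma CZ_mult m n : CZ (m * n) = (CZ m * CZ n)%C.
Proof. unfold CZ; now rewrite mult_IZR, RtoC_mult. Qed.

Lemma e2pi_Z n : e2pi (CZ n) = 1%C.
Proof.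
  assert (H : forall k, e2pi (CZ (Z.of_nat k)) = 1%C).
  { intros k; rewrite CZ_nat.
    replace (RtoC (INR k)) with (RtoC (INR k) * 1)%C by ring.
    rewrite e2pi_nat, e2pi_1; apply Cpow_1_l. }
  destruct (Z_le_gt_dec 0 n) as [Hn|Hn].
  - rewrite <- (Z2Nat.id n Hn); apply H.
  - replace n with (- Z.of_nat (Z.to_nat (- n)))%Z by lia.
    rewrite CZ_opp, e2pi_opp, H; field.
Qed.

Lemma e2pi_period z n : e2pi (z + CZ n) = e2pi z.
Proof. rewrite e2pi_plus, e2pi_Z; ring. Qed.

Definition nonint (z : C) : Prop := forall k : Z, z <> CZ k.

Lemma e2pi_eq_1 z : e2pi z = 1%C -> exists k : Z, z = CZ k.
Proof.
  intros H.
  assert (Hm : Cmod (e2pi z) = 1) by (rewrite H; apply Cmod_1).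
  rewrite Cmod_e2pi in Hm.
  assert (Him : Im z = 0).
  { rewrite <- exp_0 in Hm; apply exp_inv in Hm.
    pose proof PI_RGT_0; nra. }
  assert (Hc : cos (2 * PI * Re z) = 1).
  { apply (f_equal fst) in H; unfold e2pi in H; simpl in H.
    rewrite Him, Rmult_0_r, exp_0, Rmult_1_l in H; exact H. }
  replace (2 * PI * Re z) with (2 * (PI * Re z)) in Hc by ring.
  rewrite cos_2a_sin in Hc.
  assert (Hs : sin (PI * Re z) = 0) by nra.
  apply sin_eq_0_0 in Hs; destruct Hs as [k Hk]; exists k.
  apply C_eq; simpl; [|exact Him].
  pose proof PI_RGT_0; apply Rmult_eq_reg_l with PI; lra.
Qed.

Lemma nonint_e2pi z : nonint z -> e2pi z <> 1%C.
Proof. intros H E; destruct (e2pi_eq_1 z E) as [k Hk]; exact (H k Hk). Qed.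

(** This is [- 1 / (4 sin^2 (pi z))], which has period 1 and a double pole at each
    integer; written in terms of [e (z)] it has an evident expansion in the upper
    half plane. *)
Definition gfun (z : C) : C := (e2pi z / (1 - e2pi z) ^ 2)%C.

Lemma gfun_period z n : gfun (z + CZ n) = gfun z.
Proof. unfold gfun; now rewrite e2pi_period. Qed.

Lemma gfun_opp z : nonint z -> gfun (- z) = gfun z.
Proof.
  intros H; apply nonint_e2pi in H; unfold gfun; rewrite e2pi_opp.
  pose proof (e2pi_neq_0 z).
  field; repeat split; trivial; intros E; apply H.
  - replace (e2pi z) with (1 - (1 - e2pi z))%C by ring; rewrite E; ring.
  - replace (e2pi z) with (1 + (e2pi z - 1))%C by ring; rewrite E; ring.
Qed.

Lemma gfun_duplication z : nonint z ->
  gfun z = ((gfun (z / 2) + gfun ((z + 1) / 2)) / 4)%C.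
Proof.
  intros H; apply nonint_e2pi in H.
  assert (E1 : e2pi z = (e2pi (z / 2) * e2pi (z / 2))%C).
  { rewrite <- e2pi_plus; f_equal; field. }
  assert (E2 : e2pi ((z + 1) / 2) = (- e2pi (z / 2))%C).
  { replace ((z + 1) / 2)%C with (z / 2 + / 2)%C by field.
    rewrite e2pi_plus.
    replace (e2pi (/ 2)) with (- (1))%C; [ring|].
    unfold e2pi; simpl.
    replace (2 * PI * (2 / (2 * (2 * 1) + 0 * (0 * 1)))) with PI by field.
    replace (-2 * PI * (- 0 / (2 * (2 * 1) + 0 * (0 * 1)))) with 0 by field.
    rewrite exp_0, cos_PI, sin_PI; apply C_eq; simpl; ring. }
  unfold gfun; rewrite E2, E1; rewrite E1 in H.
  clear E1 E2; generalize dependent (e2pi (z / 2)); intros y H.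
  assert (H1 : (1 - y)%C <> 0%C).
  { intros E; apply H; replace y with (1 - (1 - y))%C by ring; rewrite E; ring. }
  assert (H2 : (1 + y)%C <> 0%C).
  { intros E; apply H; replace y with ((1 + y) - 1)%C by ring; rewrite E; ring. }
  field; repeat split; trivial.
  - intros E; apply H2; rewrite <- E; ring.
  - intros E; apply (Cmult_neq_0 _ _ H1 H2); rewrite <- E; ring.
Qed.

Lemma cosh_opp t : cosh (- t) = cosh t.
Proof. unfold cosh; rewrite Ropp_involutive; lra. Qed.

Lemma sinh_opp t : sinh (- t) = - sinh t.
Proof. unfold sinh; rewrite Ropp_involutive; lra. Qed.

Lemma cosh_sinh_sq t : sinh t * sinh t = cosh t * cosh t - 1.
Proof.
  unfold cosh, sinh.
  assert (exp t * exp (- t) = 1) by (rewrite <- exp_plus, Rplus_opp_r; apply exp_0).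
  nra.
Qed.

Lemma e2pi_sym z : let x := 2 * PI * Re z in let t := 2 * PI * Im z in
  (e2pi z + e2pi (- z) - 2)%C = (2 * cosh t * cos x - 2, - 2 * sinh t * sin x).
Proof.
  intros x t; destruct z as [a b]; unfold e2pi; simpl in *.
  replace (-2 * PI * - b) with t by (unfold t; ring).
  replace (-2 * PI * b) with (- t) by (unfold t; ring).
  replace (2 * PI * - a) with (- x) by (unfold x; ring).
  replace (2 * PI * a) with x by (unfold x; ring).
  rewrite cos_neg, sin_neg; unfold cosh, sinh.
  apply C_eq; simpl; field.
Qed.

Lemma gfun_inv z : e2pi z <> 1%C -> gfun z = (/ (e2pi z + e2pi (- z) - 2))%C.
Proof.
  intros H; unfold gfun; rewrite e2pi_opp.
  pose proof (e2pi_neq_0 z).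
  assert (H1 : (1 - e2pi z)%C <> 0%C).
  { intros E; apply H; replace (e2pi z) with (1 - (1 - e2pi z))%C by ring.
    rewrite E; ring. }
  field; repeat split; trivial.
  intros E; apply (Cmult_neq_0 _ _ H1 H1); rewrite <- E; ring.
Qed.

Lemma Cmod_le_Re_Im (z : C) B : Rabs (Re z) <= B -> Rabs (Im z) <= B -> Cmod z <= 2 * B.
Proof.
  intros H1 H2; replace z with (RtoC (Re z) + Ci * RtoC (Im z))%C.
  - eapply Rle_trans; [apply Cmod_triangle|].
    rewrite Cmod_mult, !Cmod_R, Cmod_Ci; lra.
  - apply C_eq; simpl; ring.
Qed.

(** In a neighbourhood of a whole period centred at 0, only the double pole at 0 prevents
    [gfun] from being bounded.  The value 16 of the bound is of no importance. *)
Lemma gfun_near_0 (z : C) : z <> 0%C ->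
  Rabs (2 * PI * Re z) <= 15 / 4 -> Rabs (2 * PI * Im z) <= 1 ->
  Cmod (gfun z + / (RtoC (4 * PI ^ 2) * z ^ 2)) <= 16.
Proof.
  intros Hz.
  pose proof (e2pi_sym z) as Hc; simpl in Hc.
  set (x := 2 * PI * Re z) in *; set (t := 2 * PI * Im z) in *.
  intros Hx Ht.
  assert (Ecosh : cosh t = cosh (Rabs t)).
  { unfold Rabs; destruct (Rcase_abs t); [now rewrite cosh_opp | reflexivity]. }
  assert (Ecos : cos x = cos (Rabs x)).
  { unfold Rabs; destruct (Rcase_abs x); [now rewrite cos_neg | reflexivity]. }
  assert (Px : x ^ 2 = Rabs x ^ 2) by (symmetry; apply pow2_abs).
  assert (Pt : t ^ 2 = Rabs t ^ 2) by (symmetry; apply pow2_abs).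
  rewrite <- (Rabs_Rabsolu x) in Hx; rewrite <- (Rabs_Rabsolu t) in Ht.
  pose proof (Rabs_pos x) as Hx0; pose proof (Rabs_pos t) as Ht0.
  rewrite Rabs_pos_eq in Hx by trivial; rewrite Rabs_pos_eq in Ht by trivial.
  assert (Hre := cos_taylor_re (Rabs x) (Rabs t) Hx0 (conj Ht0 Ht)).
  assert (Him := cos_taylor_im (Rabs x) (Rabs t) Hx0 (conj Ht0 Ht)).
  assert (Hfar := cos_far_from_1 (Rabs x) (Rabs t) (conj Hx0 Hx) Ht0).
  rewrite <- Ecosh, <- Ecos, <- Px, <- Pt in Hre.
  rewrite <- Ecosh, <- Ecos, <- Px, <- Pt in Hfar.
  rewrite <- Px, <- Pt in Him.
  assert (Him' : Rabs (2 * x * t - 2 * sinh t * sin x) <= (x ^ 2 + t ^ 2) ^ 2).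
  { eapply Rle_trans; [|exact Him]; apply Req_le.
    destruct (Rcase_abs x) as [hx|hx];
      [rewrite (Rabs_left x hx), sin_neg | rewrite (Rabs_right x hx)];
      (destruct (Rcase_abs t) as [ht|ht];
        [rewrite (Rabs_left t ht), sinh_opp | rewrite (Rabs_right t ht)]);
      [|rewrite <- Rabs_Ropp|rewrite <- Rabs_Ropp|]; f_equal; ring. }
  clear Him Hx0 Ht0 Hx Ht Px Pt.
  set (c := (e2pi z + e2pi (- z) - 2)%C) in *.
  set (n2 := x ^ 2 + t ^ 2) in *.
  pose proof PI_RGT_0 as Hpi.
  assert (En2 : n2 = 4 * PI ^ 2 * (Cmod z * Cmod z)).
  { replace (Cmod z * Cmod z) with (Cmod z ^ 2) by ring; rewrite Cmod2_alt.
    unfold n2, x, t; ring. }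
  apply Cmod_gt_0 in Hz.
  assert (Hn2 : 0 < n2) by (rewrite En2; apply Rmult_lt_0_compat; nra).
  assert (Hcm : n2 / 8 <= Cmod c).
  { replace (Cmod c) with (2 * cosh t - 2 * cos x); [exact Hfar|].
    rewrite <- (sqrt_pow2 (2 * cosh t - 2 * cos x)) by lra.
    unfold Cmod; f_equal; rewrite Hc; cbn [fst snd].
    pose proof (cosh_sinh_sq t); pose proof (sin2_cos2 x); unfold Rsqr in *.
    replace ((-2 * sinh t * sin x) ^ 2) with (4 * (sinh t * sinh t) * (sin x * sin x)) by ring.
    rewrite H; replace (sin x * sin x) with (1 - cos x * cos x) by lra; ring. }
  assert (Hc0 : c <> 0%C) by (apply Cmod_gt_0; lra).
  assert (Hz0 : z <> 0%C) by (apply Cmod_gt_0; lra).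
  assert (Hp : RtoC (4 * PI ^ 2) <> 0%C) by (intros E; apply RtoC_inj in E; nra).
  assert (He : e2pi z <> 1%C).
  { intros E; apply Hc0; unfold c; rewrite e2pi_opp, E.
    apply C_eq; simpl; field. }
  rewrite gfun_inv by exact He; fold c.
  replace (/ c + / (RtoC (4 * PI ^ 2) * z ^ 2))%C
    with ((c + RtoC (4 * PI ^ 2) * z ^ 2) / (c * (RtoC (4 * PI ^ 2) * z ^ 2)))%C
    by (field; auto).
  assert (Hz2 : (z ^ 2)%C <> 0%C) by now apply Cpow_nz.
  rewrite Cmod_div by exact (Cmult_neq_0 _ _ Hc0 (Cmult_neq_0 _ _ Hp Hz2)).
  rewrite !Cmod_mult, Cmod_pow, Cmod_R, Rabs_pos_eq by nra.
  replace (4 * PI ^ 2 * Cmod z ^ 2) with n2 by (rewrite En2; ring).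
  assert (Hnum : Cmod (c + RtoC (4 * PI ^ 2) * z ^ 2) <= 2 * n2 ^ 2).
  { assert (Ez : (RtoC (4 * PI ^ 2) * z ^ 2)%C = (x ^ 2 - t ^ 2, 2 * x * t)).
    { unfold x, t; apply C_eq; simpl; unfold Re, Im; ring. }
    rewrite Ez, Hc.
    apply Cmod_le_Re_Im; cbn [Re Im fst snd Cplus].
    - eapply Rle_trans; [|exact Hre]; apply Req_le; f_equal; ring.
    - eapply Rle_trans; [|exact Him']; apply Req_le; f_equal; ring. }
  apply Rle_div_l; [apply Rmult_lt_0_compat; lra|].
  eapply Rle_trans; [exact Hnum|].
  assert (n2 / 8 * n2 <= Cmod c * n2) by (apply Rmult_le_compat_r; lra).
  nra.
Qed.

(** * Partial fractions *)

Lemma PI_lt : PI < 16 / 5.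
Proof.
  destruct (Rlt_le_dec PI (16 / 5)) as [H|H]; [exact H|exfalso].
  pose proof PI2_3_2.
  assert (0 <= cos (8 / 5)) by (apply cos_ge_0; lra).
  pose proof (cos_le_quartic (8 / 5) ltac:(lra)); lra.
Qed.

Lemma Clim_of_bound (u : nat -> C) (l : C) (v : nat -> R) N :
  (forall n, (N <= n)%nat -> Cmod (u n - l) <= v n) -> is_lim_seq v 0 ->
  filterlim u eventually (locally (T := C_NormedModule) l).
Proof.
  intros H Hv; apply (filterlim_locally (F := eventually)); intros eps.
  apply is_lim_seq_spec in Hv; destruct (Hv eps) as [N' HN'].
  exists (max N N'); intros n Hn.
  apply C_NormedModule_mixin_compat1.
  eapply Rle_lt_trans; [apply (H n); lia|].
  specialize (HN' n ltac:(lia)); rewrite Rminus_0_r in HN'.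
  eapply Rle_lt_trans; [apply Rle_abs | exact HN'].
Qed.

Lemma gfun_duplication' z : nonint z ->
  gfun z = ((gfun (z / 2) + gfun ((z - 1) / 2)) / 4)%C.
Proof.
  intros H; rewrite (gfun_duplication z H); do 2 f_equal.
  rewrite <- (gfun_period _ (-1)); f_equal; unfold CZ; field.
Qed.

Lemma nonint_scale z m : (forall k : Z, z <> CZ (m * k)) ->
  (m <> 0)%Z -> nonint (z / CZ m).
Proof.
  intros H Hm k E; apply (H k); rewrite CZ_mult, <- E; field.
  unfold CZ; intros E'; apply RtoC_inj, eq_IZR in E'; contradiction.
Qed.

(** Iterating the duplication formula expresses [gfun z] as a mean of values at
    the points [(z + k) / 2 ^ (r + 1)] for [k] in a symmetric range. *)
Lemma gfun_average r z : nonint z -> let M := INR (2 ^ r) in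
  gfun z = (csum (fun k => gfun ((z + RtoC (INR k)) / RtoC (2 * M)) +
                           gfun ((z - RtoC (INR k) - 1) / RtoC (2 * M))) (2 ^ r)
            / RtoC (4 * M ^ 2))%C.
Proof.
  intros Hz; induction r as [|r IH].
  - simpl; rewrite (gfun_duplication' z Hz).
    replace ((z + 0) / RtoC (2 * 1))%C with (z / 2)%C
      by (rewrite Rmult_1_r; field).
    replace ((z - 0 - 1) / RtoC (2 * 1))%C with ((z - 1) / 2)%C
      by (rewrite Rmult_1_r; field).
    rewrite !Rmult_1_r; field.
  - intros M'; rewrite IH.
    set (M := INR (2 ^ r)) in *.
    assert (HM : M <> 0).
    { unfold M; apply not_0_INR; pose proof (Nat.pow_nonzero 2 r); lia. }
    assert (HM' : M' = 2 * M) by (unfold M', M; simpl Nat.pow; rewrite plus_INR, Nat.add_0_r; ring).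
    assert (HMc : RtoC M <> 0%C) by (intros E; apply RtoC_inj in E; contradiction).
    replace (2 ^ S r)%nat with (2 ^ r + 2 ^ r)%nat by (simpl; lia).
    set (T := fun k : nat => (gfun ((z + RtoC (INR k)) / RtoC (2 * M')) +
                           gfun ((z - RtoC (INR k) - 1) / RtoC (2 * M')))%C).
    rewrite (csum_add T), (csum_rev (fun k => T (2 ^ r + k)%nat)).
    set (h := fun k => gfun ((z + RtoC k) / RtoC (2 * M'))).
    rewrite (csum_ext _ (fun k => / 4 * ((h (INR k) + h (- INR k - 1)%R)
       + (h (2 * M - 1 - INR k)%R + h (INR k - 2 * M)%R)))%C).
    + rewrite csum_scal, csum_plus.
      rewrite (csum_ext (fun k => h (INR k) + h (- INR k - 1)%R)%C T).
      2:{ intros k _; unfold h, T; do 2 f_equal; rewrite RtoC_minus, RtoC_opp; f_equal; ring. }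
      rewrite (csum_ext (fun k => h (2 * M - 1 - INR k)%R + h (INR k - 2 * M)%R)%C
        (fun k => T (2 ^ r + (2 ^ r - 1 - k))%nat)).
      * rewrite HM', !RtoC_mult, !RtoC_pow, RtoC_mult; field.
        trivial.
      * intros k Hk; unfold h, T.
        assert (E : INR (2 ^ r + (2 ^ r - 1 - k)) = 2 * M - 1 - INR k).
        { rewrite plus_INR, !minus_INR by lia; fold M; simpl; ring. }
        rewrite E; do 2 f_equal; f_equal; rewrite !RtoC_minus; ring.
    + intros k _.
      rewrite (gfun_duplication' ((z + RtoC (INR k)) / RtoC (2 * M))).
      rewrite (gfun_duplication ((z - RtoC (INR k) - 1) / RtoC (2 * M))).
      * unfold h; rewrite HM', !RtoC_minus, RtoC_opp, !RtoC_mult.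
        replace ((z + RtoC (INR k)) / (2 * RtoC M) / 2)%C
          with ((z + RtoC (INR k)) / (2 * (2 * RtoC M)))%C by (field; trivial).
        replace (((z + RtoC (INR k)) / (2 * RtoC M) - 1) / 2)%C
          with ((z + (RtoC (INR k) - 2 * RtoC M)) / (2 * (2 * RtoC M)))%C by (field; trivial).
        replace ((z - RtoC (INR k) - 1) / (2 * RtoC M) / 2)%C
          with ((z + (- RtoC (INR k) - 1)) / (2 * (2 * RtoC M)))%C by (field; trivial).
        replace (((z - RtoC (INR k) - 1) / (2 * RtoC M) + 1) / 2)%C
          with ((z + (2 * RtoC M - 1 - RtoC (INR k))) / (2 * (2 * RtoC M)))%C
          by (field; trivial).
        field.
      * replace (RtoC (2 * M)) with (CZ (2 * Z.of_nat (2 ^ r))) by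
          (rewrite CZ_mult, CZ_nat, RtoC_mult; reflexivity).
        apply nonint_scale; [|pose proof (Nat.pow_nonzero 2 r); lia].
        intros j E; apply (Hz (2 * Z.of_nat (2 ^ r) * j + Z.of_nat k + 1)%Z).
        rewrite !CZ_plus, <- E, CZ_nat; unfold CZ; ring.
      * replace (RtoC (2 * M)) with (CZ (2 * Z.of_nat (2 ^ r))) by
          (rewrite CZ_mult, CZ_nat, RtoC_mult; reflexivity).
        apply nonint_scale; [|pose proof (Nat.pow_nonzero 2 r); lia].
        intros j E; apply (Hz (2 * Z.of_nat (2 ^ r) * j - Z.of_nat k)%Z).
        rewrite CZ_minus, <- E, CZ_nat; ring.
Qed.

Lemma nonint_dist z : nonint z -> exists e, 0 < e /\
  forall k : Z, e <= (Re z + IZR k) ^ 2 + Im z ^ 2.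
Proof.
  intros H; destruct z as [a b]; simpl Re; simpl Im.
  destruct (Req_dec b 0) as [->|Hb].
  - destruct (archimed a) as [H1 H2]; set (n := up a) in *.
    assert (Hn : a <> IZR n - 1).
    { intros E; apply (H (n - 1)%Z); unfold CZ; rewrite minus_IZR, <- E; reflexivity. }
    set (d := Rmin (IZR n - a) (a - (IZR n - 1))).
    assert (Hd : 0 < d) by (apply Rmin_glb_lt; lra).
    pose proof (Rmin_l (IZR n - a) (a - (IZR n - 1))).
    pose proof (Rmin_r (IZR n - a) (a - (IZR n - 1))); fold d in H0, H3.
    exists (d ^ 2); split; [nra|]; intros k.
    destruct (Z_le_gt_dec n (- k)) as [Hk|Hk].
    + apply IZR_le in Hk; rewrite opp_IZR in Hk; nra.
    + assert (Hk' : (- k <= n - 1)%Z) by lia.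
      apply IZR_le in Hk'; rewrite opp_IZR, minus_IZR in Hk'; nra.
  - exists (b ^ 2); split; [apply pow2_gt_0; exact Hb|].
    intros k; pose proof (pow2_ge_0 (a + IZR k)); lra.
Qed.

Lemma Cmod_inv_sq (w : C) : w <> 0%C -> Cmod (/ w ^ 2) = / (Re w ^ 2 + Im w ^ 2).
Proof.
  intros Hw; rewrite Cmod_inv by now apply Cpow_nz.
  now rewrite Cmod_pow, Cmod2_alt.
Qed.

Lemma nonint_bound z : nonint z -> exists D, 0 < D /\
  forall k : Z, Cmod (/ (z + CZ k) ^ 2) <= D * / (1 + IZR k ^ 2).
Proof.
  intros H; destruct (nonint_dist z H) as [e [He Hk]].
  exists (2 + (1 + 2 * Re z ^ 2) / e); split.
  { assert (0 <= (1 + 2 * Re z ^ 2) / e).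
    { apply Rdiv_le_0_compat; [pose proof (pow2_ge_0 (Re z)); lra | exact He]. }
    lra. }
  intros k; specialize (Hk k).
  assert (Hz : (z + CZ k)%C <> 0%C).
  { intros E; apply (H (- k)%Z); rewrite CZ_opp.
    replace z with ((z + CZ k) - CZ k)%C by ring; rewrite E; ring. }
  rewrite Cmod_inv_sq by exact Hz.
  replace (Re (z + CZ k)) with (Re z + IZR k) by reflexivity.
  replace (Im (z + CZ k)) with (Im z) by (simpl; unfold Im; ring).
  set (A := (Re z + IZR k) ^ 2 + Im z ^ 2) in *.
  assert (HA : 1 + IZR k ^ 2 <= (2 + (1 + 2 * Re z ^ 2) / e) * A).
  { assert ((1 + 2 * Re z ^ 2) / e * A >= 1 + 2 * Re z ^ 2).
    { replace (1 + 2 * Re z ^ 2) with ((1 + 2 * Re z ^ 2) / e * e) at 2 by (field; lra).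
      apply Rle_ge, Rmult_le_compat_l; [|exact Hk].
      apply Rdiv_le_0_compat; [pose proof (pow2_ge_0 (Re z)); lra | exact He]. }
    assert (IZR k ^ 2 <= 2 * A + 2 * Re z ^ 2).
    { unfold A; pose proof (pow2_ge_0 (2 * Re z + IZR k)); pose proof (pow2_ge_0 (Im z)); nra. }
    nra. }
  assert (H0 : 0 < 1 + IZR k ^ 2) by (pose proof (pow2_ge_0 (IZR k)); lra).
  apply (Rmult_le_reg_r A); [lra|]; rewrite Rinv_l by lra.
  apply (Rmult_le_reg_r (1 + IZR k ^ 2)); [lra|].
  replace (_ * / (1 + IZR k ^ 2) * A * (1 + IZR k ^ 2))
    with ((2 + (1 + 2 * Re z ^ 2) / e) * A); [lra|].
  field; split; lra.
Qed.

Definition usq (n : nat) : R := / (1 + INR n ^ 2).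

Lemma ex_series_usq : ex_series usq.
Proof.
  set (v := fun n : nat => / ((INR n + 1) * (INR n + 2))).
  apply (ex_series_le (V := R_CompleteNormedModule) _ (fun n => 4 * v n)).
  - intros n; unfold usq, v; change (Rabs (/ (1 + INR n ^ 2)) <= 4 * / ((INR n + 1) * (INR n + 2))).
    pose proof (pos_INR n); pose proof (pow2_ge_0 (INR n)).
    rewrite Rabs_pos_eq by (left; apply Rinv_0_lt_compat; lra).
    apply Rmult_le_reg_r with (1 + INR n ^ 2); [lra|].
    rewrite Rinv_l by lra.
    apply Rmult_le_reg_r with ((INR n + 1) * (INR n + 2)); [nra|].
    replace (4 * / ((INR n + 1) * (INR n + 2)) * (1 + INR n ^ 2) *
      ((INR n + 1) * (INR n + 2))) with (4 * (1 + INR n ^ 2)) by (field; lra).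
    nra.
  - apply (ex_series_scal (V := R_NormedModule) 4 v).
    exists 1; change (is_lim_seq (sum_n v) 1).
    apply (is_lim_seq_ext (fun n => 1 - / (INR n + 2))).
    + intros n; induction n as [|n IH].
      * rewrite sum_O; unfold v; simpl; field.
      * rewrite sum_Sn, <- IH; unfold v, plus; rewrite S_INR; simpl.
        pose proof (pos_INR n); field; lra.
    + replace (Finite 1) with (Rbar_minus 1 0) by (simpl; f_equal; ring).
      apply is_lim_seq_minus'; [apply is_lim_seq_const|].
      apply (is_lim_seq_inv _ p_infty); [|easy].
      apply (is_lim_seq_plus _ _ p_infty 2); [apply is_lim_seq_INR | apply is_lim_seq_const | easy].
Qed.

Lemma usq_S n : / (1 + (INR n + 1) ^ 2) <= usq n.
Proof.
  unfold usq; pose proof (pos_INR n); pose proof (pow2_ge_0 (INR n)).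
  apply Rinv_le_contravar; nra.
Qed.

(** In the average of [gfun] each of the [2 M] terms, [M = 2 ^ r], is its polar part up to
    an error of at most 16.  The polar parts are the terms of the series, and the
    errors add up to [O (M)] while the sum is divided by [4 M^2]. *)
Lemma gfun_partial_fractions z : nonint z ->
  Csum (fun n => / (z + CZ (Z.of_nat n)) ^ 2 + / (z + CZ (- Z.of_nat n - 1)) ^ 2)%C
       (- RtoC (4 * PI ^ 2) * gfun z)%C.
Proof.
  intros Hz.
  set (a := (fun n => / (z + CZ (Z.of_nat n)) ^ 2 + / (z + CZ (- Z.of_nat n - 1)) ^ 2)%C).
  apply (Csum_subseq a (fun r => 2 ^ r)%nat (fun r => csum a (2 ^ r))); trivial.
  - destruct (nonint_bound z Hz) as [D [HD Hb]].
    apply (Csum_abs_le _ (fun n => (2 * D) * usq n)).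
    + intros n; eapply Rle_trans; [apply Cmod_triangle|].
      pose proof (Hb (Z.of_nat n)) as H1; pose proof (Hb (- Z.of_nat n - 1)%Z) as H2.
      rewrite minus_IZR, opp_IZR, <- INR_IZR_INZ in H2.
      rewrite <- INR_IZR_INZ in H1; fold (usq n) in H1.
      pose proof (usq_S n).
      replace ((- INR n - 1) ^ 2) with ((INR n + 1) ^ 2) in H2 by ring.
      nra.
    + apply (ex_series_scal (V := R_NormedModule)), ex_series_usq.
  - intros n; apply Nat.pow_lt_mono_r; lia.
  - pose proof PI_RGT_0 as Hpi; pose proof PI_lt as Hpi'.
    (* For such [M] the points [(z + k) / (2 M)], [- M <= k < M], satisfy the bounds
       required near 0, as 3.2 * (1 + 1/6) < 15/4. *)
    destruct (INR_unbounded (6 * (Rabs (Re z) + Rabs (Im z)))) as [N HN].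
    apply Clim_of_bound with (v := fun r => (32 * PI ^ 2) * (/ 2) ^ r) (N := N).
    2:{ replace (Finite 0) with (Rbar_mult (32 * PI ^ 2) 0) by (simpl; f_equal; ring).
        apply is_lim_seq_scal_l, is_lim_seq_geom; rewrite Rabs_pos_eq; lra. }
    intros r Hr; rewrite (gfun_average r z Hz).
    set (M := INR (2 ^ r)).
    assert (HM : INR N <= M).
    { apply le_INR; apply Nat.le_trans with r; [exact Hr|].
      apply Nat.lt_le_incl, Nat.pow_gt_lin_r; lia. }
    assert (HM1 : 1 <= M).
    { apply (le_INR 1); pose proof (Nat.pow_nonzero 2 r); lia. }
    assert (HMpi : RtoC (4 * PI ^ 2) <> 0%C) by (intros E; apply RtoC_inj in E; nra).
    assert (HMc : RtoC M <> 0%C) by (intros E; apply RtoC_inj in E; lra).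
    assert (HM2 : RtoC (4 * M ^ 2) <> 0%C) by (intros E; apply RtoC_inj in E; nra).
    set (T := fun k => _).
    replace (csum a (2 ^ r) - - RtoC (4 * PI ^ 2) * (csum T (2 ^ r) / RtoC (4 * M ^ 2)))%C
      with (RtoC (4 * PI ^ 2) / RtoC (4 * M ^ 2) *
            csum (fun k => T k + RtoC (4 * M ^ 2) / RtoC (4 * PI ^ 2) * a k) (2 ^ r))%C
      by (rewrite csum_plus, csum_scal; field; split; trivial).
    rewrite Cmod_mult, Cmod_div by trivial.
    rewrite !Cmod_R, !Rabs_pos_eq by nra.
    assert (Hterm : forall w : C, w <> 0%C -> Rabs (Re w) <= M + Rabs (Re z) ->
        Rabs (Im w) <= Rabs (Im z) ->
        Cmod (gfun (w / RtoC (2 * M)) + RtoC (4 * M ^ 2) / RtoC (4 * PI ^ 2) * / w ^ 2) <= 16).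
    { intros w Hw Hre Him.
      replace (RtoC (4 * M ^ 2) / RtoC (4 * PI ^ 2) * / w ^ 2)%C
        with (/ (RtoC (4 * PI ^ 2) * (w / RtoC (2 * M)) ^ 2))%C.
      2:{ assert (E : RtoC (4 * M ^ 2) = (4 * RtoC M ^ 2)%C) by
            now rewrite RtoC_mult, RtoC_pow.
          rewrite E, (RtoC_mult 2 M); field; auto. }
      replace (w / RtoC (2 * M))%C with (RtoC (/ (2 * M)) * w)%C.
      2:{ rewrite RtoC_inv by lra; unfold Cdiv; ring. }
      apply gfun_near_0.
      - apply Cmult_neq_0; [|exact Hw].
        intros E; apply RtoC_inj in E; pose proof (Rinv_0_lt_compat (2 * M) ltac:(lra)); lra.
      - replace (Re (RtoC (/ (2 * M)) * w)) with (/ (2 * M) * Re w) by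
          (simpl; unfold Re; ring).
        rewrite !Rabs_mult, (Rabs_pos_eq 2), (Rabs_pos_eq PI), (Rabs_pos_eq (/ _))
          by (try lra; left; apply Rinv_0_lt_compat; lra).
        apply Rmult_le_reg_r with M; [lra|].
        replace (2 * PI * (/ (2 * M) * Rabs (Re w)) * M) with (PI * Rabs (Re w))
          by (field; lra).
        pose proof (Rabs_pos (Re z)); pose proof (Rabs_pos (Im z)).
        apply Rle_trans with (PI * (M + M / 6)); [apply Rmult_le_compat_l; lra | nra].
      - replace (Im (RtoC (/ (2 * M)) * w)) with (/ (2 * M) * Im w) by
          (simpl; unfold Im; ring).
        rewrite !Rabs_mult, (Rabs_pos_eq 2), (Rabs_pos_eq PI), (Rabs_pos_eq (/ _))
          by (try lra; left; apply Rinv_0_lt_compat; lra).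
        apply Rmult_le_reg_r with M; [lra|].
        replace (2 * PI * (/ (2 * M) * Rabs (Im w)) * M) with (PI * Rabs (Im w))
          by (field; lra).
        pose proof (Rabs_pos (Re z)); pose proof (Rabs_pos (Im z)).
        apply Rle_trans with (PI * (M / 6)); [apply Rmult_le_compat_l; lra | nra]. }
    assert (Hnz : forall k, (z + CZ k)%C <> 0%C).
    { intros k E; apply (Hz (- k)%Z); rewrite CZ_opp.
      replace z with ((z + CZ k) - CZ k)%C by ring; rewrite E; ring. }
    eapply Rle_trans.
    + apply Rmult_le_compat_l; [apply Rdiv_le_0_compat; nra|].
      apply (Cmod_csum_le _ 32); intros k Hk.
      assert (HkM : INR k + 1 <= M).
      { rewrite <- S_INR; apply le_INR; lia. }
      pose proof (pos_INR k).
      replace (T k + RtoC (4 * M ^ 2) / RtoC (4 * PI ^ 2) * a k)%C with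
        ((gfun ((z + CZ (Z.of_nat k)) / RtoC (2 * M)) +
          RtoC (4 * M ^ 2) / RtoC (4 * PI ^ 2) * / (z + CZ (Z.of_nat k)) ^ 2) +
         (gfun ((z + CZ (- Z.of_nat k - 1)) / RtoC (2 * M)) +
          RtoC (4 * M ^ 2) / RtoC (4 * PI ^ 2) * / (z + CZ (- Z.of_nat k - 1)) ^ 2))%C.
      2:{ unfold T, a; rewrite CZ_minus, CZ_opp, CZ_nat.
          replace (z - RtoC (INR k) - 1)%C with (z + (- RtoC (INR k) - CZ 1))%C
            by (unfold CZ; ring).
          fold M; ring. }
      eapply Rle_trans; [apply Cmod_triangle|].
      replace 32 with (16 + 16) by ring; apply Rplus_le_compat; apply Hterm; trivial.
      * replace (Re (z + CZ (Z.of_nat k))) with (Re z + INR k)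
          by (rewrite INR_IZR_INZ; reflexivity).
        eapply Rle_trans; [apply Rabs_triang|]; rewrite (Rabs_pos_eq (INR k)); lra.
      * replace (Im (z + CZ (Z.of_nat k))) with (Im z) by (simpl; unfold Im; ring); lra.
      * replace (Re (z + CZ (- Z.of_nat k - 1))) with (Re z - (INR k + 1)).
        2:{ rewrite CZ_minus, CZ_opp, CZ_nat; simpl; unfold Re; ring. }
        eapply Rle_trans; [apply Rabs_triang|]; rewrite Rabs_Ropp, (Rabs_pos_eq (INR k + 1)); lra.
      * replace (Im (z + CZ (- Z.of_nat k - 1))) with (Im z) by (simpl; unfold Im; ring); lra.
    + fold M; apply Req_le.
      replace ((/ 2) ^ r) with (/ M).
      * field; lra.
      * unfold M; rewrite pow_INR, pow_inv; reflexivity.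
Qed.

(** * Weierstrass functions and the inversion of the period *)

Definition lat (tau : C) (a b : R) : C := (RtoC a * tau + RtoC b)%C.

Lemma lat_norm tau a b :
  Cmod (lat tau a b) ^ 2 = (a * Re tau + b) ^ 2 + (a * Im tau) ^ 2.
Proof. rewrite Cmod2_alt; unfold lat; simpl; unfold Re, Im; ring. Qed.

Lemma lat_norm_lower tau : inH tau -> exists K, 1 <= K /\
  forall a b, a ^ 2 + b ^ 2 <= K * Cmod (lat tau a b) ^ 2.
Proof.
  unfold inH; intros Ht; exists (2 + (1 + 2 * Re tau ^ 2) / Im tau ^ 2).
  assert (Hy : 0 < Im tau ^ 2) by (apply pow2_gt_0; lra).
  assert (H0 : 0 <= (1 + 2 * Re tau ^ 2) / Im tau ^ 2).
  { apply Rdiv_le_0_compat; [pose proof (pow2_ge_0 (Re tau)); lra | exact Hy]. }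
  split; [lra|]; intros a b; rewrite lat_norm.
  set (x := Re tau) in *; set (y := Im tau) in *.
  assert (E : (1 + 2 * x ^ 2) / y ^ 2 * (a * y) ^ 2 = (1 + 2 * x ^ 2) * a ^ 2) by (field; nra).
  assert (0 <= (1 + 2 * x ^ 2) / y ^ 2 * (a * x + b) ^ 2)
    by (apply Rmult_le_pos; [lra | apply pow2_ge_0]).
  pose proof (pow2_ge_0 (a * y)).
  pose proof (pow2_ge_0 (2 * a * x + b)).
  nra.
Qed.

Lemma lat_norm_upper tau : exists K, 1 <= K /\
  forall a b, Cmod (lat tau a b) ^ 2 <= K * (a ^ 2 + b ^ 2).
Proof.
  exists (2 + 2 * (Re tau ^ 2 + Im tau ^ 2)).
  pose proof (pow2_ge_0 (Re tau)); pose proof (pow2_ge_0 (Im tau)).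
  split; [lra|]; intros a b; rewrite lat_norm.
  set (x := Re tau) in *; set (y := Im tau) in *.
  assert ((a * x + b) ^ 2 <= 2 * (a * x) ^ 2 + 2 * b ^ 2)
    by (pose proof (pow2_ge_0 (a * x - b)); nra).
  assert (0 <= b ^ 2 * (x ^ 2 + y ^ 2)) by (apply Rmult_le_pos; nra).
  assert (0 <= a ^ 2) by apply pow2_ge_0.
  assert (0 <= a ^ 2 * y ^ 2) by (apply Rmult_le_pos; nra).
  nra.
Qed.

(** A coordinate of absolute value at most 4/5 moves no nonzero integer close to 0. *)
Lemma shift_far (l : Z) p : Rabs p <= 4 / 5 -> IZR l ^ 2 <= 25 * (p + IZR l) ^ 2.
Proof.
  intros Hp; apply Rabs_le_between in Hp.
  destruct (Z.eq_dec l 0) as [->|Hl].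
  { simpl; pose proof (pow2_ge_0 (p + 0)); nra. }
  assert (Hl1 : (l <= -1)%Z \/ (1 <= l)%Z) by lia.
  destruct Hl1 as [Hl1|Hl1]; apply IZR_le in Hl1; simpl in Hl1; nra.
Qed.

(** Adding the terms of [w] and [- w] removes the odd part of order [|w|^-3]; what is
    left after the subtraction of [2 / w^2], which does not depend on [u], is of order
    [|w|^-4] and thus bounded by a product of summable functions of [l] and [k]. *)
Lemma even_term_bound tau p q : inH tau -> Rabs p <= 4 / 5 -> Rabs q <= 4 / 5 ->
  exists D, 0 <= D /\ forall l k : Z, (l <> 0 \/ k <> 0)%Z ->
    let u := lat tau p q in let w := lat tau (IZR l) (IZR k) in
    Cmod (/ (u + w) ^ 2 + / (u - w) ^ 2 - 2 / w ^ 2)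
    <= D * (/ (1 + IZR l ^ 2) * / (1 + IZR k ^ 2)).
Proof.
  intros Ht Hp Hq.
  destruct (lat_norm_lower tau Ht) as [K1 [HK1 H1]].
  destruct (lat_norm_upper tau) as [K2 [HK2 H2]].
  set (B := (25 * K1 * K2) ^ 2).
  set (N1 := 12 * K2 + 8 * K2 ^ 2 * K1).
  exists (4 * K1 ^ 2 * (N1 * B)); split.
  { unfold N1, B; repeat apply Rmult_le_pos; try apply pow2_ge_0; nra. }
  intros l k Hlk u w.
  set (S := IZR l ^ 2 + IZR k ^ 2).
  assert (HS : 1 <= S).
  { unfold S.
    assert (forall n, (n <> 0)%Z -> 1 <= IZR n ^ 2).
    { intros n Hn; assert (Hn1 : (n <= -1)%Z \/ (1 <= n)%Z) by lia.
      destruct Hn1 as [Hn1|Hn1]; apply IZR_le in Hn1; simpl in Hn1; nra. }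
    pose proof (pow2_ge_0 (IZR l)); pose proof (pow2_ge_0 (IZR k)).
    destruct Hlk as [Hn|Hn]; specialize (H _ Hn); lra. }
  set (m := Cmod w ^ 2).
  assert (Hm : S <= K1 * m) by apply H1.
  assert (Hm' : m <= K2 * S) by apply H2.
  assert (Hm0 : 0 < m) by nra.
  assert (Hu : Cmod u ^ 2 <= 2 * K2).
  { eapply Rle_trans; [apply H2|].
    apply Rabs_le_between in Hp; apply Rabs_le_between in Hq.
    replace (2 * K2) with (K2 * 2) by ring; apply Rmult_le_compat_l; nra. }
  assert (Hplus : m <= 25 * K1 * K2 * Cmod (u + w) ^ 2).
  { replace (u + w)%C with (lat tau (p + IZR l) (q + IZR k)).
    2:{ unfold u, w, lat; rewrite !RtoC_plus; ring. }
    pose proof (shift_far l p Hp); pose proof (shift_far k q Hq).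
    pose proof (H1 (p + IZR l) (q + IZR k)); unfold S in *.
    apply Rle_trans with (K2 * (25 * (K1 * Cmod (lat tau (p + IZR l) (q + IZR k)) ^ 2)));
      [|lra].
    apply Rle_trans with (1 := Hm'), Rmult_le_compat_l; lra. }
  assert (Hminus : m <= 25 * K1 * K2 * Cmod (u - w) ^ 2).
  { replace (u - w)%C with (lat tau (p + IZR (- l)) (q + IZR (- k))).
    2:{ unfold u, w, lat; rewrite !opp_IZR, !RtoC_plus, !RtoC_opp; ring. }
    pose proof (shift_far (- l) p Hp) as Ha; pose proof (shift_far (- k) q Hq) as Hb.
    replace (IZR (- l) ^ 2) with (IZR l ^ 2) in Ha by (rewrite opp_IZR; ring).
    replace (IZR (- k) ^ 2) with (IZR k ^ 2) in Hb by (rewrite opp_IZR; ring).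
    pose proof (H1 (p + IZR (- l)) (q + IZR (- k))); unfold S in *.
    apply Rle_trans with (K2 * (25 * (K1 * Cmod (lat tau (p + IZR (- l)) (q + IZR (- k))) ^ 2)));
      [|lra].
    apply Rle_trans with (1 := Hm'), Rmult_le_compat_l; lra. }
  assert (Hw0 : w <> 0%C).
  { intros E; unfold m in Hm0; rewrite E, Cmod_0 in Hm0; lra. }
  assert (Hp0 : (u + w)%C <> 0%C).
  { intros E; rewrite E, Cmod_0 in Hplus; lra. }
  assert (Hd0 : (u - w)%C <> 0%C).
  { intros E; rewrite E, Cmod_0 in Hminus; lra. }
  clearbody u w.
  replace (/ (u + w) ^ 2 + / (u - w) ^ 2 - 2 / w ^ 2)%C with
    ((6 * w ^ 2 * u ^ 2 - 2 * u ^ 4) / (w ^ 2 * (u + w) ^ 2 * (u - w) ^ 2))%C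
    by (field; auto).
  assert (Hw2 := Cpow_nz w 2 Hw0); assert (Hp2 := Cpow_nz _ 2 Hp0);
    assert (Hd2 := Cpow_nz _ 2 Hd0).
  rewrite Cmod_div by (apply Cmult_neq_0; [apply Cmult_neq_0|]; trivial).
  rewrite !Cmod_mult, !Cmod_pow; fold m.
  set (A := Cmod (u + w) ^ 2) in *; set (A' := Cmod (u - w) ^ 2) in *.
  assert (Hnum : Cmod (6 * w ^ 2 * u ^ 2 - 2 * u ^ 4) <= N1 * m).
  { eapply Rle_trans; [apply Cmod_triangle|].
    rewrite Cmod_opp, !Cmod_mult, !Cmod_pow, !Cmod_R, !Rabs_pos_eq by lra; fold m.
    replace (Cmod u ^ 4) with (Cmod u ^ 2 * Cmod u ^ 2) by ring.
    set (n := Cmod u ^ 2) in *.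
    assert (0 <= n) by apply pow2_ge_0.
    assert (0 <= K2 * (K1 * m - 1)) by (apply Rmult_le_pos; lra).
    assert (n <= 2 * K2 * K1 * m) by lra.
    unfold N1.
    assert (m * n <= m * (2 * K2)) by (apply Rmult_le_compat_l; lra).
    assert (n * n <= 2 * K2 * (2 * K2 * K1 * m)) by (apply Rmult_le_compat; lra).
    nra. }
  assert (HA : 0 < A) by (apply pow_lt, Cmod_gt_0; trivial).
  assert (HA' : 0 < A') by (apply pow_lt, Cmod_gt_0; trivial).
  assert (HB : m ^ 2 <= B * (A * A')).
  { unfold B; replace ((25 * K1 * K2) ^ 2 * (A * A')) with
      ((25 * K1 * K2 * A) * (25 * K1 * K2 * A')) by ring.
    replace (m ^ 2) with (m * m) by ring; apply Rmult_le_compat; lra. }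
  assert (HSS : (1 + IZR l ^ 2) * (1 + IZR k ^ 2) <= 4 * S ^ 2).
  { unfold S in *; pose proof (pow2_ge_0 (IZR l)); pose proof (pow2_ge_0 (IZR k)).
    set (a := IZR l ^ 2) in *; set (b := IZR k ^ 2) in *; nra. }
  set (V := (1 + IZR l ^ 2) * (1 + IZR k ^ 2)) in *.
  assert (HV : 0 < V).
  { unfold V; pose proof (pow2_ge_0 (IZR l)); pose proof (pow2_ge_0 (IZR k)).
    apply Rmult_lt_0_compat; lra. }
  rewrite <- Rinv_mult; fold V.
  assert (HN1 : 0 <= N1) by (unfold N1; nra).
  assert (HB0 : 0 <= B) by apply pow2_ge_0.
  assert (HV2 : V <= 4 * K1 ^ 2 * m ^ 2).
  { assert (S ^ 2 <= (K1 * m) ^ 2) by (apply pow_incr; lra).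
    replace (4 * K1 ^ 2 * m ^ 2) with (4 * (K1 * m) ^ 2) by ring; lra. }
  apply Rle_div_l; [apply Rmult_lt_0_compat; [apply Rmult_lt_0_compat|]; trivial|].
  eapply Rle_trans; [exact Hnum|].
  replace (4 * K1 ^ 2 * (N1 * B) * / V * (m * A * A')) with
    (N1 * m * (4 * K1 ^ 2 * (B * (A * A')) / V)) by (field; lra).
  rewrite <- (Rmult_1_r (N1 * m)) at 1.
  apply Rmult_le_compat_l; [apply Rmult_le_pos; lra|].
  apply Rle_div_r; [exact HV|].
  rewrite Rmult_1_l; eapply Rle_trans; [exact HV2|].
  apply Rmult_le_compat_l; [|exact HB].
  pose proof (pow2_ge_0 K1); lra.
Qed.

(** Series over [Z] are summed symmetrically, so that opposite lattice points occur
    together in double series. *)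
Definition symf (f : Z -> C) (n : nat) : C :=
  match n with O => f 0%Z | S _ => (f (Z.of_nat n) + f (- Z.of_nat n)%Z)%C end.

Lemma symf_ext f g n : (forall k, f k = g k) -> symf f n = symf g n.
Proof. intros H; destruct n; simpl; rewrite !H; reflexivity. Qed.

Lemma symf_scal c f n : symf (fun k => c * f k)%C n = (c * symf f n)%C.
Proof. destruct n; simpl; ring. Qed.

Lemma symf_minus f g n : symf (fun k => f k - g k)%C n = (symf f n - symf g n)%C.
Proof. destruct n; simpl; ring. Qed.

Lemma symf_swap d i j :
  symf (fun k => symf (fun l => d l k) j) i = symf (fun l => symf (fun k => d l k) i) j.
Proof. destruct i, j; simpl; ring. Qed.

Lemma Csum_symf_param (F : Z -> nat -> C) G j :
  (forall l, Csum (F l) (G l)) -> Csum (fun i => symf (fun l => F l i) j) (symf G j).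
Proof. intros H; destruct j; simpl; [apply H | apply Csum_plus; apply H]. Qed.

Lemma Csum_symf f D l :
  (forall k, Cmod (f k) <= D * / (1 + IZR k ^ 2)) ->
  Csum (fun n => f (Z.of_nat n) + f (- Z.of_nat n - 1)%Z)%C l -> Csum (symf f) l.
Proof.
  intros Hf Hl.
  assert (HD : 0 <= D).
  { specialize (Hf 0%Z); pose proof (Cmod_ge_0 (f 0%Z)).
    replace (/ (1 + 0 ^ 2)) with 1 in Hf by field; lra. }
  destruct (Csum_abs_le (fun n => f (Z.of_nat n)) (fun n => D * usq n)) as [l1 H1].
  { intros n; unfold usq; rewrite INR_IZR_INZ; apply Hf. }
  { apply (ex_series_scal (V := R_NormedModule)), ex_series_usq. }
  destruct (Csum_abs_le (fun n => f (- Z.of_nat n - 1)%Z) (fun n => D * usq n)) as [l2 H2].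
  { intros n; eapply Rle_trans; [apply Hf|]; apply Rmult_le_compat_l; [exact HD|].
    eapply Rle_trans; [|apply usq_S]; apply Req_le; do 2 f_equal.
    rewrite minus_IZR, opp_IZR, <- INR_IZR_INZ; ring. }
  { apply (ex_series_scal (V := R_NormedModule)), ex_series_usq. }
  rewrite (Csum_unique _ _ _ Hl (Csum_plus _ _ _ _ H1 H2)).
  replace (l1 + l2)%C with (symf f 0 + ((l1 - f 0%Z) + l2))%C by (simpl; ring).
  apply Csum_decr.
  apply Csum_ext with (fun n => f (Z.of_nat (S n)) + f (- Z.of_nat n - 1)%Z)%C.
  { intros n; unfold symf; do 2 f_equal; lia. }
  apply Csum_plus; [|exact H2].
  apply (Csum_incr _ _ H1).
Qed.

Lemma gfun_symf z : nonint z ->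
  Csum (symf (fun k => / (z + CZ k) ^ 2)%C) (- RtoC (4 * PI ^ 2) * gfun z)%C.
Proof.
  intros Hz; destruct (nonint_bound z Hz) as [D [_ HD]].
  apply (Csum_symf _ D); [exact HD | now apply gfun_partial_fractions].
Qed.

Lemma inH_neq_0 tau : inH tau -> tau <> 0%C.
Proof. unfold inH; intros H E; rewrite E in H; simpl in H; lra. Qed.

Lemma inH_inv tau : inH tau -> inH (- (1) / tau)%C.
Proof.
  unfold inH; intros H; pose proof (inH_neq_0 tau H) as H0.
  destruct tau as [a b]; simpl in *.
  replace (_ + _) with (b / (a ^ 2 + b ^ 2)) by (field; nra).
  apply Rdiv_lt_0_compat; nra.
Qed.

Lemma small_int (n : Z) p : Rabs p <= 4 / 5 -> p + IZR n = 0 -> p = 0.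
Proof.
  intros Hp E; pose proof (shift_far n p Hp) as H; rewrite E in H.
  assert (IZR n = 0) by nra; lra.
Qed.

Lemma lat_nonint tau p q (l : Z) : inH tau -> Rabs p <= 4 / 5 -> Rabs q <= 4 / 5 ->
  p <> 0 \/ q <> 0 -> nonint (lat tau (p + IZR l) q).
Proof.
  unfold inH; intros Ht Hp Hq Hpq k E.
  assert (Ei := f_equal Im E); assert (Er := f_equal Re E).
  unfold lat in Ei, Er; simpl in Ei, Er; fold (Im tau) in Ei; fold (Re tau) (Im tau) in Er.
  assert (H0 : p + IZR l = 0).
  { apply Rmult_eq_reg_r with (Im tau); lra. }
  rewrite H0 in Er.
  assert (p = 0) by now apply (small_int l).
  assert (q = 0) by (apply (small_int (- k)); [exact Hq | rewrite opp_IZR; lra]).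
  destruct Hpq; contradiction.
Qed.

Lemma lat_inv (tau : C) p q (k : Z) : tau <> 0%C ->
  (lat tau p (q + IZR k) / tau = - lat (- (1) / tau) (q + IZR k) (- p))%C.
Proof. intros H; unfold lat; rewrite RtoC_opp; field; exact H. Qed.

Lemma nonint_opp z : nonint z -> nonint (- z).
Proof.
  intros H k E; apply (H (- k)%Z); rewrite CZ_opp, <- E; ring.
Qed.

(** Up to the factor [- 4 pi^2], [L] is the difference of the values of the Weierstrass
    function of the lattice [Z tau + Z] at the points [p tau + q] and [p' tau + q'].  A
    relation rather than a function, it includes the convergence of the series. *)
Definition wp_diff (p q p' q' : R) (tau L : C) : Prop :=
  Csum (symf (fun l => gfun (lat tau (p + IZR l) q) - gfun (lat tau (p' + IZR l) q'))%C) L.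

(** The double series over the lattice converges absolutely once opposite
    lattice points are grouped, so that its two orders of summation agree; they
    are exchanged by [tau -> -1 / tau]. *)
Lemma wp_diff_inv p q p' q' tau L : inH tau ->
  Rabs p <= 4 / 5 -> Rabs q <= 4 / 5 -> Rabs p' <= 4 / 5 -> Rabs q' <= 4 / 5 ->
  p <> 0 \/ q <> 0 -> p' <> 0 \/ q' <> 0 ->
  wp_diff p q p' q' tau L ->
  wp_diff q (- p) q' (- p') (- (1) / tau) (tau ^ 2 * L).
Proof.
  intros Ht Hp Hq Hp' Hq' Hpq Hpq' HL.
  pose proof (inH_neq_0 tau Ht) as Ht0; pose proof (inH_inv tau Ht) as Hti.
  pose proof PI_RGT_0 as Hpi.
  set (c4 := RtoC (4 * PI ^ 2)).
  assert (Hc4 : c4 <> 0%C) by (intros E; apply RtoC_inj in E; nra).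
  set (d := fun l k : Z => (/ lat tau (p + IZR l) (q + IZR k) ^ 2
                            - / lat tau (p' + IZR l) (q' + IZR k) ^ 2)%C).
  set (h := fun k : Z => (gfun (lat (- (1) / tau) (q + IZR k) (- p))
                          - gfun (lat (- (1) / tau) (q' + IZR k) (- p')))%C).
  destruct (even_term_bound tau p q Ht Hp Hq) as [D1 [HD1 B1]].
  destruct (even_term_bound tau p' q' Ht Hp' Hq') as [D2 [HD2 B2]].
  assert (He : forall l k, (l <> 0 \/ k <> 0)%Z ->
    Cmod (d l k + d (- l)%Z (- k)%Z) <= (D1 + D2) * (/ (1 + IZR l ^ 2) * / (1 + IZR k ^ 2))).
  { intros l k Hlk; specialize (B1 l k Hlk); specialize (B2 l k Hlk).
    cbv zeta in B1, B2.
    assert (E : forall p q : R, lat tau (p + IZR l) (q + IZR k) =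
       (lat tau p q + lat tau (IZR l) (IZR k))%C).
    { intros; unfold lat; rewrite !RtoC_plus; ring. }
    assert (E' : forall p q : R, lat tau (p + IZR (- l)) (q + IZR (- k)) =
       (lat tau p q - lat tau (IZR l) (IZR k))%C).
    { intros; unfold lat; rewrite !opp_IZR, !RtoC_plus, !RtoC_opp; ring. }
    unfold d; rewrite !E, !E'.
    match type of B1 with Cmod ?x <= _ => match type of B2 with Cmod ?y <= _ =>
      replace (_ + _)%C with (x - y)%C by ring end end.
    eapply Rle_trans; [apply Cmod_triangle|]; rewrite Cmod_opp; lra. }
  (* [x i j] collects the four lattice points with [|k| = i] and [|l| = j]. *)
  set (x := fun i j => symf (fun k => symf (fun l => d l k) j) i).
  assert (Hr : Csum (fun i => symf (fun k => (- c4 / tau ^ 2) * h k)%C i) (- c4 * L)%C).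
  { set (D := 2 * (D1 + D2) + Cmod (d 0%Z 0%Z)).
    apply (Csum_fubini x (fun i => D * usq i) usq _
      (fun j => symf (fun l => - c4 * (gfun (lat tau (p + IZR l) q)
                 - gfun (lat tau (p' + IZR l) q')))%C j)).
    - intros i j; rewrite Rmult_assoc; unfold x, usq; rewrite !INR_IZR_INZ.
      pose proof (Cmod_ge_0 (d 0%Z 0%Z)).
      assert (Hpos : forall n, 0 < / (1 + IZR n ^ 2)).
      { intros n; apply Rinv_0_lt_compat; pose proof (pow2_ge_0 (IZR n)); lra. }
      assert (Hij := Rmult_lt_0_compat _ _ (Hpos (Z.of_nat i)) (Hpos (Z.of_nat j))).
      destruct i as [|i], j as [|j]; unfold symf.
      + simpl IZR; replace (/ (1 + 0 ^ 2) * / (1 + 0 ^ 2)) with 1 by field.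
        unfold D; lra.
      + rewrite <- (Z.opp_0) at 2.
        eapply Rle_trans; [apply He; lia|].
        simpl (Z.of_nat 0) in *; unfold D; nra.
      + change (d 0%Z (- Z.of_nat (S i))%Z) with (d (- 0)%Z (- Z.of_nat (S i))%Z).
        eapply Rle_trans; [apply He; lia|].
        simpl (Z.of_nat 0) in *; unfold D; nra.
      + set (k := Z.of_nat (S i)) in *; set (l := Z.of_nat (S j)) in *.
        replace (d l k + d (- l)%Z k + (d l (- k)%Z + d (- l)%Z (- k)%Z))%C
          with ((d l k + d (- l)%Z (- k)%Z) + (d l (- k)%Z + d (- l)%Z (- - k)%Z))%C.
        2:{ rewrite Z.opp_involutive; ring. }
        eapply Rle_trans; [apply Cmod_triangle|].
        pose proof (He l k ltac:(lia)) as Ha; pose proof (He l (- k)%Z ltac:(lia)) as Hb.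
        replace (IZR (- k) ^ 2) with (IZR k ^ 2) in Hb by (rewrite opp_IZR; ring).
        unfold D; nra.
    - apply (ex_series_scal (V := R_NormedModule)), ex_series_usq.
    - apply ex_series_usq.
    - intros i; unfold x.
      apply Csum_symf_param; intros k; unfold h.
      assert (Hrow : forall p q : R, Rabs p <= 4 / 5 -> Rabs q <= 4 / 5 ->
         p <> 0 \/ q <> 0 ->
         Csum (symf (fun l => / lat tau (p + IZR l) (q + IZR k) ^ 2)%C)
              (/ tau ^ 2 * (- c4 * gfun (lat (- (1) / tau) (q + IZR k) (- p))))%C).
      { clear - Ht0 Hti Ht; intros p q Hp Hq Hpq.
        assert (Hn : nonint (lat (- (1) / tau) (q + IZR k) (- p))).
        { apply lat_nonint; trivial; [now rewrite Rabs_Ropp | lra]. }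
        rewrite <- gfun_opp by exact Hn.
        rewrite <- lat_inv by exact Ht0.
        apply Csum_ext with (fun j => / tau ^ 2 * symf (fun l =>
          / (lat tau p (q + IZR k) / tau + CZ l) ^ 2) j)%C.
        - intros j; rewrite <- symf_scal; apply symf_ext; intros l.
          assert (E : lat tau (p + IZR l) (q + IZR k) =
            (tau * (lat tau p (q + IZR k) / tau + CZ l))%C).
          { unfold lat, CZ; rewrite RtoC_plus; field; exact Ht0. }
          assert (Hz : (lat tau p (q + IZR k) / tau + CZ l)%C <> 0%C).
          { intros E0; rewrite lat_inv in E0 by exact Ht0.
            apply (Hn l).
            replace (lat (- (1) / tau) (q + IZR k) (- p)) with
              (CZ l - (- lat (- (1) / tau) (q + IZR k) (- p) + CZ l))%C by ring.
            rewrite E0; ring. }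
          rewrite E; generalize dependent (lat tau p (q + IZR k) / tau + CZ l)%C.
          intros w _ Hw; field; auto.
        - apply Csum_scal, gfun_symf.
          rewrite lat_inv by exact Ht0; now apply nonint_opp. }
      apply Csum_ext with (fun j => symf (fun l => / lat tau (p + IZR l) (q + IZR k) ^ 2)%C j
         - symf (fun l => / lat tau (p' + IZR l) (q' + IZR k) ^ 2)%C j)%C.
      { intros j; rewrite <- symf_minus; reflexivity. }
      replace (- c4 / tau ^ 2 * _)%C with
        (/ tau ^ 2 * (- c4 * gfun (lat (- (1) / tau) (q + IZR k) (- p)))
         - / tau ^ 2 * (- c4 * gfun (lat (- (1) / tau) (q' + IZR k) (- p'))))%C
        by (field; exact Ht0).
      apply Csum_minus; now apply Hrow.
    - intros j.
      apply Csum_ext with (fun i => symf (fun l => symf (fun k => d l k) i) j);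
        [intros i; unfold x; now rewrite symf_swap|].
      apply Csum_symf_param; intros l.
      assert (Hcol : forall p q : R, Rabs p <= 4 / 5 -> Rabs q <= 4 / 5 ->
         p <> 0 \/ q <> 0 ->
         Csum (symf (fun k => / lat tau (p + IZR l) (q + IZR k) ^ 2)%C)
              (- c4 * gfun (lat tau (p + IZR l) q))%C).
      { clear - Ht; intros p q Hp Hq Hpq.
        apply Csum_ext with (symf (fun k => / (lat tau (p + IZR l) q + CZ k) ^ 2)%C).
        - intros i; apply symf_ext; intros k; unfold lat, CZ; rewrite (RtoC_plus q).
          do 2 f_equal; ring.
        - apply gfun_symf, lat_nonint; trivial. }
      apply Csum_ext with (fun i => symf (fun k => / lat tau (p + IZR l) (q + IZR k) ^ 2)%C i
         - symf (fun k => / lat tau (p' + IZR l) (q' + IZR k) ^ 2)%C i)%C.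
      { intros i; rewrite <- symf_minus; reflexivity. }
      replace (- c4 * _)%C with
        (- c4 * gfun (lat tau (p + IZR l) q) - - c4 * gfun (lat tau (p' + IZR l) q'))%C
        by ring.
      apply Csum_minus; now apply Hcol.
    - apply Csum_ext with (fun j => - c4 * symf (fun l => gfun (lat tau (p + IZR l) q)
                 - gfun (lat tau (p' + IZR l) q')) j)%C.
      { intros j; now rewrite <- symf_scal. }
      now apply Csum_scal. }
  apply (Csum_scal (- tau ^ 2 / c4)) in Hr.
  replace (tau ^ 2 * L)%C with (- tau ^ 2 / c4 * (- c4 * L))%C by (field; exact Hc4).
  apply Csum_ext with (2 := Hr); intros i; rewrite <- symf_scal.
  apply symf_ext; intros k; unfold h; field; auto.
Qed.

(** * The Eisenstein series as a difference of Weierstrass values *)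

Lemma inH_shift tau n : inH tau -> inH (tau + CZ n).
Proof. unfold inH; destruct tau; simpl; lra. Qed.

Lemma wp_diff_ext p q p' q' r s r' s' tau sigma L :
  (forall l : Z, gfun (lat tau (p + IZR l) q) = gfun (lat sigma (r + IZR l) s)) ->
  (forall l : Z, gfun (lat tau (p' + IZR l) q') = gfun (lat sigma (r' + IZR l) s')) ->
  wp_diff p q p' q' tau L -> wp_diff r s r' s' sigma L.
Proof.
  intros H H'; apply Csum_ext; intros n; apply symf_ext; intros l.
  now rewrite H, H'.
Qed.

Lemma wp_diff_shift n p q p' q' tau L :
  wp_diff p q p' q' tau L ->
  wp_diff p (q - IZR n * p) p' (q' - IZR n * p') (tau + CZ n) L.
Proof.
  apply wp_diff_ext; intros l;
  rewrite <- (gfun_period _ (n * l)); f_equal; unfold lat;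
  rewrite CZ_mult; unfold CZ; rewrite RtoC_minus, RtoC_mult, RtoC_plus; ring.
Qed.

Lemma wp_diff_period m m' p q p' q' tau L :
  wp_diff p q p' q' tau L -> wp_diff p (q + IZR m) p' (q' + IZR m') tau L.
Proof.
  apply wp_diff_ext; intros l; unfold lat.
  - rewrite <- (gfun_period _ m); f_equal; unfold CZ; rewrite (RtoC_plus q); ring.
  - rewrite <- (gfun_period _ m'); f_equal; unfold CZ; rewrite (RtoC_plus q'); ring.
Qed.

Lemma wp_diff_swap p q p' q' tau L :
  wp_diff p q p' q' tau L -> wp_diff p' q' p q tau (- L).
Proof.
  intros H; apply (Csum_scal (- (1))%C) in H.
  replace (- L)%C with (- (1) * L)%C by ring.
  apply Csum_ext with (2 := H); intros n; rewrite <- symf_scal.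
  apply symf_ext; intros l; ring.
Qed.

(** The Eisenstein series of weight 2 and character [chi] which is nonzero at
    infinity, as a difference of two Weierstrass values at points of order 5. *)
Definition wp_E (tau L : C) : Prop := wp_diff 0 (1 / 5) 0 (2 / 5) tau L.

(** The two points [1/5] and [2/5] are exchanged, up to sign and periods. *)
Lemma wp_E_swap q q' tau L :
  (forall l : Z, gfun (lat tau (0 + IZR l) q) = gfun (lat tau (0 + IZR l) (2 / 5))) ->
  (forall l : Z, gfun (lat tau (0 + IZR l) q') = gfun (lat tau (0 + IZR (- l)) (1 / 5))) ->
  wp_diff 0 q 0 q' tau L -> wp_E tau (- L).
Proof.
  intros H H' HL; apply wp_diff_swap in HL.
  apply Csum_ext with (2 := HL); intros n.
  rewrite !symf_minus.
  replace (symf (fun l => gfun (lat tau (0 + IZR l) q)) n)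
    with (symf (fun l => gfun (lat tau (0 + IZR l) (2 / 5))) n)
    by (symmetry; now apply symf_ext).
  replace (symf (fun l => gfun (lat tau (0 + IZR l) q')) n)
    with (symf (fun l => gfun (lat tau (0 + IZR l) (1 / 5))) n); [reflexivity|].
  rewrite (symf_ext _ _ _ H').
  destruct n as [|n]; [reflexivity|].
  unfold symf; rewrite Z.opp_involutive; ring.
Qed.

Ltac small := rewrite ?Rabs_Ropp; (rewrite Rabs_pos_eq by lra; lra) ||
  (rewrite Rabs_left by lra; lra).

(** With [S : z -> - 1 / z] and [T : z -> z + 1], the matrix [(2 -1; 5 -2)] acts as
    [S T^-2 S T^2 S].  Following the two points through this word exchanges them up to
    sign and periods, which accounts for the sign [chi (-2) = -1]. *)
Lemma wp_E_e1 tau L : inH tau -> wp_E tau L ->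
  wp_E (mobius 2 (-1) 5 (-2) tau) (- (cocyc 5 (-2) tau ^ 2 * L)).
Proof.
  intros H0 HL.
  pose proof (inH_inv tau H0) as H1.
  set (t1 := (- (1) / tau)%C) in *.
  assert (H2 := inH_shift _ 2 H1).
  pose proof (inH_inv _ H2) as H3.
  set (t2 := (t1 + CZ 2)%C) in *.
  set (t3 := (- (1) / t2)%C) in *.
  assert (H4 := inH_shift _ (-2) H3).
  set (t4 := (t3 + CZ (-2))%C) in *.
  apply wp_diff_inv in HL; trivial; try small; try lra.
  apply (wp_diff_shift 2) in HL; fold t1 in HL; fold t2 in HL.
  replace (- 0 - 2 * (1 / 5)) with (- (2 / 5)) in HL by field.
  replace (- 0 - 2 * (2 / 5)) with (- (4 / 5)) in HL by field.
  apply wp_diff_inv in HL; trivial; try small; try lra.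
  apply (wp_diff_shift (-2)) in HL; fold t3 in HL; fold t4 in HL.
  apply (wp_diff_period 1 2) in HL.
  replace (- (1 / 5) - -2 * - (2 / 5) + 1) with 0 in HL by field.
  replace (- (2 / 5) - -2 * - (4 / 5) + 2) with 0 in HL by field.
  apply wp_diff_inv in HL; trivial; try small; try lra.
  rewrite !Ropp_involutive in HL.
  pose proof (inH_neq_0 _ H0); pose proof (inH_neq_0 _ H2); pose proof (inH_neq_0 _ H4).
  assert (E2 : (2 * tau - 1)%C = (t2 * tau)%C) by (unfold t2, t1, CZ; field; trivial).
  assert (E4 : cocyc 5 (-2) tau = (- (t4 * t2 * tau))%C).
  { unfold t4, t3, t2, t1, cocyc, CZ; rewrite ?RtoC_opp; field.
    split; trivial; intros E; apply (Cmult_neq_0 t2 tau); trivial.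
    rewrite <- E2, <- E; ring. }
  assert (Em : mobius 2 (-1) 5 (-2) tau = (- (1) / t4)%C).
  { unfold mobius; rewrite E4.
    replace (CZ 2 * tau + CZ (-1))%C with (t2 * tau)%C; [field; auto|].
    rewrite <- E2; unfold CZ; rewrite ?RtoC_opp; ring. }
  rewrite Em, E4.
  replace (- ((- (t4 * t2 * tau)) ^ 2 * L))%C with (- (t4 ^ 2 * (t2 ^ 2 * (tau ^ 2 * L))))%C
    by ring.
  assert (H9 := inH_inv _ H4).
  apply (wp_E_swap _ _ _ _ ) in HL; trivial.
  intros l; rewrite <- gfun_opp.
  - rewrite <- (gfun_period _ 1); f_equal; unfold lat, CZ.
    rewrite opp_IZR, ?RtoC_plus, ?RtoC_opp, ?RtoC_div by lra; field; trivial.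
  - apply lat_nonint; trivial; try small; lra.
Qed.

(** The word of the matrix [(3 -2; 5 -3)] is [S T^-2 S T^-3 S T^-1]. *)
Lemma wp_E_e2 tau L : inH tau -> wp_E tau L ->
  wp_E (mobius 3 (-2) 5 (-3) tau) (- (cocyc 5 (-3) tau ^ 2 * L)).
Proof.
  intros H HL.
  assert (H0 := inH_shift _ (-1) H).
  set (t0 := (tau + CZ (-1))%C) in *.
  pose proof (inH_inv t0 H0) as H1.
  set (t1 := (- (1) / t0)%C) in *.
  assert (H2 := inH_shift _ (-3) H1).
  pose proof (inH_inv _ H2) as H3.
  set (t2 := (t1 + CZ (-3))%C) in *.
  set (t3 := (- (1) / t2)%C) in *.
  assert (H4 := inH_shift _ (-2) H3).
  set (t4 := (t3 + CZ (-2))%C) in *.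
  apply (wp_diff_shift (-1)) in HL; fold t0 in HL.
  replace (1 / 5 - -1 * 0) with (1 / 5) in HL by field.
  replace (2 / 5 - -1 * 0) with (2 / 5) in HL by field.
  apply wp_diff_inv in HL; trivial; try small; try lra.
  apply (wp_diff_shift (-3)) in HL; fold t1 in HL; fold t2 in HL.
  apply (wp_diff_period 0 (-1)) in HL.
  replace (- 0 - -3 * (1 / 5) + 0) with (3 / 5) in HL by field.
  replace (- 0 - -3 * (2 / 5) + -1) with (1 / 5) in HL by field.
  apply wp_diff_inv in HL; trivial; try small; try lra.
  apply (wp_diff_shift (-2)) in HL; fold t3 in HL; fold t4 in HL.
  apply (wp_diff_period (-1) 0) in HL.
  replace (- (1 / 5) - -2 * (3 / 5) + -1) with 0 in HL by field.
  replace (- (2 / 5) - -2 * (1 / 5) + 0) with 0 in HL by field.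
  apply wp_diff_inv in HL; trivial; try small; try lra.
  pose proof (inH_neq_0 _ H0); pose proof (inH_neq_0 _ H2); pose proof (inH_neq_0 _ H4).
  assert (Et : tau = (t0 + 1)%C) by (unfold t0, CZ; rewrite ?RtoC_opp; ring).
  assert (E2 : (- (1) - 3 * t0)%C = (t2 * t0)%C).
  { unfold t2, t1, CZ; rewrite ?RtoC_opp; field; trivial. }
  assert (E4 : cocyc 5 (-3) tau = (t4 * t2 * t0)%C).
  { rewrite Et; unfold cocyc, CZ.
    replace (t4 * t2 * t0)%C with (- t0 - 2 * (t2 * t0))%C.
    - rewrite <- E2, ?RtoC_opp; ring.
    - unfold t4, t3, CZ; rewrite ?RtoC_opp; field; trivial. }
  assert (Em : mobius 3 (-2) 5 (-3) tau = (- (1) / t4)%C).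
  { unfold mobius; rewrite E4.
    replace (CZ 3 * tau + CZ (-2))%C with (- (t2 * t0))%C; [field; auto|].
    rewrite <- E2, Et; unfold CZ; rewrite ?RtoC_opp; ring. }
  rewrite Em, E4.
  replace (- ((t4 * t2 * t0) ^ 2 * L))%C with (- (t4 ^ 2 * (t2 ^ 2 * (t0 ^ 2 * L))))%C
    by ring.
  assert (H9 := inH_inv _ H4).
  apply (wp_diff_period 1 0) in HL.
  apply (wp_E_swap _ _ _ _ ) in HL; trivial.
  - intros l; do 2 f_equal; field.
  - intros l; rewrite <- gfun_opp.
    + f_equal; unfold lat.
      rewrite opp_IZR, ?RtoC_plus, ?RtoC_opp, ?RtoC_div by lra; field; trivial.
    + replace (- (1 / 5) + 0) with (- (1 / 5)) by ring.
      apply lat_nonint; trivial; try small; lra.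
Qed.

(** * Lambert series *)

Lemma INR_pow_bounded s : 0 <= s < 1 -> exists D, 0 <= D /\ forall n, INR n * s ^ n <= D.
Proof.
  intros Hs; destruct (Req_dec s 0) as [->|Hs0].
  { exists 0; split; [lra|]; intros [|n]; simpl; lra. }
  set (d := / s - 1).
  assert (Hd : 0 < d).
  { unfold d; assert (1 < / s); [|lra].
    rewrite <- Rinv_1; apply Rinv_lt_contravar; lra. }
  exists (/ d); split; [left; now apply Rinv_0_lt_compat|]; intros n.
  pose proof (poly n d Hd) as Hb.
  replace (1 + d) with (/ s) in Hb by (unfold d; ring).
  rewrite pow_inv in Hb.
  assert (Hp : 0 < s ^ n) by (apply pow_lt; lra).
  apply Rmult_le_reg_r with (/ s ^ n); [now apply Rinv_0_lt_compat|].
  replace (INR n * s ^ n * / s ^ n) with (INR n) by (field; lra).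
  apply Rmult_le_reg_l with d; [exact Hd|].
  replace (d * (/ d * / s ^ n)) with (/ s ^ n) by (field; lra); lra.
Qed.

Lemma sqrt_in_unit r : 0 <= r < 1 -> 0 <= sqrt r < 1.
Proof.
  intros Hr; split; [apply sqrt_pos|].
  rewrite <- sqrt_1; apply sqrt_lt_1; lra.
Qed.

Lemma INR_pow_geom r : 0 <= r < 1 ->
  exists D, 0 <= D /\ forall n, INR n * r ^ n <= D * sqrt r ^ n.
Proof.
  intros Hr; pose proof (sqrt_in_unit r Hr) as Hs.
  destruct (INR_pow_bounded (sqrt r) Hs) as [D [HD H]].
  exists D; split; [exact HD|]; intros n.
  replace (r ^ n) with (sqrt r ^ n * sqrt r ^ n).
  - rewrite <- Rmult_assoc; apply Rmult_le_compat_r; [apply pow_le; lra | apply H].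
  - rewrite <- Rpow_mult_distr, sqrt_sqrt by lra; reflexivity.
Qed.

Lemma ex_series_pow r : 0 <= r < 1 -> ex_series (fun n => r ^ n).
Proof. intros Hr; apply ex_series_geom; rewrite Rabs_pos_eq; lra. Qed.

Lemma ex_series_INR_pow r : 0 <= r < 1 -> ex_series (fun n => INR n * r ^ n).
Proof.
  intros Hr; destruct (INR_pow_geom r Hr) as [D [HD H]].
  apply (ex_series_le (V := R_CompleteNormedModule) _ (fun n => D * sqrt r ^ n)).
  - intros n; change (Rabs (INR n * r ^ n) <= D * sqrt r ^ n).
    rewrite Rabs_pos_eq; [apply H|].
    apply Rmult_le_pos; [apply pos_INR | apply pow_le; lra].
  - apply (ex_series_scal (V := R_NormedModule)), ex_series_pow, sqrt_in_unit, Hr.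
Qed.

Lemma Csum_INR_pow (x : C) : Cmod x < 1 ->
  Csum (fun n => RtoC (INR n) * x ^ n)%C (x / (1 - x) ^ 2)%C.
Proof.
  intros Hx; apply Csum_lim.
  assert (Hx1 : (1 - x)%C <> 0%C).
  { intros E; replace x with (1 - (1 - x))%C in Hx by ring; rewrite E in Hx.
    replace (1 - 0)%C with (RtoC 1) in Hx by ring; rewrite Cmod_1 in Hx; lra. }
  pose proof (Cmod_ge_0 x) as Hx0.
  destruct (INR_pow_geom (Cmod x) (conj Hx0 Hx)) as [D [HD HB]].
  pose proof (sqrt_in_unit _ (conj Hx0 Hx)) as Hs.
  set (e := Cmod ((1 - x) ^ 2)).
  assert (He : 0 < e) by (apply Cmod_gt_0, Cpow_nz; exact Hx1).
  apply Clim_of_bound with (N := 1%nat) (v := fun n => 2 * D / e * sqrt (Cmod x) ^ n).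
  2:{ replace (Finite 0) with (Rbar_mult (2 * D / e) 0) by (simpl; f_equal; ring).
      apply is_lim_seq_scal_l, is_lim_seq_geom; rewrite Rabs_pos_eq; lra. }
  assert (Hcl : forall n, csum (fun n => RtoC (INR n) * x ^ n)%C n =
    ((x - RtoC (INR n) * x ^ n + (RtoC (INR n) - 1) * x ^ n * x) / (1 - x) ^ 2)%C).
  { induction n as [|n IH]; [simpl; field; exact Hx1|].
    simpl csum; rewrite IH, S_INR, RtoC_plus; simpl Cpow; field; exact Hx1. }
  intros n Hn; rewrite Hcl.
  replace (_ - _)%C with
    ((x ^ n * (- RtoC (INR n) + RtoC (INR n - 1) * x)) / (1 - x) ^ 2)%C
    by (rewrite RtoC_minus; field; exact Hx1).
  rewrite Cmod_div by (now apply Cpow_nz); fold e; rewrite Cmod_mult, Cmod_pow.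
  apply Rle_div_l; [exact He|].
  replace (2 * D / e * sqrt (Cmod x) ^ n * e) with (2 * (D * sqrt (Cmod x) ^ n)) by (field; lra).
  apply le_INR in Hn; simpl (INR 1) in Hn.
  assert (Cmod (- RtoC (INR n) + RtoC (INR n - 1) * x) <= 2 * INR n).
  { eapply Rle_trans; [apply Cmod_triangle|].
    rewrite Cmod_opp, Cmod_mult, !Cmod_R, !Rabs_pos_eq by lra; nra. }
  apply Rle_trans with (Cmod x ^ n * (2 * INR n));
    [apply Rmult_le_compat_l; [apply pow_le|]; lra|].
  specialize (HB n); lra.
Qed.

Lemma Cmod_e2pi_lt_1 z : inH z -> Cmod (e2pi z) < 1.
Proof.
  unfold inH; intros H; rewrite Cmod_e2pi, <- exp_0; apply exp_increasing.
  pose proof PI_RGT_0; nra.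
Qed.

Lemma gfun_series z : inH z -> Csum (fun n => RtoC (INR n) * e2pi z ^ n)%C (gfun z).
Proof. intros H; apply Csum_INR_pow, Cmod_e2pi_lt_1, H. Qed.

(** Used to put the series in powers of [X ^ l] on the scale of powers of [X]. *)
Lemma Csum_sparse b s l : (0 < l)%nat -> Csum b s ->
  Csum (fun N => if (N mod l =? 0)%nat then b (N / l)%nat else RtoC 0) s.
Proof.
  intros Hl H; rewrite Csum_lim in *.
  assert (E : forall N, csum (fun N => if (N mod l =? 0)%nat then b (N / l)%nat else RtoC 0) N
     = csum b ((N + (l - 1)) / l)%nat).
  { induction N as [|N IH].
    - rewrite Nat.div_small by lia; reflexivity.
    - simpl csum at 1; rewrite IH; clear IH.
      pose proof (Nat.div_mod_eq N l) as Hd; pose proof (Nat.mod_upper_bound N l ltac:(lia)) as Hr.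
      set (k := (N / l)%nat) in *; set (r := (N mod l)%nat) in *.
      destruct (Nat.eqb_spec r 0) as [Hr0|Hr0].
      + replace ((N + (l - 1)) / l)%nat with k
          by (apply Nat.div_unique with (l - 1)%nat; nia).
        replace ((S N + (l - 1)) / l)%nat with (S k)
          by (apply Nat.div_unique with O; nia).
        reflexivity.
      + replace ((N + (l - 1)) / l)%nat with (S k)
          by (apply Nat.div_unique with (r - 1)%nat; nia).
        replace ((S N + (l - 1)) / l)%nat with (S k)
          by (apply Nat.div_unique with r; nia).
        ring. }
  apply filterlim_ext with (fun N => csum b ((N + (l - 1)) / l)%nat); [now intros|].
  apply filterlim_comp with (2 := H).
  intros P [N0 HN0]; exists (N0 * l)%nat; intros n Hn; apply HN0.
  apply Nat.div_le_lower_bound; nia.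
Qed.

Definition lambert_term (A B : nat -> C) (l N : nat) : C :=
  if (N mod l =? 0)%nat then (A l * (B (N / l)%nat * RtoC (INR (N / l))))%C else RtoC 0.

(** These are the coefficients of the Lambert series
    [sum_l A l * sum_n n * B n * X ^ (l * n)], as shown in [Csum_lambert]; the divisors
    [l] of [N] are at most [N]. *)
Definition lambert (A B : nat -> C) (N : nat) : C :=
  csum (fun l => lambert_term A B (S l) N) N.

Lemma lambert_term_far A B l N : (N <= l)%nat -> lambert_term A B (S l) N = 0%C.
Proof.
  intros H; unfold lambert_term.
  destruct (Nat.eqb_spec (N mod S l) 0) as [E|E]; [|reflexivity].
  rewrite Nat.div_small by lia; simpl; ring.
Qed.

Lemma Cmod_lambert_term A B l N : (forall n, Cmod (A n) <= 1) -> (forall n, Cmod (B n) <= 1) ->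
  Cmod (lambert_term A B (S l) N) <= INR N.
Proof.
  intros HA HB; unfold lambert_term; destruct (_ =? _)%nat.
  - rewrite !Cmod_mult, Cmod_R, Rabs_pos_eq by apply pos_INR.
    assert (INR (N / S l) <= INR N) by (apply le_INR, Nat.Div0.div_le_upper_bound; nia).
    pose proof (pos_INR (N / S l)); pose proof (Cmod_ge_0 (B (N / S l)%nat)).
    specialize (HA (S l)); specialize (HB (N / S l)%nat); pose proof (Cmod_ge_0 (A (S l))).
    assert (Cmod (B (N / S l)%nat) * INR (N / S l) <= INR N) by nra.
    assert (0 <= Cmod (B (N / S l)%nat) * INR (N / S l)) by nra.
    nra.
  - rewrite Cmod_0; apply pos_INR.
Qed.

(** The order of summation over [l] and [N = l n] can be exchanged: as [l <= N], the term
    is at most [N |X|^N <= |X|^(l/2) * N |X|^(N/2)], a product of summable functions. *)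
Lemma Csum_lambert A B X G : Cmod X < 1 ->
  (forall n, Cmod (A n) <= 1) -> (forall n, Cmod (B n) <= 1) ->
  (forall l, Csum (fun n => B n * (RtoC (INR n) * (X ^ S l) ^ n))%C (G l)) ->
  exists S0, Csum (fun N => lambert A B N * X ^ N)%C S0 /\ Csum (fun l => A (S l) * G l)%C S0.
Proof.
  intros HX HA HB HG; pose proof (Cmod_ge_0 X) as HX0.
  set (s := sqrt (Cmod X)).
  assert (Hs : 0 <= s < 1) by (apply sqrt_in_unit; lra).
  assert (HsX : forall N, s ^ N * s ^ N = Cmod X ^ N).
  { intros N; rewrite <- Rpow_mult_distr; unfold s; rewrite sqrt_sqrt by lra; reflexivity. }
  set (x := fun l N => (lambert_term A B (S l) N * X ^ N)%C).
  assert (Hrow : forall l, Csum (x l) (A (S l) * G l)%C).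
  { intros l.
    apply Csum_ext with (fun N => A (S l) * (if (N mod S l =? 0)%nat then
      (fun n => B n * (RtoC (INR n) * (X ^ S l) ^ n)) (N / S l)%nat else 0))%C.
    - intros N; unfold x, lambert_term.
      destruct (Nat.eqb_spec (N mod S l) 0) as [E|E]; [|ring].
      rewrite <- Cpow_mult_r.
      replace (S l * (N / S l))%nat with N; [ring|].
      pose proof (Nat.div_mod_eq N (S l)); lia.
    - apply Csum_scal.
      apply (Csum_sparse (fun n => B n * (RtoC (INR n) * (X ^ S l) ^ n))%C);
        [lia | apply HG]. }
  assert (Hx : forall l N, Cmod (x l N) <= s ^ l * (INR N * s ^ N)).
  { intros l N; destruct (le_lt_dec N l) as [H|H].
    - unfold x; rewrite lambert_term_far, Cmult_0_l, Cmod_0 by exact H.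
      pose proof (pos_INR N).
      repeat apply Rmult_le_pos; trivial; apply pow_le; lra.
    - unfold x; rewrite Cmod_mult, Cmod_pow, <- HsX.
      pose proof (Cmod_lambert_term A B l N HA HB) as Hl.
      pose proof (Cmod_ge_0 (lambert_term A B (S l) N)).
      assert (Hsl : s ^ N <= s ^ l).
      { replace N with (l + (N - l))%nat by lia; rewrite pow_add.
        rewrite <- (Rmult_1_r (s ^ l)) at 2; apply Rmult_le_compat_l; [apply pow_le; lra|].
        rewrite <- (pow1 (N - l)); apply pow_incr; lra. }
      assert (Hs0 : 0 <= s ^ N) by (apply pow_le; lra).
      pose proof (pos_INR N).
      apply Rle_trans with (INR N * (s ^ l * s ^ N)); [|lra].
      apply Rmult_le_compat; nra. }
  assert (Hcol : forall N, Csum (fun l => x l N) (lambert A B N * X ^ N)%C).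
  { intros N; unfold x; apply Csum_scal_r.
    apply Csum_finite; intros l Hl; now apply lambert_term_far. }
  destruct (INR_pow_geom (Cmod X) (conj HX0 HX)) as [D [HD HB']]; fold s in HB'.
  destruct (Csum_abs_le (fun N => lambert A B N * X ^ N)%C
    (fun N => D * (INR N * s ^ N))) as [S0 HS0].
  - intros N; rewrite Cmod_mult, Cmod_pow.
    assert (HlN : Cmod (lambert A B N) <= INR N * INR N).
    { apply Cmod_csum_le; intros l _; now apply Cmod_lambert_term. }
    pose proof (pos_INR N).
    assert (0 <= Cmod X ^ N) by (apply pow_le; lra).
    apply Rle_trans with (INR N * INR N * Cmod X ^ N); [now apply Rmult_le_compat_r|].
    specialize (HB' N); nra.
  - apply (ex_series_scal (V := R_NormedModule)), ex_series_INR_pow, Hs.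
  - exists S0; split; [exact HS0|].
    apply (Csum_fubini x (fun l => s ^ l) (fun N => INR N * s ^ N) _
      (fun N => lambert A B N * X ^ N)%C); trivial.
    + now apply ex_series_pow.
    + now apply ex_series_INR_pow.
Qed.

(** * Fifth roots of unity *)

Definition ec (j : Z) : C := e2pi (CZ j / 5).

Lemma ec_plus i j : ec (i + j) = (ec i * ec j)%C.
Proof. unfold ec; rewrite <- e2pi_plus, CZ_plus; f_equal; field. Qed.

Lemma ec_period j k : ec (j + 5 * k) = ec j.
Proof.
  unfold ec; rewrite <- (e2pi_period (CZ j / 5) k); f_equal.
  rewrite CZ_plus, CZ_mult; unfold CZ; field.
Qed.

Lemma ec_0 : ec 0 = 1%C.
Proof. unfold ec; rewrite <- e2pi_0; f_equal; unfold CZ; field. Qed.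

Lemma ec_sum : (1 + ec 1 + ec (-1) + ec 2 + ec (-2))%C = 0%C.
Proof.
  assert (E1 : ec 1 <> 1%C).
  { apply nonint_e2pi; intros k E.
    apply (f_equal (Cmult 5)) in E; unfold CZ in E.
    replace (5 * (1 / 5))%C with (RtoC 1) in E by field.
    rewrite <- RtoC_mult, <- mult_IZR in E; apply RtoC_inj, eq_IZR in E; lia. }
  replace (ec (-1)) with (ec 1 * ec 1 * ec 1 * ec 1)%C.
  2:{ rewrite <- !ec_plus; apply (ec_period (-1) 1). }
  replace (ec (-2)) with (ec 1 * ec 1 * ec 1)%C.
  2:{ rewrite <- !ec_plus; apply (ec_period (-2) 1). }
  replace (ec 2) with (ec 1 * ec 1)%C by (rewrite <- ec_plus; reflexivity).
  assert (E5 : (ec 1 * ec 1 * ec 1 * ec 1 * ec 1)%C = 1%C).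
  { rewrite <- !ec_plus, <- ec_0; apply (ec_period 0 1). }
  generalize dependent (ec 1); intros z Hz E5.
  assert (Hz1 : (z - 1)%C <> 0%C).
  { intros E; apply Hz; replace z with ((z - 1) + 1)%C by ring; rewrite E; ring. }
  replace (1 + z + z * z * z * z + z * z + z * z * z)%C
    with ((z * z * z * z * z - 1) / (z - 1))%C by (field; exact Hz1).
  rewrite E5; field; exact Hz1.
Qed.

Lemma sqrt5_pos : 0 < sqrt 5.
Proof. apply sqrt_lt_R0; lra. Qed.

Lemma sqrt5_sq : (RtoC (sqrt 5) * RtoC (sqrt 5))%C = 5%C.
Proof. rewrite <- RtoC_mult, sqrt_sqrt by lra; reflexivity. Qed.

Lemma sqrt5_neq_0 : RtoC (sqrt 5) <> 0%C.
Proof. intros E; apply RtoC_inj in E; pose proof sqrt5_pos; lra. Qed.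

(** This is [2 cos (2 pi / 5)], the positive root of [y^2 + y - 1]. *)
Lemma ec_1 : (ec 1 + ec (-1))%C = ((RtoC (sqrt 5) - 1) / 2)%C.
Proof.
  set (c := cos (2 * PI / 5)).
  assert (E : (ec 1 + ec (-1))%C = RtoC (2 * c)).
  { replace (ec (-1)) with (e2pi (- (CZ 1 / 5))) by (unfold ec; f_equal; unfold CZ; field).
    replace (ec 1 + e2pi (- (CZ 1 / 5)))%C with
      ((e2pi (CZ 1 / 5) + e2pi (- (CZ 1 / 5)) - 2) + 2)%C by (unfold ec; ring).
    rewrite e2pi_sym; simpl.
    replace (1 * (5 / (5 * (5 * 1) + 0 * (0 * 1))) - 0 * (- 0 / (5 * (5 * 1) + 0 * (0 * 1))))
      with (1 / 5) by field.
    replace (1 * (- 0 / (5 * (5 * 1) + 0 * (0 * 1))) + 0 * (5 / (5 * (5 * 1) + 0 * (0 * 1))))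
      with 0 by field.
    rewrite Rmult_0_r, cosh_0, sinh_0; unfold c.
    replace (2 * PI * (1 / 5)) with (2 * PI / 5) by field.
    apply C_eq; simpl; ring. }
  assert (Hc : 0 < c).
  { pose proof PI_RGT_0; apply cos_gt_0; lra. }
  assert (Eq : ((ec 1 + ec (-1)) * (ec 1 + ec (-1)) + (ec 1 + ec (-1)) - 1)%C = 0%C).
  { rewrite <- ec_sum.
    replace (ec 2) with (ec 1 * ec 1)%C by (rewrite <- ec_plus; reflexivity).
    replace (ec (-2)) with (ec (-1) * ec (-1))%C by (rewrite <- ec_plus; reflexivity).
    assert (E1 : (ec 1 * ec (-1))%C = 1%C) by (rewrite <- ec_plus; apply ec_0).
    replace (_ - 1)%C with
      (ec 1 * ec 1 + ec (-1) * ec (-1) + ec 1 + ec (-1) + 2 * (ec 1 * ec (-1)) - 1)%C by ring.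
    rewrite E1; ring. }
  rewrite E in *.
  rewrite <- RtoC_mult, <- RtoC_plus, <- RtoC_minus in Eq; apply RtoC_inj in Eq.
  assert (Hs : sqrt 5 = 4 * c + 1).
  { rewrite <- (sqrt_pow2 (4 * c + 1)) by lra; f_equal; nra. }
  rewrite Hs, RtoC_plus, !RtoC_mult; field.
Qed.

Lemma ec_2 : (ec 2 + ec (-2))%C = ((- RtoC (sqrt 5) - 1) / 2)%C.
Proof.
  replace (ec 2 + ec (-2))%C with
    ((1 + ec 1 + ec (-1) + ec 2 + ec (-2)) - 1 - (ec 1 + ec (-1)))%C by ring.
  rewrite ec_sum, ec_1; field.
Qed.

Lemma ec_mod5 n : exists r k, (n = 5 * k + r)%Z /\
  (r = 0 \/ r = 1 \/ r = 2 \/ r = -2 \/ r = -1)%Z.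
Proof.
  pose proof (Z.div_mod n 5 ltac:(lia)); pose proof (Z.mod_pos_bound n 5 ltac:(lia)).
  destruct (Z_le_gt_dec (n mod 5) 2).
  - exists (n mod 5)%Z, (n / 5)%Z; lia.
  - exists (n mod 5 - 5)%Z, (n / 5 + 1)%Z; lia.
Qed.

Lemma chi_period r k : chi (5 * k + r) = chi r.
Proof.
  unfold chi; replace (5 * k + r)%Z with (r + k * 5)%Z by ring.
  now rewrite Z.mod_add by lia.
Qed.

Lemma ec_red r k c : ec (c * (5 * k + r)) = ec (c * r).
Proof.
  replace (c * (5 * k + r))%Z with (c * r + 5 * (c * k))%Z by ring; apply ec_period.
Qed.

Lemma gauss_sum n : (ec n + ec (- n) - ec (2 * n) - ec (- 2 * n))%C
  = (RtoC (sqrt 5) * CZ (chi n))%C.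
Proof.
  destruct (ec_mod5 n) as (r & k & -> & Hr).
  rewrite chi_period.
  replace (5 * k + r)%Z with (1 * (5 * k + r))%Z at 1 by ring.
  replace (- (5 * k + r))%Z with ((-1) * (5 * k + r))%Z by ring.
  rewrite !ec_red.
  pose proof ec_1 as H1; pose proof ec_2 as H2.
  assert (P4 : ec 4 = ec (-1)) by apply (ec_period (-1) 1).
  assert (P4' : ec (-4) = ec 1) by (symmetry; apply (ec_period (-4) 1)).
  assert (H3 : (RtoC (sqrt 5))%C = (ec 1 + ec (-1) - (ec 2 + ec (-2)))%C)
    by (rewrite H1, H2; field).
  rewrite H3; clear H1 H2 H3.
  destruct Hr as [Hr|[Hr|[Hr|[Hr|Hr]]]]; subst r; simpl Z.mul; rewrite ?P4, ?P4', ?ec_0;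
    unfold chi; simpl; unfold CZ; ring.
Qed.

Lemma trace_sum n : (1 + ec n + ec (- n) + ec (2 * n) + ec (- 2 * n))%C
  = if (n mod 5 =? 0)%Z then 5%C else 0%C.
Proof.
  destruct (ec_mod5 n) as (r & k & -> & Hr).
  replace ((5 * k + r) mod 5)%Z with (r mod 5)%Z.
  2:{ replace (5 * k + r)%Z with (r + k * 5)%Z by ring; now rewrite Z.mod_add by lia. }
  replace (5 * k + r)%Z with (1 * (5 * k + r))%Z at 1 by ring.
  replace (- (5 * k + r))%Z with ((-1) * (5 * k + r))%Z by ring.
  rewrite !ec_red.
  assert (P4 : ec 4 = ec (-1)) by apply (ec_period (-1) 1).
  assert (P4' : ec (-4) = ec 1) by (symmetry; apply (ec_period (-4) 1)).
  pose proof ec_sum as H.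
  destruct Hr as [Hr|[Hr|[Hr|[Hr|Hr]]]]; subst r; simpl Z.mul; rewrite ?P4, ?P4', ?ec_0;
    simpl; try (rewrite <- H); ring.
Qed.

(** The constant term of the Eisenstein series, equal to [- 25 / (4 pi^2) * L (2, chi)]. *)
Lemma gfun_fifths : (gfun (1 / 5) - gfun (2 / 5))%C = (- (1) / RtoC (sqrt 5))%C.
Proof.
  assert (Hn : forall j, (j = 1 \/ j = 2)%Z -> e2pi (CZ j / 5) <> 1%C).
  { intros j Hj; apply nonint_e2pi; intros k E.
    apply (f_equal (Cmult 5)) in E; unfold CZ in E.
    replace (5 * (RtoC (IZR j) / 5))%C with (RtoC (IZR j)) in E by field.
    rewrite <- RtoC_mult, <- mult_IZR in E; apply RtoC_inj, eq_IZR in E; lia. }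
  change (gfun (CZ 1 / 5) - gfun (CZ 2 / 5) = - (1) / RtoC (sqrt 5))%C.
  rewrite !gfun_inv by (apply Hn; auto).
  replace (e2pi (- (CZ 1 / 5))) with (ec (-1)) by (unfold ec; f_equal; unfold CZ; field).
  replace (e2pi (- (CZ 2 / 5))) with (ec (-2)) by (unfold ec; f_equal; unfold CZ; field).
  fold (ec 1) (ec 2); rewrite ec_1, ec_2.
  pose proof sqrt5_sq as Hs; pose proof sqrt5_neq_0 as H0.
  assert (N1 : (RtoC (sqrt 5) - 5)%C <> 0%C).
  { intros E; rewrite <- RtoC_minus in E; apply RtoC_inj in E.
    pose proof (sqrt_sqrt 5 ltac:(lra)); nra. }
  assert (N2 : (RtoC (sqrt 5) + 5)%C <> 0%C).
  { intros E; rewrite <- RtoC_plus in E; apply RtoC_inj in E; pose proof sqrt5_pos; lra. }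
  replace (/ ((RtoC (sqrt 5) - 1) / 2 - 2) - / ((- RtoC (sqrt 5) - 1) / 2 - 2))%C
    with (4 * RtoC (sqrt 5) / (RtoC (sqrt 5) * RtoC (sqrt 5) - 25))%C.
  2:{ assert (N3 : (- RtoC (sqrt 5) - 5)%C <> 0%C).
      { intros E; apply N2; replace (RtoC (sqrt 5) + 5)%C with (- (- RtoC (sqrt 5) - 5))%C by ring.
        rewrite E; ring. }
      field; repeat split; intros E.
      - apply N3; rewrite <- E; ring.
      - apply N1; rewrite <- E; ring.
      - apply (Cmult_neq_0 _ _ N1 N2); rewrite <- E; ring. }
  rewrite Hs.
  replace (4 * RtoC (sqrt 5) / (5 - 25))%C with
    (- (RtoC (sqrt 5) * RtoC (sqrt 5)) / (RtoC (sqrt 5) * 5))%C.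
  - rewrite Hs; field; exact H0.
  - field; exact H0.
Qed.

(** * Expansions of the Eisenstein series at the two cusps *)

Definition chiC (n : nat) : C := CZ (chi (Z.of_nat n)).

Lemma Cmod_chiC n : Cmod (chiC n) <= 1.
Proof.
  unfold chiC, CZ; rewrite Cmod_R, <- abs_IZR; apply IZR_le.
  unfold chi; destruct (_ mod 5)%Z as [|p|p]; try lia.
  do 3 (destruct p as [p|p|]; try lia).
Qed.

Lemma chiC_values :
  (chiC 0 = 0)%C /\ (chiC 1 = 1)%C /\ (chiC 2 = - (1))%C /\ (chiC 3 = - (1))%C /\
  (chiC 4 = 1)%C /\ (chiC 5 = 0)%C /\ (chiC 6 = 1)%C /\ (chiC 7 = - (1))%C.
Proof.
  assert (H : RtoC (-1) = (- (1))%C) by (rewrite <- RtoC_opp; reflexivity).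
  unfold chiC, CZ, chi; simpl; rewrite H; repeat split.
Qed.

Definition oneC (n : nat) : C := 1%C.

Lemma Cmod_oneC n : Cmod (oneC n) <= 1.
Proof. unfold oneC; rewrite Cmod_1; lra. Qed.

(** The coefficients of the two expansions of the Eisenstein series, at infinity
    in [q] and at 0 in [q^(1/5)]. *)
Definition E_inf (N : nat) : C :=
  ((if (N =? 0)%nat then - (1) / RtoC (sqrt 5) else 0) + RtoC (sqrt 5) * lambert oneC chiC N)%C.

Definition E_zero : nat -> C := lambert chiC oneC.

Lemma inH_scale r z : 0 < r -> inH z -> inH (RtoC r * z)%C.
Proof. unfold inH; destruct z; simpl; intros; nra. Qed.

Lemma inH_real_shift r z : inH z -> inH (z + RtoC r)%C.
Proof. unfold inH; destruct z; simpl; intros; lra. Qed.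

Lemma inH_lat r s z : 0 < r -> inH z -> inH (lat z r s).
Proof. intros; now apply inH_real_shift, inH_scale. Qed.

Lemma e2pi_lat_fifth l j n tau :
  (e2pi (lat tau (INR l) (IZR j / 5)) ^ n)%C
  = ((e2pi tau ^ l) ^ n * ec (j * Z.of_nat n))%C.
Proof.
  unfold lat; rewrite e2pi_plus, e2pi_nat, Cpow_mult_l; f_equal.
  unfold ec; rewrite <- e2pi_nat; f_equal.
  rewrite CZ_mult, CZ_nat; unfold CZ; rewrite RtoC_div by lra; field.
Qed.

Lemma gfun_lat_neg tau (l : Z) q : inH tau -> Rabs q <= 4 / 5 -> q <> 0 ->
  gfun (lat tau (0 + IZR (- l)) q) = gfun (lat tau (IZR l) (- q)).
Proof.
  intros Ht Hq Hq0; rewrite <- gfun_opp.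
  - f_equal; unfold lat; rewrite opp_IZR, !RtoC_plus, !RtoC_opp; ring.
  - apply lat_nonint; trivial; [rewrite Rabs_R0; lra | lra].
Qed.

(** The term [l = 0] is the constant; in the terms [l] and [- l], the fifth roots of unity
    attached to [q^(l n)] form the Gauss sum [sqrt 5 * chi n]. *)
Lemma wp_E_expansion tau : inH tau -> exists L,
  wp_E tau L /\ Csum (fun N => E_inf N * e2pi tau ^ N)%C L.
Proof.
  intros Ht.
  pose proof sqrt5_neq_0 as H5.
  set (G := fun l => ((gfun (lat tau (INR (S l)) (1 / 5)) + gfun (lat tau (INR (S l)) (-1 / 5))
     - gfun (lat tau (INR (S l)) (2 / 5)) - gfun (lat tau (INR (S l)) (-2 / 5))) / RtoC (sqrt 5))%C).
  destruct (Csum_lambert oneC chiC (e2pi tau) G) as [S0 [HS HG]].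
  - now apply Cmod_e2pi_lt_1.
  - apply Cmod_oneC.
  - apply Cmod_chiC.
  - intros l; set (X := (e2pi tau ^ S l)%C).
    assert (Hg : forall j, Csum (fun n => RtoC (INR n) * (X ^ n * ec (j * Z.of_nat n)))%C
       (gfun (lat tau (INR (S l)) (IZR j / 5)))).
    { intros j; eapply Csum_ext; [|apply gfun_series, inH_lat; trivial; apply lt_0_INR; lia].
      intros n; cbv beta; rewrite e2pi_lat_fifth; reflexivity. }
    pose proof (Csum_scal (/ RtoC (sqrt 5))%C _ _ (Csum_minus _ _ _ _ (Csum_minus _ _ _ _
      (Csum_plus _ _ _ _ (Hg 1%Z) (Hg (-1)%Z)) (Hg 2%Z)) (Hg (-2)%Z))) as H.
    replace (G l) with (/ RtoC (sqrt 5) *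
      (gfun (lat tau (INR (S l)) (1 / 5)) + gfun (lat tau (INR (S l)) (-1 / 5))
       - gfun (lat tau (INR (S l)) (2 / 5)) - gfun (lat tau (INR (S l)) (-2 / 5))))%C
      by (unfold G; field; exact H5).
    apply Csum_ext with (2 := H); intros n; cbv beta.
    unfold chiC; replace (CZ (chi (Z.of_nat n))) with (RtoC (sqrt 5) * CZ (chi (Z.of_nat n)) / RtoC (sqrt 5))%C
      by (field; exact H5).
    rewrite <- gauss_sum, Z.mul_1_l.
    replace (-1 * Z.of_nat n)%Z with (- Z.of_nat n)%Z by ring.
    field; exact H5.
  - exists (- (1) / RtoC (sqrt 5) + RtoC (sqrt 5) * S0)%C; split.
    + replace (- (1) / RtoC (sqrt 5))%C with
        (symf (fun l => gfun (lat tau (0 + IZR l) (1 / 5)) - gfun (lat tau (0 + IZR l) (2 / 5))) 0)%C.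
      2:{ simpl symf; rewrite <- gfun_fifths; unfold lat.
          rewrite Rplus_0_l, Cmult_0_l, !Cplus_0_l, !RtoC_div by lra; reflexivity. }
      apply Csum_decr.
      apply Csum_ext with (fun l => RtoC (sqrt 5) * (oneC (S l) * G l))%C;
        [|now apply Csum_scal].
      intros l; unfold symf, G, oneC.
      rewrite !gfun_lat_neg by (trivial; try small; lra).
      rewrite !Rplus_0_l, <- INR_IZR_INZ.
      replace (- (1 / 5)) with (-1 / 5) by field; replace (- (2 / 5)) with (-2 / 5) by field.
      field; exact H5.
    + apply Csum_ext with (fun N => (if (N =? 0)%nat then - (1) / RtoC (sqrt 5) else 0)
         + RtoC (sqrt 5) * (lambert oneC chiC N * e2pi tau ^ N))%C.
      * intros [|n]; unfold E_inf; simpl Nat.eqb; simpl Cpow; cbv iota; ring.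
      * apply Csum_plus; [|now apply Csum_scal].
        set (d := fun N => (if (N =? 0)%nat then - (1) / RtoC (sqrt 5) else 0)%C).
        replace (- (1) / RtoC (sqrt 5))%C with (csum d 1)
          by (unfold d; simpl; ring).
        apply Csum_finite; intros [|n] Hn; [lia | reflexivity].
Qed.

Lemma Csum_regroup a b (phi : nat -> nat) l :
  (forall n, (phi n < phi (S n))%nat) -> (forall n, csum b (S n) = csum a (phi n)) ->
  Csum a l -> Csum b l.
Proof.
  intros Hphi H Ha; rewrite Csum_lim in *.
  intros P HP; destruct (eventually_subseq phi Hphi _ (Ha P HP)) as [N HN].
  exists (S N); intros [|n] Hn; [lia|]; rewrite H; apply HN; lia.
Qed.

Lemma csum_add5 a k : csum a (k + 5) =
  (csum a k + (a k + a (k + 1)%nat + a (k + 2)%nat + a (k + 3)%nat + a (k + 4)%nat))%C.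
Proof.
  replace (k + 5)%nat with (S (S (S (S (S k))))) by lia; simpl csum.
  rewrite !Nat.add_succ_r, Nat.add_0_r; ring.
Qed.

(** The terms [l] and [- l] contain the four values of [gfun] at [m tau / 5] for
    [m = 5 l + 1], [5 l - 1], [5 l + 2] and [5 l - 2], with sign [chi m]; together they
    run once through all positive [m] prime to 5. *)
Lemma wp_E_expansion_zero tau : inH tau -> exists L,
  wp_diff (1 / 5) 0 (2 / 5) 0 tau L /\ Csum (fun N => E_zero N * e2pi (tau / 5) ^ N)%C L.
Proof.
  intros Ht.
  assert (Ht5 : inH (tau / 5)).
  { replace (tau / 5)%C with (RtoC (/ 5) * tau)%C
      by (rewrite RtoC_inv by lra; field).
    apply inH_scale; [lra | exact Ht]. }
  destruct (Csum_lambert chiC oneC (e2pi (tau / 5))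
    (fun l => gfun (lat (tau / 5) (INR (S l)) 0))) as [S0 [HS HG]].
  - now apply Cmod_e2pi_lt_1.
  - apply Cmod_chiC.
  - apply Cmod_oneC.
  - intros l; eapply Csum_ext;
      [|apply gfun_series, inH_lat; trivial; apply lt_0_INR; lia].
    intros n; cbv beta; unfold oneC.
    replace 0 with (IZR 0 / 5) at 1 by field.
    rewrite e2pi_lat_fifth, Z.mul_0_l, ec_0; ring.
  - exists S0; split; [|exact HS].
    set (a := fun m : nat => (chiC m * gfun (lat (tau / 5) (INR m) 0))%C).
    assert (Ha : Csum a S0).
    { replace S0 with (a O + S0)%C
        by (unfold a; rewrite (proj1 chiC_values); ring).
      now apply Csum_decr. }
    apply Csum_regroup with (3 := Ha) (phi := fun n => (5 * n + 3)%nat); [lia|].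
    assert (Hlat : forall (m : nat) p (l : Z), 5 * (p + IZR l) = INR m ->
       lat tau (p + IZR l) 0 = lat (tau / 5) (INR m) 0).
    { intros m p l <-; unfold lat; rewrite RtoC_mult; field. }
    assert (Hlatn : forall (m : nat) p (l : Z), Rabs p <= 4 / 5 -> p <> 0 ->
       5 * (p + IZR l) = - INR m ->
       gfun (lat tau (p + IZR l) 0) = gfun (lat (tau / 5) (INR m) 0)).
    { intros m p l Hp Hp0 E; rewrite <- gfun_opp.
      - f_equal; unfold lat; replace (INR m) with (- (5 * (p + IZR l))) by lra.
        rewrite RtoC_opp, RtoC_mult; field.
      - apply lat_nonint; trivial; [rewrite Rabs_R0; lra | now left]. }
    assert (Hchi : forall n r, chiC (5 * n + r) = chiC r).
    { intros n r; unfold chiC; rewrite Nat2Z.inj_add, Nat2Z.inj_mul.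
      now rewrite (chi_period (Z.of_nat r)). }
    destruct chiC_values as (C0 & C1 & C2 & C3 & C4 & C5 & C6 & C7).
    induction n as [|n IH].
    + simpl csum; simpl symf.
      rewrite (Hlat 1%nat), (Hlat 2%nat) by (simpl; lra).
      unfold a; rewrite C0, C1, C2; ring.
    + change (csum (symf (fun l => gfun (lat tau (1 / 5 + IZR l) 0) - gfun (lat tau (2 / 5 + IZR l) 0)))%C (S (S n)))
        with (csum (symf (fun l => gfun (lat tau (1 / 5 + IZR l) 0) - gfun (lat tau (2 / 5 + IZR l) 0))) (S n) +
              symf (fun l => gfun (lat tau (1 / 5 + IZR l) 0) - gfun (lat tau (2 / 5 + IZR l) 0)) (S n))%C.
      rewrite IH.
      replace (5 * S n + 3)%nat with (5 * n + 3 + 5)%nat by lia.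
      rewrite csum_add5.
      replace (5 * n + 3 + 1)%nat with (5 * n + 4)%nat by lia.
      replace (5 * n + 3 + 2)%nat with (5 * n + 5)%nat by lia.
      replace (5 * n + 3 + 3)%nat with (5 * n + 6)%nat by lia.
      replace (5 * n + 3 + 4)%nat with (5 * n + 7)%nat by lia.
      unfold a at 3 4 5 6 7; rewrite !Hchi; unfold symf.
      assert (En : IZR (Z.of_nat (S n)) = INR n + 1) by (rewrite <- INR_IZR_INZ; apply S_INR).
      assert (E5 : forall r, INR (5 * n + r) = 5 * INR n + INR r)
        by (intros r; rewrite plus_INR, mult_INR; simpl; ring).
      rewrite (Hlat (5 * n + 6)%nat) by (rewrite En, E5; simpl; lra).
      rewrite (Hlat (5 * n + 7)%nat) by (rewrite En, E5; simpl; lra).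
      rewrite (Hlatn (5 * n + 4)%nat (1 / 5)) by
        (try (rewrite opp_IZR, En, E5; simpl); try small; lra).
      rewrite (Hlatn (5 * n + 3)%nat (2 / 5)) by
        (try (rewrite opp_IZR, En, E5; simpl); try small; lra).
      rewrite C3, C4, C5, C6, C7; ring.
Qed.

(** * Laurent series in a root of [q] *)

Lemma Rabs_Im_le_Cmod (z : C) : Rabs (Im z) <= Cmod z.
Proof. eapply Rle_trans; [apply Rmax_r | apply Rmax_Cmod]. Qed.

Lemma Csum_cauchy a b la lb :
  Csum a la -> Csum b lb ->
  ex_series (fun n => Cmod (a n)) -> ex_series (fun n => Cmod (b n)) ->
  Csum (fun n => csum (fun k => a k * b (n - k)%nat)%C (S n)) (la * lb)%C.
Proof.
  intros Ha Hb Aa Ab.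
  assert (AR : forall u, ex_series (fun n => Cmod (u n)) -> ex_series (fun n => Rabs (Re (u n)))).
  { intros u Hu; apply (ex_series_le (V := R_CompleteNormedModule) _ (fun n => Cmod (u n)));
      [|exact Hu].
    intros n; change (Rabs (Rabs (Re (u n))) <= Cmod (u n)).
    rewrite Rabs_Rabsolu; apply re_le_Cmod. }
  assert (AI : forall u, ex_series (fun n => Cmod (u n)) -> ex_series (fun n => Rabs (Im (u n)))).
  { intros u Hu; apply (ex_series_le (V := R_CompleteNormedModule) _ (fun n => Cmod (u n)));
      [|exact Hu].
    intros n; change (Rabs (Rabs (Im (u n))) <= Cmod (u n)).
    rewrite Rabs_Rabsolu; apply Rabs_Im_le_Cmod. }
  apply Csum_iff in Ha; apply Csum_iff in Hb; destruct Ha as [Ha Ha'], Hb as [Hb Hb'].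
  apply Csum_iff; split.
  - apply is_series_ext with (fun n =>
      sum_f_R0 (fun k => Re (a k) * Re (b (n - k)%nat)) n
      - sum_f_R0 (fun k => Im (a k) * Im (b (n - k)%nat)) n).
    + intros n; change (@eq R (sum_f_R0 (fun k => Re (a k) * Re (b (n - k)%nat)) n
        - sum_f_R0 (fun k => Im (a k) * Im (b (n - k)%nat)) n)
        (Re (csum (fun k => a k * b (n - k)%nat)%C (S n)))).
      rewrite Re_csum, sum_n_Reals, <- minus_sum; reflexivity.
    + replace (Re (la * lb)) with (Re la * Re lb - Im la * Im lb)
        by (destruct la, lb; reflexivity).
      apply (is_series_minus (V := R_NormedModule)).
      * apply (is_series_mult (fun n => Re (a n)) (fun n => Re (b n))); auto.
      * apply (is_series_mult (fun n => Im (a n)) (fun n => Im (b n))); auto.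
  - apply is_series_ext with (fun n =>
      sum_f_R0 (fun k => Re (a k) * Im (b (n - k)%nat)) n
      + sum_f_R0 (fun k => Im (a k) * Re (b (n - k)%nat)) n).
    + intros n; change (@eq R (sum_f_R0 (fun k => Re (a k) * Im (b (n - k)%nat)) n
        + sum_f_R0 (fun k => Im (a k) * Re (b (n - k)%nat)) n)
        (Im (csum (fun k => a k * b (n - k)%nat)%C (S n)))).
      rewrite Im_csum, sum_n_Reals, <- sum_plus; reflexivity.
    + replace (Im (la * lb)) with (Re la * Im lb + Im la * Re lb)
        by (destruct la, lb; reflexivity).
      apply (is_series_plus (V := R_NormedModule)).
      * apply (is_series_mult (fun n => Re (a n)) (fun n => Im (b n))); auto.
      * apply (is_series_mult (fun n => Im (a n)) (fun n => Re (b n))); auto.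
Qed.

(** The coefficients of Laurent series in [e (tau / h)] are listed from the exponent
    [- K] on: index [N] stands for the exponent [N - K], index [K] for the constant. *)
Definition qexponent (h : R) (K N : nat) : R := (INR N - INR K) / h.

Definition qser (h : R) (K : nat) (c : nat -> C) (F : C -> C) : Prop :=
  forall tau, inH tau ->
    Csum (fun N => c N * e2pi (RtoC (qexponent h K N) * tau))%C (F tau).

Lemma Cmod_e2pi_real m tau : Cmod (e2pi (RtoC m * tau)) = exp (- 2 * PI * m * Im tau).
Proof. rewrite Cmod_e2pi; f_equal; destruct tau; simpl; ring. Qed.

Lemma Csum_bounded a l : Csum a l -> exists M, 0 <= M /\ forall n, Cmod (a n) <= M.
Proof.
  intros H; apply Csum_iff in H; destruct H as [H1 H2].
  assert (B : forall u : nat -> R, ex_series u -> exists M, forall n, Rabs (u n) <= M).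
  { intros u Hu; apply ex_series_lim_0 in Hu.
    destruct (filterlim_bounded (V := R_NormedModule) u) as [M HM]; [now exists 0|].
    now exists M. }
  destruct (B (fun n => Re (a n))) as [M1 HM1]; [now exists (Re l)|].
  destruct (B (fun n => Im (a n))) as [M2 HM2]; [now exists (Im l)|].
  exists (2 * Rmax M1 M2); split.
  - pose proof (Rmax_l M1 M2); specialize (HM1 O).
    pose proof (Rabs_pos (Re (a O))); lra.
  - intros n; apply Cmod_le_Re_Im.
    + eapply Rle_trans; [apply HM1 | apply Rmax_l].
    + eapply Rle_trans; [apply HM2 | apply Rmax_r].
Qed.

(** Convergence at height [y / 2] bounds the terms at height [y] geometrically. *)
Lemma qser_geom h K c F y : 0 < h -> qser h K c F -> 0 < y ->
  exists M r, 0 <= M /\ 0 <= r < 1 /\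
  forall N, Cmod (c N) * exp (- 2 * PI * qexponent h K N * y) <= M * r ^ N.
Proof.
  intros Hh HF Hy; pose proof PI_RGT_0 as Hpi.
  destruct (Csum_bounded _ _ (HF (0, y / 2) ltac:(unfold inH; simpl; lra))) as [M [HM HB]].
  set (t := PI * y / h).
  assert (Ht : 0 < t) by (apply Rdiv_lt_0_compat; nra).
  exists (M * exp (t * INR K)), (exp (- t)); repeat split.
  - apply Rmult_le_pos; [exact HM | left; apply exp_pos].
  - left; apply exp_pos.
  - rewrite <- exp_0; apply exp_increasing; lra.
  - intros N; specialize (HB N).
    rewrite Cmod_mult, Cmod_e2pi_real in HB; simpl Im in HB.
    assert (E : exp (- t) ^ N = exp (- t * INR N)).
    { clear; induction N as [|N IH]; [simpl; rewrite Rmult_0_r, exp_0; reflexivity|].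
      rewrite S_INR; simpl; rewrite IH, <- exp_plus; f_equal; ring. }
    rewrite E.
    replace (exp (- 2 * PI * qexponent h K N * y)) with
      (exp (- 2 * PI * qexponent h K N * (y / 2)) * (exp (t * INR K) * exp (- t * INR N))).
    2:{ rewrite <- !exp_plus; f_equal; unfold t, qexponent; field; lra. }
    rewrite <- !Rmult_assoc, (Rmult_assoc M), (Rmult_assoc (Cmod (c N) * _)).
    apply Rmult_le_compat_r; [|exact HB].
    apply Rmult_le_pos; left; apply exp_pos.
Qed.

Lemma qser_abs h K c F tau : 0 < h -> qser h K c F -> inH tau ->
  ex_series (fun N => Cmod (c N * e2pi (RtoC (qexponent h K N) * tau))%C).
Proof.
  intros Hh HF Ht; destruct (qser_geom h K c F (Im tau) Hh HF Ht) as (M & r & HM & Hr & HB).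
  apply (ex_series_le (V := R_CompleteNormedModule) _ (fun N => M * r ^ N)).
  - intros N; change (Rabs (Cmod (c N * e2pi (RtoC (qexponent h K N) * tau))%C) <= M * r ^ N).
    rewrite Rabs_pos_eq by apply Cmod_ge_0.
    rewrite Cmod_mult, Cmod_e2pi_real; apply HB.
  - apply (ex_series_scal (V := R_NormedModule)), ex_series_pow, Hr.
Qed.

Lemma qser_mult h K a b F E : 0 < h -> qser h K a F -> qser h 0 b E ->
  qser h K (fun N => csum (fun k => a k * b (N - k)%nat)%C (S N)) (fun tau => F tau * E tau)%C.
Proof.
  intros Hh HF HE tau Ht.
  pose proof (Csum_cauchy _ _ _ _ (HF tau Ht) (HE tau Ht)
    (qser_abs _ _ _ _ _ Hh HF Ht) (qser_abs _ _ _ _ _ Hh HE Ht)) as H.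
  apply Csum_ext with (2 := H); intros N.
  rewrite Cmult_comm, <- csum_scal; apply csum_ext; intros k Hk.
  replace (RtoC (qexponent h K N) * tau)%C with
    (RtoC (qexponent h K k) * tau + RtoC (qexponent h 0 (N - k)) * tau)%C.
  - rewrite e2pi_plus; ring.
  - rewrite <- Cmult_plus_distr_r, <- RtoC_plus; do 2 f_equal.
    unfold qexponent; rewrite minus_INR by lia; simpl; field; lra.
Qed.

(** * Complex derivatives *)

(** Differentiability with a quadratic remainder: it holds for analytic
    functions and makes the chain rule a matter of inequalities. *)
Definition cderiv (G : C -> C) (z l : C) : Prop :=
  exists B eta, 0 < eta /\ 0 <= B /\
    forall w, Cmod (w - z) <= eta -> Cmod (G w - G z - l * (w - z)) <= B * Cmod (w - z) ^ 2.

Lemma exp_taylor_1 p : Rabs (exp p - 1) <= Rabs p * exp (Rabs p).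
Proof.
  pose proof (exp_ineq1_le p); pose proof (exp_ineq1_le (- p)).
  pose proof (exp_pos p); pose proof (exp_pos (- p)).
  assert (E : exp p * exp (- p) = 1) by (rewrite <- exp_plus, Rplus_opp_r; apply exp_0).
  destruct (Rle_dec 0 p) as [Hp|Hp].
  - rewrite !Rabs_pos_eq by lra; nra.
  - rewrite (Rabs_left p) by lra; rewrite Rabs_left1 by nra.
    assert (1 <= exp (- p)) by lra. nra.
Qed.

Lemma exp_taylor_2 p : Rabs (exp p - 1 - p) <= p ^ 2 * exp (Rabs p).
Proof.
  pose proof (exp_ineq1_le p); pose proof (exp_ineq1_le (- p)).
  pose proof (exp_pos p); pose proof (exp_pos (- p)).
  assert (E : exp p * exp (- p) = 1) by (rewrite <- exp_plus, Rplus_opp_r; apply exp_0).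
  pose proof (exp_taylor_1 p) as H3.
  rewrite Rabs_pos_eq by lra.
  assert (exp p - 1 <= p * exp p) by nra.
  apply Rle_trans with (p * (exp p - 1)); [lra|].
  replace (p ^ 2) with (Rabs p * Rabs p) by (rewrite <- (pow2_abs p); ring).
  apply Rle_trans with (Rabs p * Rabs (exp p - 1)).
  - rewrite <- Rabs_mult; apply Rle_abs.
  - rewrite Rmult_assoc; apply Rmult_le_compat_l; [apply Rabs_pos | exact H3].
Qed.

Lemma sin_taylor_2 q : Rabs (sin q - q) <= q ^ 2.
Proof.
  assert (H : forall q, 0 <= q -> Rabs (sin q - q) <= q ^ 2).
  { clear q; intros q Hq; pose proof (sin_ge_cubic q Hq); pose proof (sin_le_id q Hq).
    pose proof (SIN_bound q); rewrite Rabs_left1 by lra.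
    destruct (Rle_dec q 6); nra. }
  destruct (Rle_dec 0 q) as [Hq|Hq]; [now apply H|].
  rewrite <- Rabs_Ropp; replace (- (sin q - q)) with (sin (- q) - (- q)) by (rewrite sin_neg; ring).
  replace (q ^ 2) with ((- q) ^ 2) by ring; apply H; lra.
Qed.

Lemma cos_taylor_1 q : Rabs (cos q - 1) <= q ^ 2 / 2.
Proof.
  pose proof (COS_bound q); rewrite Rabs_left1 by lra.
  destruct (Rle_dec 0 q) as [Hq|Hq].
  - pose proof (cos_ge_quad q Hq); lra.
  - pose proof (cos_ge_quad (- q) ltac:(lra)); rewrite cos_neg in *; nra.
Qed.

(** The factor [exp s] makes the estimate usable for all [v], hence simultaneously for
    all terms of a series. *)
Lemma e2pi_taylor (v : C) : let s := 2 * PI * Cmod v in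
  Cmod (e2pi v - 1 - RtoC (2 * PI) * Ci * v) <= 4 * s ^ 2 * exp s.
Proof.
  intros s; pose proof PI_RGT_0 as Hpi.
  set (p := - 2 * PI * Im v); set (q := 2 * PI * Re v).
  assert (Hp : Rabs p <= s).
  { replace p with (- (2 * PI * Im v)) by (unfold p; ring); unfold s.
    rewrite Rabs_Ropp, !Rabs_mult, (Rabs_pos_eq 2), (Rabs_pos_eq PI) by lra.
    apply Rmult_le_compat_l; [lra | apply Rabs_Im_le_Cmod]. }
  assert (Hq : Rabs q <= s).
  { unfold q, s; rewrite !Rabs_mult, (Rabs_pos_eq 2), (Rabs_pos_eq PI) by lra.
    apply Rmult_le_compat_l; [lra | apply re_le_Cmod]. }
  assert (Hs : 0 <= s) by (eapply Rle_trans; [apply Rabs_pos | exact Hp]).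
  assert (He : exp (Rabs p) <= exp s).
  { destruct Hp as [Hp|Hp]; [left; now apply exp_increasing | rewrite Hp; lra]. }
  assert (He1 : 1 <= exp s) by (pose proof (exp_ineq1_le s); lra).
  assert (He2 : exp p <= exp s).
  { apply Rle_trans with (2 := He).
    destruct (Rle_abs p) as [H|H]; [left; now apply exp_increasing | rewrite <- H; lra]. }
  assert (Hp2 : p ^ 2 <= s ^ 2) by (rewrite <- pow2_abs; apply pow_incr; split; [apply Rabs_pos | lra]).
  assert (Hq2 : q ^ 2 <= s ^ 2) by (rewrite <- pow2_abs; apply pow_incr; split; [apply Rabs_pos | lra]).
  replace (4 * s ^ 2 * exp s) with (2 * (2 * s ^ 2 * exp s)) by ring.
  pose proof (exp_pos s); pose proof (exp_pos p).
  apply Cmod_le_Re_Im.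
  - replace (Re _) with ((exp p - 1 - p) + exp p * (cos q - 1)).
    2:{ unfold e2pi; simpl; fold p q; unfold p, Im, Re; ring. }
    eapply Rle_trans; [apply Rabs_triang|]; rewrite Rabs_mult, (Rabs_pos_eq (exp p)) by lra.
    pose proof (exp_taylor_2 p); pose proof (cos_taylor_1 q).
    assert (p ^ 2 * exp (Rabs p) <= s ^ 2 * exp s).
    { apply Rmult_le_compat; trivial; [apply pow2_ge_0 | left; apply exp_pos]. }
    assert (exp p * Rabs (cos q - 1) <= exp s * s ^ 2).
    { apply Rmult_le_compat; try lra; [apply Rabs_pos|].
      pose proof (pow2_ge_0 q); lra. }
    lra.
  - replace (Im _) with ((exp p - 1) * sin q + (sin q - q)).
    2:{ unfold e2pi; simpl; fold p q; unfold q, Im, Re; ring. }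
    eapply Rle_trans; [apply Rabs_triang|]; rewrite Rabs_mult.
    pose proof (exp_taylor_1 p); pose proof (sin_taylor_2 q).
    assert (Hsin : Rabs (sin q) <= s).
    { destruct (Rle_dec 1 s) as [H3|H3].
      - apply Rle_trans with 1; [|exact H3]. apply Rabs_le; apply SIN_bound.
      - apply Rle_trans with (Rabs q); [|exact Hq].
        destruct (Rle_dec 0 q) as [Hq0|Hq0].
        + pose proof (sin_le_id q Hq0); rewrite (Rabs_pos_eq q) in * by lra.
          pose proof (sin_ge_cubic q Hq0); rewrite Rabs_pos_eq; nra.
        + rewrite <- Rabs_Ropp, <- sin_neg; rewrite (Rabs_left q) in * by lra.
          pose proof (sin_le_id (- q) ltac:(lra)).
          pose proof (sin_ge_cubic (- q) ltac:(lra)); rewrite Rabs_pos_eq; nra. }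
    assert (Rabs (exp p - 1) * Rabs (sin q) <= (s * exp s) * s).
    { apply Rmult_le_compat; try apply Rabs_pos; trivial.
      eapply Rle_trans; [exact H1|].
      apply Rmult_le_compat; trivial; [apply Rabs_pos | left; apply exp_pos]. }
    assert (s ^ 2 <= s ^ 2 * exp s).
    { rewrite <- (Rmult_1_r (s ^ 2)) at 1; apply Rmult_le_compat_l; [apply pow2_ge_0 | lra]. }
    lra.
Qed.

(** * Primitives *)

Definition CSeries (a : nat -> C) : C :=
  (Series (fun n => Re (a n)), Series (fun n => Im (a n))).

Lemma CSeries_correct a l : Csum a l -> CSeries a = l.
Proof.
  intros H; apply Csum_iff in H; destruct H as [H1 H2].
  apply C_eq; simpl; now apply is_series_unique.
Qed.

Lemma CSeries_ext a b : (forall n, a n = b n) -> CSeries a = CSeries b.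
Proof. intros H; unfold CSeries; f_equal; apply Series_ext; intros n; now rewrite H. Qed.

Lemma Cmod_Csum_le a b l s :
  Csum a l -> is_series b s -> (forall n, Cmod (a n) <= b n) -> Cmod l <= 2 * s.
Proof.
  intros Ha Hb H; apply Csum_iff in Ha; destruct Ha as [H1 H2].
  apply Cmod_le_Re_Im.
  - apply (is_series_Rabs_le _ _ _ _ H1 Hb); intros n.
    eapply Rle_trans; [apply re_le_Cmod | apply H].
  - apply (is_series_Rabs_le _ _ _ _ H2 Hb); intros n.
    eapply Rle_trans; [apply Rabs_Im_le_Cmod | apply H].
Qed.

Lemma exp_le x y : x <= y -> exp x <= exp y.
Proof. intros [H| ->]; [left; now apply exp_increasing | lra]. Qed.

Definition TwoPiI : C := (RtoC (2 * PI) * Ci)%C.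

Lemma TwoPiI_neq_0 : TwoPiI <> 0%C.
Proof.
  pose proof PI_RGT_0; apply Cmod_gt_0; unfold TwoPiI.
  rewrite Cmod_mult, Cmod_Ci, Cmod_R, Rabs_pos_eq; lra.
Qed.

Lemma Cmod_TwoPiI : Cmod TwoPiI = 2 * PI.
Proof.
  pose proof PI_RGT_0; unfold TwoPiI.
  rewrite Cmod_mult, Cmod_Ci, Cmod_R, Rabs_pos_eq; lra.
Qed.

Definition qprimitive_coef (h : R) (K : nat) (c : nat -> C) (N : nat) : C :=
  if (N =? K)%nat then RtoC 0 else (c N / (TwoPiI * RtoC (qexponent h K N)))%C.

Lemma qexponent_ge h K N : 0 < h -> N <> K -> 1 <= Rabs (qexponent h K N) * h.
Proof.
  intros Hh HN; unfold qexponent, Rdiv.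
  rewrite Rabs_mult, Rabs_inv, (Rabs_pos_eq h), Rmult_assoc, Rinv_l, Rmult_1_r by lra.
  rewrite !INR_IZR_INZ, <- minus_IZR, <- abs_IZR; apply IZR_le; lia.
Qed.

Lemma Cmod_qprimitive_coef h K c N : 0 < h ->
  Cmod (qprimitive_coef h K c N) * (2 * PI * Rabs (qexponent h K N)) <= Cmod (c N).
Proof.
  intros Hh; pose proof PI_RGT_0; unfold qprimitive_coef.
  destruct (Nat.eqb_spec N K) as [HN|HN].
  - rewrite Cmod_0; pose proof (Cmod_ge_0 (c N)); lra.
  - pose proof (qexponent_ge h K N Hh HN) as Hq.
    assert (Hq0 : 0 < Rabs (qexponent h K N)).
    { pose proof (Rabs_pos (qexponent h K N)); nra. }
    assert (Hn0 : qexponent h K N <> 0) by (intros E; rewrite E, Rabs_R0 in Hq0; lra).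
    assert (Hc0 : RtoC (qexponent h K N) <> 0%C) by (intros E; apply RtoC_inj in E; contradiction).
    rewrite Cmod_div by (apply Cmult_neq_0; [apply TwoPiI_neq_0 | exact Hc0]).
    rewrite Cmod_mult, Cmod_TwoPiI, Cmod_R; apply Req_le; field; split; lra.
Qed.

(** The constant term integrates to the linear function [c K * z], by which alone the
    primitive fails to be periodic. *)
Definition qprimitive (h : R) (K : nat) (c : nat -> C) (z : C) : C :=
  (CSeries (fun N => qprimitive_coef h K c N * e2pi (RtoC (qexponent h K N) * z)) + c K * z)%C.

Lemma qprimitive_converges h K c F z : 0 < h -> qser h K c F -> inH z ->
  exists l, Csum (fun N => qprimitive_coef h K c N * e2pi (RtoC (qexponent h K N) * z))%C l.
Proof.
  intros Hh HF Hz; pose proof PI_RGT_0.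
  apply (Csum_abs_le _ (fun N => h / (2 * PI) *
    Cmod (c N * e2pi (RtoC (qexponent h K N) * z))%C)).
  - intros N; rewrite !Cmod_mult, <- Rmult_assoc.
    apply Rmult_le_compat_r; [apply Cmod_ge_0|].
    pose proof (Cmod_qprimitive_coef h K c N Hh) as Hd.
    unfold qprimitive_coef in *; destruct (Nat.eqb_spec N K) as [HN|HN].
    + rewrite Cmod_0; apply Rmult_le_pos; [|apply Cmod_ge_0].
      apply Rdiv_le_0_compat; lra.
    + pose proof (qexponent_ge h K N Hh HN) as Hq.
      set (d := Cmod (c N / _)) in *.
      assert (0 <= d) by apply Cmod_ge_0.
      apply Rmult_le_reg_r with (2 * PI / h); [apply Rdiv_lt_0_compat; lra|].
      replace (h / (2 * PI) * Cmod (c N) * (2 * PI / h)) with (Cmod (c N)) by (field; lra).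
      eapply Rle_trans; [|exact Hd]; apply Rmult_le_compat_l; [assumption|].
      apply Rmult_le_reg_r with h; [exact Hh|].
      replace (2 * PI / h * h) with (2 * PI) by (field; lra).
      rewrite Rmult_assoc; nra.
  - apply (ex_series_scal (V := R_NormedModule)), (qser_abs h K c F z Hh HF Hz).
Qed.

Lemma inH_near z w : Cmod (w - z) <= Im z / 2 -> inH z -> inH w.
Proof.
  unfold inH; intros H Hz; pose proof (Rabs_Im_le_Cmod (w - z)) as Hi.
  replace (Im (w - z)) with (Im w - Im z) in Hi by reflexivity.
  assert (Hr : Rabs (Im w - Im z) <= Im z / 2) by lra.
  apply Rabs_le_between in Hr; lra.
Qed.

(** Termwise integration.  The remainder of the term of exponent [m] at distance
    [d] is at most a multiple of [|m| d^2 exp (2 pi |m| d)], so that the remainders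
    can be summed as long as [d] is at most half the height of the point. *)
Lemma qprimitive_cderiv h K c F z : 0 < h -> qser h K c F -> inH z ->
  cderiv (qprimitive h K c) z (F z).
Proof.
  intros Hh HF Hz; pose proof PI_RGT_0 as Hpi; unfold inH in Hz.
  set (y := Im z) in *.
  destruct (qser_geom h K c F (y / 2) Hh HF ltac:(lra)) as (M & r & HM & Hr & HB).
  set (D := 8 * PI / h * exp (2 * PI * INR K * y / h) * M).
  assert (HD : 0 <= D).
  { unfold D; apply Rmult_le_pos; [|exact HM]; apply Rmult_le_pos; [|left; apply exp_pos].
    apply Rdiv_le_0_compat; lra. }
  assert (HT : forall n, 0 <= D * (INR n * r ^ n) + D * INR K * r ^ n).
  { intros n; assert (0 <= r ^ n) by (apply pow_le; lra).
    pose proof (pos_INR n); pose proof (pos_INR K).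
    apply Rplus_le_le_0_compat.
    - apply Rmult_le_pos; [exact HD | apply Rmult_le_pos; assumption].
    - apply Rmult_le_pos; [apply Rmult_le_pos|]; assumption. }
  assert (HS : ex_series (fun N => D * (INR N * r ^ N) + D * INR K * r ^ N)).
  { apply (ex_series_plus (V := R_NormedModule)).
    - apply (ex_series_scal (V := R_NormedModule)), ex_series_INR_pow, Hr.
    - apply (ex_series_scal (V := R_NormedModule) (D * INR K)), ex_series_pow, Hr. }
  destruct HS as [S HS].
  assert (HS0 : 0 <= S).
  { apply Rle_trans with (1 := Rabs_pos S), (is_series_Rabs_le _ _ _ _ HS HS).
    intros n; apply Req_le, Rabs_pos_eq, HT. }
  exists (2 * S), (y / 2); split; [lra|]; split; [lra|].
  intros w Hw; pose proof (inH_near z w Hw Hz) as HwH.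
  destruct (qprimitive_converges h K c F z Hh HF Hz) as [lz Hlz].
  destruct (qprimitive_converges h K c F w Hh HF HwH) as [lw Hlw].
  unfold qprimitive; rewrite (CSeries_correct _ _ Hlz), (CSeries_correct _ _ Hlw).
  set (dl := (w - z)%C) in *.
  pose proof (Csum_minus _ _ _ _ (Csum_minus _ _ _ _ Hlw Hlz)
    (Csum_scal_r dl _ _ (HF z Hz))) as H1.
  assert (H2 : Csum (fun N => if (N =? K)%nat then (c K * dl)%C else RtoC 0) (c K * dl)%C).
  { set (d := fun N => if (N =? K)%nat then (c K * dl)%C else RtoC 0).
    replace (c K * dl)%C with (csum d (Datatypes.S K)).
    - apply Csum_finite; intros n Hn; unfold d.
      destruct (Nat.eqb_spec n K); [lia | reflexivity].
    - simpl; unfold d at 2; rewrite Nat.eqb_refl.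
      replace (csum d K) with (RtoC 0); [ring|].
      assert (Hd : forall k, (k <= K)%nat -> csum d k = 0%C).
      { induction k as [|k IH]; [reflexivity|]; intros Hk; simpl; rewrite IH by lia.
        unfold d; destruct (Nat.eqb_spec k K); [lia | ring]. }
      symmetry; now apply Hd. }
  pose proof (Csum_plus _ _ _ _ H1 H2) as H3; clear H1 H2 Hlz Hlw.
  replace (lw + c K * w - (lz + c K * z) - F z * dl)%C with (lw - lz - F z * dl + c K * dl)%C
    by (unfold dl; ring).
  set (e2 := Cmod dl ^ 2).
  assert (He2 : 0 <= e2) by apply pow2_ge_0.
  replace (2 * S * e2) with (2 * (e2 * S)) by ring.
  apply (Cmod_Csum_le _ (fun N => e2 * (D * (INR N * r ^ N) + D * INR K * r ^ N)) _ _ H3);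
    [now apply (is_series_scal (V := R_NormedModule))|].
  intros N; cbv beta; set (m := qexponent h K N).
  specialize (HB N); fold m in HB.
  assert (HrN : 0 <= r ^ N) by (apply pow_le; lra).
  pose proof (pos_INR N) as HN0; pose proof (pos_INR K) as HK0.
  destruct (Nat.eqb_spec N K) as [E|E].
  { assert (Hm : m = 0) by (unfold m, qexponent; rewrite E; field; lra).
    unfold qprimitive_coef; rewrite (proj2 (Nat.eqb_eq N K) E), Hm.
    replace (_ + _)%C with (RtoC 0).
    - rewrite Cmod_0; apply Rmult_le_pos; [exact He2 | apply HT].
    - rewrite (Cmult_0_l z), e2pi_0, E; ring. }
  assert (Hm0 : RtoC m <> 0%C).
  { intros E0; apply RtoC_inj in E0; pose proof (qexponent_ge h K N Hh E) as Hq.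
    fold m in Hq; rewrite E0, Rabs_R0 in Hq; lra. }
  pose proof (Cmod_qprimitive_coef h K c N Hh) as Hd; fold m in Hd.
  assert (Ed : c N = (qprimitive_coef h K c N * (TwoPiI * RtoC m))%C).
  { unfold qprimitive_coef; rewrite (proj2 (Nat.eqb_neq N K) E); fold m.
    field; split; [exact Hm0 | apply TwoPiI_neq_0]. }
  set (d := qprimitive_coef h K c N) in *.
  replace (d * e2pi (RtoC m * w) - d * e2pi (RtoC m * z) - c N * e2pi (RtoC m * z) * dl + 0)%C
    with (d * e2pi (RtoC m * z) * (e2pi (RtoC m * dl) - 1 - RtoC (2 * PI) * Ci * (RtoC m * dl)))%C.
  2:{ replace (RtoC m * w)%C with (RtoC m * z + RtoC m * dl)%C by (unfold dl; ring).
      rewrite e2pi_plus, Ed; unfold TwoPiI; ring. }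
  rewrite !Cmod_mult, Cmod_e2pi_real; fold y.
  pose proof (e2pi_taylor (RtoC m * dl)) as Ht; simpl in Ht.
  rewrite Cmod_mult, Cmod_R in Ht.
  set (am := Rabs m) in *; assert (Ham : 0 <= am) by apply Rabs_pos.
  pose proof (Cmod_ge_0 dl) as Hdl; pose proof (Cmod_ge_0 d) as Hd0.
  set (ex := exp (2 * PI * (am * Cmod dl))) in *.
  assert (Hex0 : 0 < ex) by apply exp_pos.
  pose proof (exp_pos (-2 * PI * m * y)) as Hey.
  eapply Rle_trans.
  { apply Rmult_le_compat_l; [apply Rmult_le_pos; lra | exact Ht]. }
  replace (Cmod d * exp (-2 * PI * m * y) *
    (4 * (2 * PI * (am * Cmod dl) * (2 * PI * (am * Cmod dl) * 1)) * ex))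
    with ((Cmod d * (2 * PI * am)) * (8 * PI * am * (exp (-2 * PI * m * y) * ex)) * e2)
    by (unfold e2; ring).
  rewrite (Rmult_comm e2); apply Rmult_le_compat_r; [exact He2|].
  assert (Ham1 : am <= (INR N + INR K) / h).
  { unfold am, m, qexponent, Rdiv; rewrite Rabs_mult, Rabs_inv, (Rabs_pos_eq h) by lra.
    apply Rmult_le_compat_r; [left; now apply Rinv_0_lt_compat|].
    apply Rabs_le; lra. }
  assert (Ham2 : am <= m + 2 * INR K / h).
  { replace (m + 2 * INR K / h) with ((INR N + INR K) / h); [exact Ham1|].
    unfold m, qexponent; field; lra. }
  assert (Hexp : exp (-2 * PI * m * y) * ex <=
     exp (-2 * PI * m * (y / 2)) * exp (2 * PI * INR K * y / h)).
  { unfold ex; rewrite <- !exp_plus; apply exp_le.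
    assert (am * Cmod dl <= (m + 2 * INR K / h) * (y / 2)).
    { apply Rmult_le_compat; lra. }
    replace (-2 * PI * m * (y / 2) + 2 * PI * INR K * y / h) with
      (-2 * PI * m * y + 2 * PI * ((m + 2 * INR K / h) * (y / 2))) by (field; lra).
    apply Rplus_le_compat_l, Rmult_le_compat_l; lra. }
  pose proof (Cmod_ge_0 (c N)) as Hc0.
  pose proof (exp_pos (-2 * PI * m * (y / 2))) as Hey2.
  pose proof (exp_pos (2 * PI * INR K * y / h)) as HeK.
  apply Rle_trans with (Cmod (c N) * (8 * PI * ((INR N + INR K) / h) *
     (exp (-2 * PI * m * (y / 2)) * exp (2 * PI * INR K * y / h)))).
  { apply Rmult_le_compat; trivial.
    - apply Rmult_le_pos; [exact Hd0 | apply Rmult_le_pos; lra].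
    - apply Rmult_le_pos; [apply Rmult_le_pos | apply Rmult_le_pos]; lra.
    - apply Rmult_le_compat; [apply Rmult_le_pos; lra | apply Rmult_le_pos; lra | | exact Hexp].
      apply Rmult_le_compat_l; lra. }
  replace (Cmod (c N) * _) with
    ((8 * PI / h * exp (2 * PI * INR K * y / h)) * (INR N + INR K) *
     (Cmod (c N) * exp (-2 * PI * m * (y / 2)))) by (field; lra).
  replace (D * (INR N * r ^ N) + D * INR K * r ^ N) with
    ((8 * PI / h * exp (2 * PI * INR K * y / h)) * (INR N + INR K) * (M * r ^ N))
    by (unfold D; ring).
  apply Rmult_le_compat_l; [|exact HB].
  apply Rmult_le_pos; [|lra]; apply Rmult_le_pos; [|lra].
  apply Rdiv_le_0_compat; lra.
Qed.

Lemma qprimitive_shift h K c z : 0 < h ->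
  qprimitive h K c (z + RtoC h) = (qprimitive h K c z + RtoC h * c K)%C.
Proof.
  intros Hh; unfold qprimitive.
  rewrite (CSeries_ext _ (fun N => qprimitive_coef h K c N * e2pi (RtoC (qexponent h K N) * z))%C).
  - ring.
  - intros N; f_equal.
    rewrite <- (e2pi_period (RtoC (qexponent h K N) * z) (Z.of_nat N - Z.of_nat K)); f_equal.
    replace (CZ (Z.of_nat N - Z.of_nat K)) with (RtoC (qexponent h K N * h)).
    + rewrite RtoC_mult; ring.
    + rewrite CZ_minus, !CZ_nat, <- RtoC_minus; f_equal; unfold qexponent; field; lra.
Qed.

Lemma cderiv_minus G1 G2 z l1 l2 :
  cderiv G1 z l1 -> cderiv G2 z l2 -> cderiv (fun w => G1 w - G2 w)%C z (l1 - l2)%C.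
Proof.
  intros (B1 & e1 & He1 & HB1 & H1) (B2 & e2 & He2 & HB2 & H2).
  exists (B1 + B2), (Rmin e1 e2); split; [now apply Rmin_glb_lt|]; split; [lra|].
  intros w Hw; specialize (H1 w ltac:(eapply Rle_trans; [exact Hw | apply Rmin_l])).
  specialize (H2 w ltac:(eapply Rle_trans; [exact Hw | apply Rmin_r])).
  replace (G1 w - G2 w - (G1 z - G2 z) - (l1 - l2) * (w - z))%C with
    ((G1 w - G1 z - l1 * (w - z)) - (G2 w - G2 z - l2 * (w - z)))%C by ring.
  eapply Rle_trans; [apply Cmod_triangle|]; rewrite Cmod_opp; lra.
Qed.

Lemma cderiv_zero_const D : (forall z, inH z -> cderiv D z 0) ->
  forall z w, inH z -> inH w -> D z = D w.
Proof.
  intros H z w Hz Hw.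
  set (p := fun t : R => (z + RtoC t * (w - z))%C).
  assert (Hp : forall t, 0 <= t <= 1 -> inH (p t)).
  { unfold p, inH in *; intros t Ht; destruct z as [a b], w as [a' b']; simpl in *; nra. }
  assert (Hdiff : forall t s, (p s - p t)%C = (RtoC (s - t) * (w - z))%C).
  { intros t s; unfold p; rewrite RtoC_minus; ring. }
  assert (Hlim : forall proj : C -> R, (forall u, Rabs (proj u) <= Cmod u) ->
      (forall u v, proj (u - v)%C = proj u - proj v) ->
      proj (D (p 0)) = proj (D (p 1))).
  { intros proj Hpr Hlin.
    apply (eq_is_derive (V := R_NormedModule) (fun t => proj (D (p t))) 0 1); [|lra].
    intros t Ht.
    apply is_derive_Reals; intros eps Heps.
    destruct (H (p t) (Hp t Ht)) as (B & eta & Heta & HB & HD).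
    set (m := Cmod (w - z) + 1).
    assert (Hm : 1 <= m) by (unfold m; pose proof (Cmod_ge_0 (w - z)); lra).
    assert (HBm : 0 < B * m ^ 2 + 1) by (assert (0 <= B * m ^ 2) by (apply Rmult_le_pos; [lra | apply pow2_ge_0]); lra).
    set (d := Rmin (eta / m) (eps / (B * m ^ 2 + 1))).
    assert (Hd : 0 < d) by (apply Rmin_glb_lt; apply Rdiv_lt_0_compat; lra).
    exists (mkposreal d Hd); intros h Hh Hhd; simpl in Hhd.
    assert (Hh1 : Rabs h * m <= eta).
    { apply Rle_div_r; [lra|]; left; eapply Rlt_le_trans; [exact Hhd | apply Rmin_l]. }
    assert (Hh2 : Rabs h * (B * m ^ 2 + 1) < eps).
    { apply Rlt_div_r; [lra|]; eapply Rlt_le_trans; [exact Hhd | apply Rmin_r]. }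
    assert (Hmod : Cmod (p (t + h) - p t) <= Rabs h * m).
    { rewrite Hdiff, Cmod_mult, Cmod_R; replace (t + h - t) with h by ring.
      apply Rmult_le_compat_l; [apply Rabs_pos | unfold m; lra]. }
    specialize (HD (p (t + h)) ltac:(lra)).
    rewrite Rminus_0_r; unfold Rdiv; rewrite Rabs_mult, Rabs_inv, <- Hlin.
    apply Rabs_pos_lt in Hh.
    apply Rmult_lt_reg_r with (Rabs h); [exact Hh|].
    rewrite Rmult_assoc, Rinv_l, Rmult_1_r by lra.
    eapply Rle_lt_trans; [apply Hpr|].
    replace (D (p (t + h)%R) - D (p t))%C with
      (D (p (t + h)%R) - D (p t) - 0 * (p (t + h)%R - p t))%C by ring.
    eapply Rle_lt_trans; [exact HD|].
    assert (Cmod (p (t + h) - p t) ^ 2 <= (Rabs h * m) ^ 2).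
    { apply pow_incr; split; [apply Cmod_ge_0 | exact Hmod]. }
    apply Rle_lt_trans with (Rabs h * (Rabs h * (B * m ^ 2))); [nra|].
    rewrite (Rmult_comm eps); apply Rmult_lt_compat_l; [exact Hh|]. nra. }
  replace z with (p 0) by (unfold p; ring).
  replace w with (p 1) by (unfold p; ring).
  apply C_eq.
  - apply Hlim; [apply re_le_Cmod | reflexivity].
  - apply Hlim; [apply Rabs_Im_le_Cmod | reflexivity].
Qed.

Lemma cocyc_neq_0 a b c d z : (a * d - b * c = 1)%Z -> inH z -> cocyc c d z <> 0%C.
Proof.
  unfold inH; intros Hdet Hz E.
  assert (Ei := f_equal Im E); assert (Er := f_equal Re E).
  destruct z as [x y]; simpl in *.
  assert (Hc : IZR c = 0) by (apply Rmult_eq_reg_r with y; lra).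
  rewrite Hc in Er; assert (Hd : IZR d = 0) by lra.
  apply eq_IZR in Hc; apply eq_IZR in Hd; subst; lia.
Qed.

Lemma inH_mobius a b c d z : (a * d - b * c = 1)%Z -> inH z -> inH (mobius a b c d z).
Proof.
  intros Hdet Hz; pose proof (cocyc_neq_0 a b c d z Hdet Hz) as H0.
  apply Cmod_gt_0 in H0; assert (H1 : 0 < Cmod (cocyc c d z) ^ 2) by now apply pow_lt.
  rewrite Cmod2_alt in H1.
  apply (f_equal IZR) in Hdet; rewrite minus_IZR, !mult_IZR in Hdet.
  unfold inH in *; destruct z as [x y]; unfold mobius, cocyc in *; simpl in *.
  set (X := IZR c * x - 0 * y + IZR d) in *; set (Y := IZR c * y + 0 * x + 0) in *.
  replace (_ + _) with ((IZR a * IZR d - IZR b * IZR c) * y / (X ^ 2 + Y ^ 2)).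
  - rewrite Hdet; apply Rdiv_lt_0_compat; simpl; nra.
  - unfold X, Y; field; unfold X, Y in H1; nra.
Qed.

Lemma mobius_diff a b c d z w : (a * d - b * c = 1)%Z -> inH z -> inH w ->
  (mobius a b c d w - mobius a b c d z)%C = ((w - z) / (cocyc c d w * cocyc c d z))%C.
Proof.
  intros Hdet Hz Hw.
  pose proof (cocyc_neq_0 a b c d z Hdet Hz); pose proof (cocyc_neq_0 a b c d w Hdet Hw).
  assert (E : (CZ a * CZ d - CZ b * CZ c)%C = 1%C).
  { rewrite <- !CZ_mult, <- CZ_minus, Hdet; reflexivity. }
  replace (w - z)%C with ((CZ a * CZ d - CZ b * CZ c) * (w - z))%C by (rewrite E; ring).
  unfold mobius; unfold cocyc in *; field; auto.
Qed.

Lemma cderiv_mobius a b c d G z l : (a * d - b * c = 1)%Z -> inH z ->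
  cderiv G (mobius a b c d z) l ->
  cderiv (fun w => G (mobius a b c d w)) z (l / cocyc c d z ^ 2)%C.
Proof.
  intros Hdet Hz (B & eta & Heta & HB & HG).
  pose proof (cocyc_neq_0 a b c d z Hdet Hz) as H0.
  set (J := cocyc c d z) in *.
  set (j := Cmod J); assert (Hj : 0 < j) by now apply Cmod_gt_0.
  set (cc := Cmod (CZ c) + 1).
  assert (Hcc : 1 <= cc) by (unfold cc; pose proof (Cmod_ge_0 (CZ c)); lra).
  exists (4 * B / j ^ 4 + 2 * Cmod l * cc / j ^ 3), (Rmin (Im z / 2) (Rmin (j / (2 * cc)) (eta * j ^ 2 / 2))).
  assert (Hj2 : 0 < j ^ 2) by now apply pow_lt.
  assert (Hj3 : 0 < j ^ 3) by now apply pow_lt.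
  assert (Hj4 : 0 < j ^ 4) by now apply pow_lt.
  pose proof (Cmod_ge_0 l) as Hl.
  split; [|split].
  - unfold inH in Hz; repeat apply Rmin_glb_lt; [lra| |].
    + apply Rdiv_lt_0_compat; lra.
    + apply Rdiv_lt_0_compat; [apply Rmult_lt_0_compat; lra | lra].
  - apply Rplus_le_le_0_compat; apply Rdiv_le_0_compat; try lra.
    apply Rmult_le_pos; lra.
  - intros w Hw.
    assert (Hw1 : Cmod (w - z) <= Im z / 2) by (eapply Rle_trans; [exact Hw | apply Rmin_l]).
    assert (Hw2 : Cmod (w - z) <= j / (2 * cc)).
    { eapply Rle_trans; [exact Hw|]; eapply Rle_trans; [apply Rmin_r | apply Rmin_l]. }
    assert (Hw3 : Cmod (w - z) <= eta * j ^ 2 / 2).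
    { eapply Rle_trans; [exact Hw|]; eapply Rle_trans; [apply Rmin_r | apply Rmin_r]. }
    pose proof (inH_near z w Hw1 Hz) as HwH.
    pose proof (cocyc_neq_0 a b c d w Hdet HwH) as Hw0.
    set (Jw := cocyc c d w) in *.
    set (dl := Cmod (w - z)) in *.
    assert (Hdl : 0 <= dl) by apply Cmod_ge_0.
    assert (EJ : (Jw - J)%C = (CZ c * (w - z))%C) by (unfold Jw, J, cocyc; ring).
    assert (HJw : j / 2 <= Cmod Jw).
    { assert (Hjj : j <= Cmod Jw + Cmod (CZ c * (w - z))).
      { unfold j; replace J with (Jw - CZ c * (w - z))%C by (rewrite <- EJ; ring).
        eapply Rle_trans; [apply Cmod_triangle|]; rewrite Cmod_opp; lra. }
      rewrite Cmod_mult in Hjj; fold dl in Hjj.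
      assert (dl * cc <= j / 2).
      { apply Rle_trans with (j / (2 * cc) * cc); [apply Rmult_le_compat_r; lra|].
        apply Req_le; field; lra. }
      assert (Cmod (CZ c) * dl <= dl * cc) by (unfold cc; nra).
      lra. }
    assert (Hjw : 0 < Cmod Jw) by lra.
    assert (Hinv : / Cmod Jw <= 2 / j).
    { replace (2 / j) with (/ (j / 2)) by (field; lra).
      apply Rinv_le_contravar; lra. }
    pose proof (mobius_diff a b c d z w Hdet Hz HwH) as Hm; fold J Jw in Hm.
    assert (Hmm : Cmod (mobius a b c d w - mobius a b c d z) <= 2 * dl / j ^ 2).
    { rewrite Hm, Cmod_div, Cmod_mult by (now apply Cmult_neq_0); fold j dl.
      replace (dl / (Cmod Jw * j)) with (dl * / j * / Cmod Jw) by (field; lra).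
      replace (2 * dl / j ^ 2) with (dl * / j * (2 / j)) by (field; lra).
      apply Rmult_le_compat_l; [|exact Hinv].
      apply Rmult_le_pos; [lra | left; now apply Rinv_0_lt_compat]. }
    assert (Hme : Cmod (mobius a b c d w - mobius a b c d z) <= eta).
    { eapply Rle_trans; [exact Hmm|]; apply Rle_div_l; lra. }
    specialize (HG _ Hme).
    replace (G (mobius a b c d w) - G (mobius a b c d z) - l / J ^ 2 * (w - z))%C with
      ((G (mobius a b c d w) - G (mobius a b c d z) - l * (mobius a b c d w - mobius a b c d z))
       - l * CZ c * ((w - z) ^ 2) / (Jw * J ^ 2))%C.
    2:{ rewrite Hm.
        replace (l * CZ c * (w - z) ^ 2)%C with (l * (w - z) * (Jw - J))%C by (rewrite EJ; ring).
        field; auto. }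
    eapply Rle_trans; [apply Cmod_triangle|]; rewrite Cmod_opp.
    assert (HJ2 : (J ^ 2)%C <> 0%C) by now apply Cpow_nz.
    rewrite Cmod_div, !Cmod_mult, !Cmod_pow by (now apply Cmult_neq_0); fold j dl.
    assert (T1 : B * Cmod (mobius a b c d w - mobius a b c d z) ^ 2 <= 4 * B / j ^ 4 * dl ^ 2).
    { apply Rle_trans with (B * (2 * dl / j ^ 2) ^ 2).
      - apply Rmult_le_compat_l; [exact HB|]; apply pow_incr; split; [apply Cmod_ge_0 | exact Hmm].
      - apply Req_le; field; lra. }
    assert (T2 : Cmod l * Cmod (CZ c) * dl ^ 2 / (Cmod Jw * j ^ 2) <= 2 * Cmod l * cc / j ^ 3 * dl ^ 2).
    { replace (Cmod l * Cmod (CZ c) * dl ^ 2 / (Cmod Jw * j ^ 2)) with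
        ((Cmod l * dl ^ 2 / j ^ 2) * (Cmod (CZ c) * / Cmod Jw)) by (field; lra).
      replace (2 * Cmod l * cc / j ^ 3 * dl ^ 2) with
        ((Cmod l * dl ^ 2 / j ^ 2) * (cc * (2 / j))) by (field; lra).
      apply Rmult_le_compat_l.
      - apply Rdiv_le_0_compat; [apply Rmult_le_pos; [lra | apply pow2_ge_0] | lra].
      - apply Rmult_le_compat; [apply Cmod_ge_0 | left; now apply Rinv_0_lt_compat | unfold cc; lra | exact Hinv]. }
    lra.
Qed.

(** * Cancellation of the constant terms at the two cusps *)

Lemma mobius_S tau : mobius 0 (-1) 1 0 tau = (- (1) / tau)%C.
Proof.
  unfold mobius, cocyc, CZ.
  replace (RtoC 0 * tau + RtoC (-1))%C with (- (1))%C by ring.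
  replace (RtoC 1 * tau + RtoC 0)%C with tau by ring.
  reflexivity.
Qed.

(** A primitive [G] of [F] is invariant under each of the two elements of order 2,
    because it is so at the fixed point; as their product is the generator
    [z / (5 z + 1)] of the stabilizer of the cusp 0 times a translation, the
    periods of [G] at the two cusps cancel. *)
Lemma constant_terms F FS K1 K2 c1 c2 :
  qser 1 K1 c1 F -> qser 25 K2 c2 FS ->
  (forall tau, inH tau -> F (- (1) / tau)%C = (tau ^ 2 * FS tau)%C) ->
  (forall tau, inH tau -> F (mobius 2 (-1) 5 (-2) tau) = (cocyc 5 (-2) tau ^ 2 * F tau)%C) ->
  (forall tau, inH tau -> F (mobius 3 (-2) 5 (-3) tau) = (cocyc 5 (-3) tau ^ 2 * F tau)%C) ->
  (c1 K1 + 5 * c2 K2)%C = 0%C.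
Proof.
  intros HF HFS HS H1 H2.
  set (G := qprimitive 1 K1 c1); set (G0 := qprimitive 25 K2 c2).
  assert (DG : forall z, inH z -> cderiv G z (F z)).
  { intros z Hz; apply qprimitive_cderiv; trivial; lra. }
  assert (DG0 : forall z, inH z -> cderiv G0 z (FS z)).
  { intros z Hz; apply qprimitive_cderiv; trivial; lra. }
  assert (Hinv : forall a b c d p, (a * d - b * c = 1)%Z -> inH p -> mobius a b c d p = p ->
     (forall tau, inH tau -> F (mobius a b c d tau) = (cocyc c d tau ^ 2 * F tau)%C) ->
     forall z, inH z -> G (mobius a b c d z) = G z).
  { intros a b c d p Hdet Hp Hfix HFm z Hz.
    enough (E : (G (mobius a b c d z) - G z)%C = 0%C).
    { replace (G (mobius a b c d z)) with ((G (mobius a b c d z) - G z) + G z)%C by ring.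
      rewrite E; ring. }
    rewrite (cderiv_zero_const (fun w => G (mobius a b c d w) - G w)%C) with (w := p); trivial.
    - rewrite Hfix; ring.
    - intros w Hw; replace (RtoC 0) with (F (mobius a b c d w) / cocyc c d w ^ 2 - F w)%C.
      + apply cderiv_minus; [|now apply DG].
        apply cderiv_mobius; trivial; apply DG, inH_mobius; trivial.
      + rewrite HFm by exact Hw; field; now apply (cocyc_neq_0 a b). }
  (* The fixed points are [(2 + i) / 5] and [(3 + i) / 5]. *)
  assert (I1 : forall z, inH z -> G (mobius 2 (-1) 5 (-2) z) = G z).
  { apply (Hinv 2%Z (-1)%Z 5%Z (-2)%Z (2 / 5, 1 / 5)); trivial.
    - unfold inH; simpl; lra.
    - unfold mobius, cocyc, CZ; apply C_eq; simpl; field. }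
  assert (I2 : forall z, inH z -> G (mobius 3 (-2) 5 (-3) z) = G z).
  { apply (Hinv 3%Z (-2)%Z 5%Z (-3)%Z (3 / 5, 1 / 5)); trivial.
    - unfold inH; simpl; lra.
    - unfold mobius, cocyc, CZ; apply C_eq; simpl; field. }
  assert (HGS : forall z w, inH z -> inH w ->
     (G (- (1) / z) - G0 z)%C = (G (- (1) / w) - G0 w)%C).
  { intros z w Hz Hw; rewrite <- !mobius_S.
    apply (cderiv_zero_const (fun z => G (mobius 0 (-1) 1 0 z) - G0 z)%C); trivial.
    intros u Hu; pose proof (inH_neq_0 u Hu).
    replace (RtoC 0) with (F (mobius 0 (-1) 1 0 u) / cocyc 1 0 u ^ 2 - FS u)%C.
    - apply cderiv_minus; [|now apply DG0].
      apply cderiv_mobius; trivial; apply DG, inH_mobius; trivial.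
    - rewrite mobius_S, HS by exact Hu.
      replace (cocyc 1 0 u) with u by (unfold cocyc, CZ; ring).
      field; trivial. }
  assert (IP : forall z, inH z -> G (mobius 1 0 5 1 z) = (G z + c1 K1)%C).
  { intros z Hz.
    assert (Hz1 : inH (z + CZ 1)) by now apply inH_shift.
    assert (Hm := inH_mobius 3 (-2) 5 (-3) _ eq_refl Hz1).
    assert (E : mobius 1 0 5 1 z = mobius 2 (-1) 5 (-2) (mobius 3 (-2) 5 (-3) (z + CZ 1))).
    { pose proof (cocyc_neq_0 1 0 5 1 z eq_refl Hz) as N1.
      pose proof (cocyc_neq_0 3 (-2) 5 (-3) _ eq_refl Hz1) as N2.
      assert (N3 := cocyc_neq_0 2 (-1) 5 (-2) _ eq_refl Hm).
      unfold mobius, cocyc, CZ in *; field; repeat split; trivial.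
      - intros E; apply N3; rewrite <- (Cmult_0_l (/ (RtoC 5 * (z + RtoC 1) + RtoC (-3)))), <- E.
        field; exact N2. }
    rewrite E, I1, I2 by trivial.
    replace (CZ 1) with (RtoC 1) by reflexivity.
    unfold G; rewrite qprimitive_shift by lra; ring. }
  (* The expansion at 0 has period 25, which corresponds to the fifth power of the
     parabolic element [(1 0; 5 1)]; any point of the upper half plane will do. *)
  set (z0 := (0, 1) : C).
  assert (Hz0 : inH z0) by (unfold inH, z0; simpl; lra).
  assert (Hiter : forall n : nat, G (mobius 1 0 (5 * Z.of_nat n) 1 z0) = (G z0 + CZ (Z.of_nat n) * c1 K1)%C).
  { induction n as [|n IH].
    - replace (mobius 1 0 (5 * Z.of_nat 0) 1 z0) with z0; [unfold CZ; simpl; ring|].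
      unfold mobius, cocyc, CZ; simpl; field.
    - assert (Hm : inH (mobius 1 0 (5 * Z.of_nat n) 1 z0)) by (apply inH_mobius; [lia | exact Hz0]).
      replace (mobius 1 0 (5 * Z.of_nat (S n)) 1 z0) with
        (mobius 1 0 5 1 (mobius 1 0 (5 * Z.of_nat n) 1 z0)).
      + rewrite IP by exact Hm; rewrite IH, Nat2Z.inj_succ; unfold Z.succ; rewrite CZ_plus.
        unfold CZ; ring.
      + assert (N1 := cocyc_neq_0 1 0 (5 * Z.of_nat n) 1 z0 ltac:(lia) Hz0).
        assert (N2 := cocyc_neq_0 1 0 5 1 _ eq_refl Hm).
        assert (N3 := cocyc_neq_0 1 0 (5 * Z.of_nat (S n)) 1 z0 ltac:(lia) Hz0).
        rewrite Nat2Z.inj_succ in *; unfold Z.succ in *.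
        unfold mobius, cocyc in *; rewrite !CZ_mult, !CZ_plus in *; unfold CZ in *.
        field; repeat split; trivial. }
  set (s0 := (- (1) / z0)%C).
  assert (Hs0 : inH s0) by (now apply inH_inv).
  assert (Hs1 : inH (s0 + CZ (-25))) by now apply inH_shift.
  pose proof (inH_neq_0 _ Hs0) as Ns0; pose proof (inH_neq_0 _ Hs1) as Ns1.
  pose proof (inH_neq_0 _ Hz0) as Nz0.
  pose proof (HGS _ _ Hs0 Hs1) as E.
  assert (E0 : G0 s0 = (G0 (s0 + CZ (-25)) + 25 * c2 K2)%C).
  { replace s0 with ((s0 + CZ (-25)) + RtoC 25)%C at 1 by (unfold CZ; ring).
    unfold G0; rewrite qprimitive_shift by lra; ring. }
  replace (- (1) / s0)%C with z0 in E by (unfold s0; field; exact Nz0).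
  specialize (Hiter 5%nat).
  replace (mobius 1 0 (5 * Z.of_nat 5) 1 z0) with (- (1) / (s0 + CZ (-25)))%C in Hiter.
  2:{ assert (N3 := cocyc_neq_0 1 0 (5 * Z.of_nat 5) 1 z0 eq_refl Hz0).
      unfold s0 in *; unfold mobius, cocyc, CZ in *; simpl Z.mul in *.
      field; repeat split; trivial.
      intros E1; apply N3.
      replace (RtoC 25 * z0 + RtoC 1)%C with (- (- (1) + RtoC (-25) * z0))%C by ring.
      rewrite <- (Copp_0); f_equal; rewrite <- E1; ring. }
  rewrite Hiter, E0 in E; simpl Z.of_nat in E.
  set (g := G0 (s0 + CZ (-25))%C) in *.
  assert (E' : (5 * (c1 K1 + 5 * c2 K2))%C = 0%C).
  { replace (5 * (c1 K1 + 5 * c2 K2))%C with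
      ((G z0 + CZ 5 * c1 K1 - g) - (G z0 - (g + 25 * c2 K2)))%C by (unfold CZ; ring).
    rewrite <- E; ring. }
  replace (c1 K1 + 5 * c2 K2)%C with (/ 5 * (5 * (c1 K1 + 5 * c2 K2)))%C by field.
  rewrite E'; ring.
Qed.

(** * The plus condition at the cusp 0 *)

Lemma Csum_prepend (b : nat -> C) m l :
  (forall i, (i < m)%nat -> b i = RtoC 0) -> Csum (fun j => b (m + j)%nat) l -> Csum b l.
Proof.
  revert b; induction m as [|m IH]; intros b H0 H; [exact H|].
  replace l with (b O + l)%C by (rewrite H0 by lia; ring).
  apply Csum_decr, IH; [intros i Hi; apply H0; lia | exact H].
Qed.

Lemma qexp_qser f a : qexp f a ->
  exists K, (forall n : Z, (n < - Z.of_nat K)%Z -> a n = RtoC 0) /\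
    qser 1 K (fun N => a (Z.of_nat N - Z.of_nat K)%Z) f.
Proof.
  intros (n0 & Hlow & Hf); exists (Z.to_nat (- n0)); split.
  - intros n Hn; apply Hlow; lia.
  - intros tau Ht; specialize (Hf tau Ht).
    set (K := Z.to_nat (- n0)).
    apply Csum_prepend with (m := Z.to_nat (n0 + Z.of_nat K)).
    + intros i Hi; rewrite Hlow by lia; ring.
    + apply Csum_ext with (2 := Hf); intros j; cbv beta zeta.
      replace (Z.of_nat (Z.to_nat (n0 + Z.of_nat K) + j) - Z.of_nat K)%Z
        with (n0 + Z.of_nat j)%Z by lia.
      do 2 f_equal.
      unfold qexponent; rewrite !INR_IZR_INZ, <- minus_IZR.
      replace (Z.of_nat (Z.to_nat (n0 + Z.of_nat K) + j) - Z.of_nat K)%Z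
        with (n0 + Z.of_nat j)%Z by lia.
      unfold CZ; rewrite Rdiv_1_r; field.
Qed.

Section Twist.

Variables (f : C -> C) (K : nat) (a : Z -> C).
Hypothesis Hq : qser 1 K (fun N => a (Z.of_nat N - Z.of_nat K)%Z) f.
Hypothesis Hplus : forall n : Z, chi n = (-1)%Z -> a n = RtoC 0.

Let shiftf (tau : C) (j : Z) : C := f (tau + CZ j / 5).

Lemma shift_series tau j : inH tau ->
  Csum (fun N => a (Z.of_nat N - Z.of_nat K)%Z * e2pi (RtoC (qexponent 1 K N) * tau)
                 * ec (j * (Z.of_nat N - Z.of_nat K)))%C (shiftf tau j).
Proof.
  intros Ht.
  assert (Ht' : inH (tau + CZ j / 5)).
  { replace (CZ j / 5)%C with (RtoC (IZR j / 5)) by (unfold CZ; rewrite RtoC_div by lra; reflexivity).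
    now apply inH_real_shift. }
  apply Csum_ext with (2 := Hq _ Ht'); intros N.
  rewrite Cmult_plus_distr_l, e2pi_plus, Cmult_assoc; f_equal.
  unfold ec; f_equal; rewrite CZ_mult, CZ_minus, !CZ_nat.
  unfold qexponent; rewrite Rdiv_1_r, RtoC_minus; field.
Qed.

Definition trace5 (tau : C) : C :=
  (f tau + shiftf tau 1 + shiftf tau (-1) + shiftf tau 2 + shiftf tau (-2))%C.

Definition twist5 (tau : C) : C :=
  (shiftf tau 1 + shiftf tau (-1) - shiftf tau 2 - shiftf tau (-2))%C.

Lemma trace5_series tau : inH tau ->
  Csum (fun N => (if ((Z.of_nat N - Z.of_nat K) mod 5 =? 0)%Z
                  then 5 * a (Z.of_nat N - Z.of_nat K)%Z else 0)
                 * e2pi (RtoC (qexponent 1 K N) * tau))%C (trace5 tau).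
Proof.
  intros Ht; unfold trace5.
  pose proof (Csum_plus _ _ _ _ (Csum_plus _ _ _ _ (Csum_plus _ _ _ _ (Csum_plus _ _ _ _
    (Hq tau Ht) (shift_series tau 1 Ht)) (shift_series tau (-1) Ht))
    (shift_series tau 2 Ht)) (shift_series tau (-2) Ht)) as H.
  apply Csum_ext with (2 := H); intros N; cbv beta.
  set (n := (Z.of_nat N - Z.of_nat K)%Z); pose proof (trace_sum n) as Hn.
  replace (1 * n)%Z with n by ring; replace (-1 * n)%Z with (- n)%Z by ring.
  set (t := e2pi _); set (x := a n).
  transitivity (x * t * (1 + ec n + ec (- n) + ec (2 * n) + ec (- 2 * n)))%C; [ring|].
  rewrite Hn; destruct (_ =? _)%Z; ring.
Qed.

(** By the vanishing of [a n] for [chi n = -1], the twist of [f] by [chi] is [f]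
    without the terms of exponent divisible by 5. *)
Lemma twist5_trace5 tau : inH tau ->
  twist5 tau = (RtoC (sqrt 5) * (f tau - trace5 tau / 5))%C.
Proof.
  intros Ht; unfold twist5.
  pose proof (Csum_minus _ _ _ _ (Csum_minus _ _ _ _ (Csum_plus _ _ _ _
    (shift_series tau 1 Ht) (shift_series tau (-1) Ht))
    (shift_series tau 2 Ht)) (shift_series tau (-2) Ht)) as H.
  apply (Csum_unique _ _ _ H).
  pose proof (Csum_scal (RtoC (sqrt 5)) _ _ (Csum_minus _ _ _ _ (Hq tau Ht)
    (Csum_scal (/ 5)%C _ _ (trace5_series tau Ht)))) as H'.
  replace (RtoC (sqrt 5) * (f tau - trace5 tau / 5))%C with
    (RtoC (sqrt 5) * (f tau - / 5 * trace5 tau))%C by field.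
  apply Csum_ext with (2 := H'); intros N; cbv beta.
  set (n := (Z.of_nat N - Z.of_nat K)%Z); pose proof (gauss_sum n) as Hn.
  replace (1 * n)%Z with n by ring; replace (-1 * n)%Z with (- n)%Z by ring.
  set (t := e2pi _).
  transitivity (a n * t * (ec n + ec (- n) - ec (2 * n) - ec (- 2 * n)))%C; [|ring].
  rewrite Hn.
  destruct (Z.eq_dec (chi n) (-1)) as [E|E].
  - rewrite (Hplus n E); destruct (_ =? _)%Z; ring.
  - unfold chi in *; destruct (Z.eqb_spec (n mod 5) 0) as [E0|E0].
    + rewrite E0; unfold CZ; field.
    + assert (Hr : (n mod 5 = 1 \/ n mod 5 = 2 \/ n mod 5 = 3 \/ n mod 5 = 4)%Z).
      { pose proof (Z.mod_pos_bound n 5 ltac:(lia)); lia. }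
      destruct Hr as [Hr|[Hr|[Hr|Hr]]]; rewrite Hr in *; try lia; unfold CZ; ring.
Qed.

Hypothesis Hmod : forall a b c d : Z, (a * d - b * c = 1)%Z -> (5 | c)%Z ->
  forall tau, inH tau -> f (mobius a b c d tau) = (CZ (chi d) * f tau)%C.

Lemma shiftf_mobius (p q r j k : Z) sigma : inH sigma -> inH (sigma + CZ k / 5)%C ->
  (p * r - q * 5 = 1)%Z -> (j = p)%Z -> (r = - k)%Z ->
  shiftf (- (1) / (25 * sigma)) j = (CZ (chi r) * shiftf sigma k)%C.
Proof.
  intros Hs Hk Hdet Hj Hr; unfold shiftf.
  rewrite <- Hmod with (1 := Hdet) (2 := Z.divide_refl 5) by exact Hk.
  f_equal; unfold mobius, cocyc.
  pose proof (inH_neq_0 _ Hs) as H0.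
  assert (E : (CZ 5 * CZ q)%C = (CZ p * CZ r - 1)%C).
  { rewrite <- !CZ_mult; replace (5 * q)%Z with (p * r - 1)%Z by lia.
    rewrite CZ_minus, CZ_mult; reflexivity. }
  assert (Eq : CZ q = ((CZ p * CZ r - 1) / 5)%C).
  { rewrite <- E; unfold CZ; field. }
  rewrite Eq, Hj, Hr, CZ_opp.
  replace (CZ 5 * (sigma + CZ k / 5) + - CZ k)%C with (5 * sigma)%C by (unfold CZ; field).
  field; exact H0.
Qed.

(** The condition on the coefficients is thus a condition on the expansion at the
    cusp 0: all the translates in the identity of the twist with the trace, taken at
    [-1/(25 sigma)], except the trivial one, go back to translates of [sigma]. *)
Lemma fricke_plus sigma : inH sigma ->
  f (- (1) / (25 * sigma))%C = (trace5 sigma / RtoC (sqrt 5))%C.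
Proof.
  intros Hs.
  pose proof (inH_neq_0 _ Hs) as H0; pose proof sqrt5_neq_0 as H5.
  assert (Hk : forall k, inH (sigma + CZ k / 5)%C).
  { intros k; replace (CZ k / 5)%C with (RtoC (IZR k / 5)) by (unfold CZ; rewrite RtoC_div by lra; reflexivity).
    now apply inH_real_shift. }
  assert (Ht : inH (- (1) / (25 * sigma))) by (apply inH_inv, (inH_scale 25); [lra | exact Hs]).
  pose proof (shiftf_mobius 1 0 1 1 (-1) sigma Hs (Hk _) eq_refl eq_refl eq_refl) as A1.
  pose proof (shiftf_mobius 2 (-1) (-2) 2 2 sigma Hs (Hk _) eq_refl eq_refl eq_refl) as A2.
  pose proof (shiftf_mobius (-2) (-1) 2 (-2) (-2) sigma Hs (Hk _) eq_refl eq_refl eq_refl) as A3.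
  pose proof (shiftf_mobius (-1) 0 (-1) (-1) 1 sigma Hs (Hk _) eq_refl eq_refl eq_refl) as A4.
  change (chi 1) with 1%Z in A1; change (chi (-2)) with (-1)%Z in A2;
  change (chi 2) with (-1)%Z in A3; change (chi (-1)) with 1%Z in A4.
  pose proof (twist5_trace5 _ Ht) as B1; pose proof (twist5_trace5 _ Hs) as B2.
  set (tau := (- (1) / (25 * sigma))%C) in *.
  unfold twist5, trace5 in *; rewrite A1, A2, A3, A4 in B1; unfold CZ in B1.
  set (x1 := shiftf sigma 1) in *; set (y1 := shiftf sigma (-1)) in *;
  set (x2 := shiftf sigma 2) in *; set (y2 := shiftf sigma (-2)) in *.
  set (w := RtoC (sqrt 5)) in *.
  assert (Hw : (w * w)%C = 5%C) by apply sqrt5_sq.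
  clearbody w x1 y1 x2 y2 tau.
  assert (C1 : (x1 + y1 + x2 + y2)%C = (w * f tau * (4 / 5) - w / 5 * (x1 + y1 - x2 - y2))%C).
  { transitivity (1 * y1 + 1 * x1 - -1 * x2 - -1 * y2)%C; [ring|].
    rewrite B1; field. }
  rewrite B2 in C1.
  assert (C2 : (w * w * (f sigma - (f sigma + x1 + y1 + x2 + y2) / 5) / 5)%C
     = (f sigma - (f sigma + x1 + y1 + x2 + y2) / 5)%C) by (rewrite Hw; field).
  assert (C3 : (w * f tau * (4 / 5))%C = (4 / 5 * (f sigma + x1 + y1 + x2 + y2))%C).
  { transitivity ((x1 + y1 + x2 + y2) + w * w * (f sigma - (f sigma + x1 + y1 + x2 + y2) / 5) / 5)%C.
    - rewrite C1; field.
    - rewrite C2; field. }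
  replace (f tau) with (w * f tau * (4 / 5) / (w * (4 / 5)))%C by (field; exact H5).
  rewrite C3; field; exact H5.
Qed.

Lemma fricke_series :
  qser 25 K (fun N => if ((Z.of_nat N - Z.of_nat K) mod 5 =? 0)%Z
                      then RtoC (sqrt 5) * a (Z.of_nat N - Z.of_nat K)%Z else RtoC 0)%C
       (fun tau => f (- (1) / tau)%C).
Proof.
  intros tau Ht.
  pose proof sqrt5_neq_0 as H5.
  assert (Hs : inH (RtoC (/ 25) * tau)) by (apply inH_scale; [lra | exact Ht]).
  replace (- (1) / tau)%C with (- (1) / (25 * (RtoC (/ 25) * tau)))%C.
  2:{ rewrite RtoC_inv by lra; field; now apply inH_neq_0. }
  rewrite fricke_plus by exact Hs.
  pose proof (Csum_scal (/ RtoC (sqrt 5))%C _ _ (trace5_series _ Hs)) as H.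
  replace (trace5 _ / _)%C with (/ RtoC (sqrt 5) * trace5 (RtoC (/ 25) * tau))%C by (field; exact H5).
  apply Csum_ext with (2 := H); intros N; cbv beta.
  replace (RtoC (qexponent 25 K N) * tau)%C with (RtoC (qexponent 1 K N) * (RtoC (/ 25) * tau))%C.
  2:{ rewrite Cmult_assoc, <- RtoC_mult; do 2 f_equal; unfold qexponent; field. }
  destruct (_ =? _)%Z; [|ring].
  rewrite <- sqrt5_sq.
  field; exact H5.
Qed.

End Twist.

(** * Integrality and parity of divisor sums *)

Definition isZ (x : C) : Prop := exists n : Z, x = CZ n.

Lemma isZ_plus x y : isZ x -> isZ y -> isZ (x + y)%C.
Proof. intros [m ->] [n ->]; exists (m + n)%Z; now rewrite CZ_plus. Qed.

Lemma isZ_mult x y : isZ x -> isZ y -> isZ (x * y)%C.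
Proof. intros [m ->] [n ->]; exists (m * n)%Z; now rewrite CZ_mult. Qed.

Lemma isZ_CZ n : isZ (CZ n).
Proof. now exists n. Qed.

Lemma isZ_csum a n : (forall k, (k < n)%nat -> isZ (a k)) -> isZ (csum a n).
Proof.
  induction n as [|n IH]; intros H; simpl; [apply (isZ_CZ 0)|].
  apply isZ_plus; [apply IH; intros; apply H|apply H]; lia.
Qed.

Lemma isZ_INR n : isZ (RtoC (INR n)).
Proof. rewrite <- CZ_nat; apply isZ_CZ. Qed.

Lemma isZ_lambert A B N : (forall n, isZ (A n)) -> (forall n, isZ (B n)) ->
  isZ (lambert A B N).
Proof.
  intros HA HB; apply isZ_csum; intros l _; unfold lambert_term.
  destruct (_ =? _)%nat; [|apply (isZ_CZ 0)].
  repeat apply isZ_mult; auto using isZ_INR.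
Qed.

Lemma isZ_oneC n : isZ (oneC n).
Proof. apply (isZ_CZ 1). Qed.

Lemma isZ_chiC n : isZ (chiC n).
Proof. apply isZ_CZ. Qed.

Lemma chi_mult5 n : chi (5 * n) = 0%Z.
Proof.
  unfold chi; rewrite Z.mul_comm, Z.mod_mul by lia; reflexivity.
Qed.

Lemma chiC_mult5 n : chiC (5 * n) = RtoC 0.
Proof. unfold chiC; rewrite Nat2Z.inj_mul, chi_mult5; reflexivity. Qed.

Lemma chi_unit n : (n mod 5 <> 0)%Z -> chi n = 1%Z \/ chi n = (-1)%Z.
Proof.
  intros H; unfold chi; pose proof (Z.mod_pos_bound n 5 ltac:(lia)).
  assert (Hr : (n mod 5 = 1 \/ n mod 5 = 2 \/ n mod 5 = 3 \/ n mod 5 = 4)%Z) by lia.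
  destruct Hr as [Hr|[Hr|[Hr|Hr]]]; rewrite Hr; auto.
Qed.

Lemma csum_mult5 a M : (forall k, (S k mod 5 <> 0)%nat -> a k = RtoC 0) ->
  csum a (5 * M) = csum (fun k => a (5 * k + 4)%nat) M.
Proof.
  intros H; induction M as [|M IH]; [reflexivity|].
  replace (5 * S M)%nat with (5 * M + 5)%nat by lia.
  rewrite csum_add5, IH; cbn [csum].
  assert (Hm : forall r, (r < 5)%nat -> ((5 * M + r) mod 5 = r)%nat).
  { intros r Hr; symmetry; apply Nat.mod_unique with M; lia. }
  rewrite (H (5 * M)%nat), (H (5 * M + 1)%nat), (H (5 * M + 2)%nat), (H (5 * M + 3)%nat);
    [ring| | | |].
  - replace (S (5 * M + 3)) with (5 * M + 4)%nat by lia; rewrite Hm; lia.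
  - replace (S (5 * M + 2)) with (5 * M + 3)%nat by lia; rewrite Hm; lia.
  - replace (S (5 * M + 1)) with (5 * M + 2)%nat by lia; rewrite Hm; lia.
  - replace (S (5 * M)) with (5 * M + 1)%nat by lia; rewrite Hm; lia.
Qed.

Lemma gcd_5 k : (k mod 5 <> 0)%nat -> Nat.gcd k 5 = 1%nat.
Proof.
  intros Hk.
  pose proof (Nat.gcd_divide_r k 5) as Hd; pose proof (Nat.gcd_divide_l k 5) as Hd'.
  set (g := Nat.gcd k 5) in *.
  assert (g <= 5)%nat by (apply Nat.divide_pos_le; [lia | exact Hd]).
  destruct Hd as [c Hc].
  assert (Hg : (g = 1 \/ g = 5)%nat).
  { destruct g as [|[|[|[|[|[|g]]]]]]; try lia. }
  destruct Hg as [Hg|Hg]; [exact Hg|exfalso].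
  rewrite Hg in Hd'; apply Hk; now apply Nat.Lcm0.mod_divide.
Qed.

(** If [l n = 5 M] and 5 does not divide [l], then 5 divides [n] and [chi n = 0]: only
    the [l] divisible by 5 contribute. *)
Lemma lambert_inf_mult5 M : lambert oneC chiC (5 * M) = lambert oneC chiC M.
Proof.
  unfold lambert; rewrite csum_mult5.
  - apply csum_ext; intros k Hk; unfold lambert_term, oneC.
    replace (S (5 * k + 4)) with (5 * S k)%nat by lia.
    rewrite Nat.Div0.mul_mod_distr_l, Nat.Div0.div_mul_cancel_l by lia.
    destruct (Nat.eqb_spec (M mod S k) 0) as [E|E].
    + rewrite E; reflexivity.
    + destruct (Nat.eqb_spec (5 * (M mod S k)) 0) as [E'|E']; [lia | reflexivity].
  - intros k Hk; unfold lambert_term.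
    destruct (Nat.eqb_spec (5 * M mod S k) 0) as [E|E]; [|reflexivity].
    apply Nat.Lcm0.mod_divide in E.
    apply Nat.gauss in E; [|now apply gcd_5].
    destruct E as [c ->].
    replace (5 * (c * S k))%nat with (5 * c * S k)%nat by ring.
    rewrite Nat.div_mul, chiC_mult5 by lia; ring.
Qed.

(** Only the [l] prime to 5 contribute, and such an [l] divides [5 M] exactly when it
    divides [M]. *)
Lemma lambert_zero_mult5 M : lambert chiC oneC (5 * M) = (5 * lambert chiC oneC M)%C.
Proof.
  assert (Ht : forall k, lambert_term chiC oneC (S k) (5 * M)
      = (5 * lambert_term chiC oneC (S k) M)%C).
  { intros k; unfold lambert_term, oneC.
    destruct (Nat.eqb_spec (S k mod 5) 0) as [E5|E5].
    - apply Nat.Lcm0.mod_divide in E5; destruct E5 as [c Hc].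
      rewrite Hc, (Nat.mul_comm c 5), chiC_mult5.
      destruct (_ =? _)%nat, (_ =? _)%nat; ring.
    - assert (Hd : Nat.divide (S k) (5 * M) <-> Nat.divide (S k) M).
      { split; [|intros H; now apply Nat.divide_mul_r].
        intros E; apply Nat.gauss in E; [exact E | now apply gcd_5]. }
      rewrite <- !Nat.Lcm0.mod_divide in Hd.
      destruct (Nat.eqb_spec (5 * M mod S k) 0) as [E|E],
        (Nat.eqb_spec (M mod S k) 0) as [E'|E']; try tauto; [|ring].
      apply Nat.Lcm0.mod_divide in E'; destruct E' as [c ->].
      replace (5 * (c * S k))%nat with (5 * c * S k)%nat by ring.
      rewrite !Nat.div_mul by lia.
      rewrite mult_INR, RtoC_mult; simpl (INR 5).
      replace (RtoC (1 + 1 + 1 + 1 + 1)) with (RtoC 5) by (f_equal; ring).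
      ring. }
  unfold lambert.
  transitivity (csum (fun l => lambert_term chiC oneC (S l) (5 * M)) (M + 4 * M));
    [f_equal; lia|].
  rewrite csum_add.
  rewrite (csum_ext (fun k => lambert_term chiC oneC (S (M + k)) (5 * M)) (fun _ => 0 * 0)%C (4 * M)).
  - rewrite (csum_scal 0 (fun _ => RtoC 0)), (csum_ext _ _ M (fun k _ => Ht k)), csum_scal.
    ring.
  - intros k _; rewrite Ht, lambert_term_far by lia; ring.
Qed.

(** When 5 does not divide [M = l n], both [chi l] and [chi n] are odd, and the sum of
    [(chi l + chi n) * n] is even term by term.  Replacing [M] by [5 M] multiplies one of
    the two sums by 5 and preserves the other, so that the parity is unchanged. *)
Lemma lambert_even M : exists n : Z,
  (lambert oneC chiC M + lambert chiC oneC M)%C = (2 * CZ n)%C.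
Proof.
  induction M as [M IH] using lt_wf_ind.
  destruct (Nat.eq_dec M 0) as [->|HM0].
  { exists 0%Z; unfold lambert, CZ; simpl; ring. }
  destruct (Nat.eq_dec (M mod 5) 0) as [E|E].
  - apply Nat.Lcm0.mod_divide in E; destruct E as [M' ->].
    rewrite (Nat.mul_comm M' 5), lambert_inf_mult5, lambert_zero_mult5.
    destruct (IH M' ltac:(lia)) as [n Hn].
    destruct (isZ_lambert chiC oneC M' isZ_chiC isZ_oneC) as [k Hk].
    exists (n + 2 * k)%Z.
    rewrite CZ_plus, CZ_mult.
    transitivity (lambert oneC chiC M' + lambert chiC oneC M' + 4 * lambert chiC oneC M')%C; [ring|].
    rewrite Hn, Hk; unfold CZ; ring.
  - unfold lambert; rewrite <- csum_plus.
    assert (H : forall m, exists n : Z, csum (fun l => lambert_term oneC chiC (S l) M +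
        lambert_term chiC oneC (S l) M)%C m = (2 * CZ n)%C).
    { induction m as [|m [n Hn]]; [exists 0%Z; unfold CZ; simpl; ring|].
      simpl csum; rewrite Hn; unfold lambert_term, oneC.
      destruct (Nat.eqb_spec (M mod S m) 0) as [Em|Em].
      2:{ exists n; ring. }
      apply Nat.Lcm0.mod_divide in Em; destruct Em as [c Hc].
      rewrite Hc, Nat.div_mul by lia.
      assert (H1 : (Z.of_nat c mod 5 <> 0)%Z).
      { intros H; apply E; apply Z.mod_divide in H; [|lia].
        destruct H as [d Hd]; apply Nat.Lcm0.mod_divide.
        exists (Z.to_nat d * S m)%nat; rewrite Hc; nia. }
      assert (H2 : (Z.of_nat (S m) mod 5 <> 0)%Z).
      { intros H; apply E; apply Z.mod_divide in H; [|lia].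
        destruct H as [d Hd]; apply Nat.Lcm0.mod_divide.
        exists (c * Z.to_nat d)%nat; rewrite Hc; nia. }
      unfold chiC; rewrite <- CZ_nat.
      destruct (chi_unit _ H1) as [-> | ->], (chi_unit _ H2) as [-> | ->].
      - exists (n + Z.of_nat c)%Z; rewrite CZ_plus; unfold CZ; ring.
      - exists n; unfold CZ; ring.
      - exists n; unfold CZ; ring.
      - exists (n - Z.of_nat c)%Z; rewrite CZ_minus; unfold CZ; ring. }
    apply H.
Qed.

(** The coefficient with which [a (- M)] enters the formula for the constant term
    of [f], divided by 5. *)
Definition weight_coef (M : nat) : C :=
  (lambert oneC chiC M + (if (M mod 5 =? 0)%nat then 5 * lambert chiC oneC (M / 5) else 0))%C.

(** If 5 divides [M], then [2 a] is an integer and [weight_coef M] is even, since it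
    differs from the even number of [lambert_even] at [M / 5] by 4 times an integer. *)
Lemma isZ_weight_term a c M : (0 < M)%nat ->
  (CZ (s (- Z.of_nat M)) * a)%C = CZ c -> isZ (a * weight_coef M)%C.
Proof.
  intros HM; unfold s, weight_coef.
  destruct (Nat.eqb_spec (M mod 5) 0) as [E|E].
  - apply Nat.Lcm0.mod_divide in E; destruct E as [M' ->].
    rewrite Nat.div_mul by lia.
    replace (- Z.of_nat (M' * 5) mod 5)%Z with 0%Z.
    2:{ replace (- Z.of_nat (M' * 5))%Z with (- Z.of_nat M' * 5)%Z by lia.
        now rewrite Z.mod_mul by lia. }
    simpl Z.eqb; cbv iota; intros Hc.
    rewrite (Nat.mul_comm M' 5), lambert_inf_mult5.
    destruct (lambert_even M') as [n Hn].
    destruct (isZ_lambert chiC oneC M' isZ_chiC isZ_oneC) as [k Hk].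
    exists (c * (n + 2 * k))%Z.
    transitivity (a * ((lambert oneC chiC M' + lambert chiC oneC M') + 4 * lambert chiC oneC M'))%C;
      [ring|].
    rewrite Hn, Hk, CZ_mult, <- Hc, CZ_plus, CZ_mult; unfold CZ; ring.
  - replace (- Z.of_nat M mod 5 =? 0)%Z with false.
    2:{ symmetry; apply Z.eqb_neq; intros H; apply E.
        apply Z.mod_divide in H; [|lia]; destruct H as [d Hd].
        apply Nat.Lcm0.mod_divide; exists (Z.to_nat (- d)); lia. }
    intros Hc; rewrite Cplus_0_r.
    apply isZ_mult; [exists c; rewrite <- Hc; unfold CZ; ring|].
    apply isZ_lambert; [apply isZ_oneC | apply isZ_chiC].
Qed.

(** * The constant term and the weight *)

Definition E_fun (tau : C) : C := CSeries (fun N => E_inf N * e2pi tau ^ N)%C.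

Definition E_fun_zero (tau : C) : C := CSeries (fun N => E_zero N * e2pi (tau / 5) ^ N)%C.

Lemma wp_E_fun tau : inH tau -> wp_E tau (E_fun tau).
Proof.
  intros Ht; destruct (wp_E_expansion tau Ht) as [L [HL HS]].
  unfold E_fun; now rewrite (CSeries_correct _ _ HS).
Qed.

Lemma E_fun_unique tau L : inH tau -> wp_E tau L -> E_fun tau = L.
Proof. intros Ht HL; exact (Csum_unique _ _ _ (wp_E_fun tau Ht) HL). Qed.

Lemma E_fun_inv tau : inH tau -> E_fun (- (1) / tau) = (tau ^ 2 * E_fun_zero tau)%C.
Proof.
  intros Ht; pose proof (inH_neq_0 _ Ht) as H0; pose proof (inH_inv _ Ht) as Hi.
  assert (H := wp_E_fun _ Hi).
  apply wp_diff_inv in H; trivial; try small; try lra.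
  replace (- (1) / (- (1) / tau))%C with tau in H.
  2:{ field; repeat split; trivial; apply (Copp_neq_0_compat 1 C1_nz). }
  rewrite !Ropp_0 in H.
  destruct (wp_E_expansion_zero tau Ht) as [L [HL HS]].
  unfold E_fun_zero; rewrite (CSeries_correct _ _ HS), (Csum_unique _ _ _ HL H).
  field; exact H0.
Qed.

Lemma qser_E_fun : qser 1 0 E_inf E_fun.
Proof.
  intros tau Ht; destruct (wp_E_expansion tau Ht) as [L [_ HS]].
  unfold E_fun; rewrite (CSeries_correct _ _ HS).
  apply Csum_ext with (2 := HS); intros N; f_equal.
  unfold qexponent; rewrite Rdiv_1_r; simpl (INR 0); rewrite Rminus_0_r.
  symmetry; apply e2pi_nat.
Qed.

Definition E_zero_spread (N : nat) : C :=
  if (N mod 5 =? 0)%nat then E_zero (N / 5) else RtoC 0.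

Lemma qser_E_fun_zero : qser 25 0 E_zero_spread E_fun_zero.
Proof.
  intros tau Ht; destruct (wp_E_expansion_zero tau Ht) as [L [_ HS]].
  unfold E_fun_zero; rewrite (CSeries_correct _ _ HS).
  apply (Csum_sparse _ _ 5 ltac:(lia)) in HS.
  apply Csum_ext with (2 := HS); intros N; unfold E_zero_spread.
  destruct (Nat.eqb_spec (N mod 5) 0) as [E|E]; [|ring].
  rewrite <- e2pi_nat; do 2 f_equal.
  unfold qexponent; simpl (INR 0).
  assert (EN : INR N = 5 * INR (N / 5)).
  { rewrite (Nat.div_mod_eq N 5) at 1; rewrite E, Nat.add_0_r, mult_INR; simpl; ring. }
  rewrite EN; replace ((5 * INR (N / 5) - 0) / 25) with (INR (N / 5) / 5) by field.
  rewrite RtoC_div by lra; field.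
Qed.

(** The relation between the two constant terms of [f E], solved for [a 0].  In the
    product at 0, [sqrt 5 * a n] meets an unscaled coefficient of [E], at infinity [a n]
    meets [sqrt 5] times a coefficient: so the factor [sqrt 5] is common to all terms with
    [n < 0], while [a 0] has the factor [- 1 / sqrt 5]. *)
Lemma constant_term_formula f a K :
  (forall n : Z, chi n = (-1)%Z -> a n = RtoC 0) ->
  (forall a b c d : Z, (a * d - b * c = 1)%Z -> (5 | c)%Z ->
    forall tau, inH tau -> f (mobius a b c d tau) = (CZ (chi d) * f tau)%C) ->
  qser 1 K (fun N => a (Z.of_nat N - Z.of_nat K)%Z) f ->
  a 0%Z = (5 * csum (fun k => a (Z.of_nat k - Z.of_nat K)%Z * weight_coef (K - k)) K)%C.
Proof.
  intros Hplus Hmod Hq; pose proof sqrt5_neq_0 as H5; pose proof sqrt5_sq as Hs5.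
  pose proof (constant_terms (fun tau => f tau * E_fun tau)%C
    (fun tau => f (- (1) / tau) * E_fun_zero tau)%C K K _ _
    (qser_mult 1 K _ _ _ _ Rlt_0_1 Hq qser_E_fun)
    (qser_mult 25 K _ _ _ _ ltac:(lra) (fricke_series f K a Hq Hplus Hmod) qser_E_fun_zero)) as H.
  cbv beta in H.
  assert (E1 : forall tau, inH tau -> (f (- (1) / tau) * E_fun (- (1) / tau))%C =
    (tau ^ 2 * (f (- (1) / tau) * E_fun_zero tau))%C).
  { intros tau Ht; rewrite E_fun_inv by exact Ht; ring. }
  assert (E2 : forall p q r, (p * r - q * 5 = 1)%Z -> chi r = (-1)%Z ->
    (forall tau L, inH tau -> wp_E tau L -> wp_E (mobius p q 5 r tau) (- (cocyc 5 r tau ^ 2 * L))) ->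
    forall tau, inH tau -> (f (mobius p q 5 r tau) * E_fun (mobius p q 5 r tau))%C =
      (cocyc 5 r tau ^ 2 * (f tau * E_fun tau))%C).
  { intros p q r Hdet Hr HE tau Ht.
    rewrite Hmod by (trivial; exists 1%Z; reflexivity).
    rewrite (E_fun_unique _ _ (inH_mobius _ _ _ _ _ Hdet Ht) (HE _ _ Ht (wp_E_fun _ Ht))), Hr.
    unfold CZ; ring. }
  specialize (H E1 (E2 2 (-1) (-2) eq_refl eq_refl wp_E_e1)%Z (E2 3 (-2) (-3) eq_refl eq_refl wp_E_e2)%Z).
  rewrite <- csum_scal, <- csum_plus in H; cbn [csum] in H.
  rewrite Nat.sub_diag, Z.sub_diag in H.
  replace (E_inf 0) with (- (1) / RtoC (sqrt 5))%C in H
    by (unfold E_inf, lambert; simpl; ring).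
  replace (E_zero_spread 0) with (RtoC 0) in H by reflexivity.
  rewrite (csum_ext _ (fun k => RtoC (sqrt 5) *
    (a (Z.of_nat k - Z.of_nat K)%Z * weight_coef (K - k)))%C) in H.
  - rewrite csum_scal in H.
    set (S := csum _ K) in *.
    assert (H' : (RtoC (sqrt 5) * S - a 0%Z / RtoC (sqrt 5))%C = 0%C).
    { rewrite <- H; destruct (_ =? _)%Z; field; exact H5. }
    replace (a 0%Z) with (RtoC (sqrt 5) * RtoC (sqrt 5) * S
       - RtoC (sqrt 5) * (RtoC (sqrt 5) * S - a 0%Z / RtoC (sqrt 5)))%C by (field; exact H5).
    rewrite H', Hs5; ring.
  - intros k Hk; unfold weight_coef, E_inf, E_zero_spread, E_zero.
    replace ((K - k =? 0)%nat) with false by (symmetry; apply Nat.eqb_neq; lia).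
    replace ((Z.of_nat k - Z.of_nat K) mod 5 =? 0)%Z with ((K - k) mod 5 =? 0)%nat.
    + destruct (_ =? _)%nat; ring.
    + apply Bool.eq_iff_eq_true; rewrite Nat.eqb_eq, Z.eqb_eq.
      rewrite Nat.Lcm0.mod_divide, Z.mod_divide by lia; split.
      * intros [c Hc]; exists (- Z.of_nat c)%Z; lia.
      * intros [c Hc]; exists (Z.to_nat (- c)); lia.
Qed.

Theorem corollary4p5
  (Hint : forall k : Z, k = 0%Z \/ k = 2%Z ->
     forall (m : Z) (f : C -> C) (a : Z -> C), reduced k m f a ->
     forall n : Z, exists z : Z, (CZ (s m) * a n)%C = CZ z)
  (m : Z) (hm : (m < 0)%Z)
  (f : C -> C) (a : Z -> C) (hf : reduced 0 m f a)
  (Psi : hilbert_form) (hPsi : is_borcherds_lift a Psi) :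
  exists z : Z, hweight Psi = (5 * IZR z)%R.
Proof.
  destruct hf as [[[_ [_ Hmod]] [Hexp Hplus]] _].
  destruct hPsi as [Hw [c [Hc _]]].
  destruct (qexp_qser f a Hexp) as [K [_ HK]].
  assert (Ha : a 0%Z = (5 * csum (fun k => a (Z.of_nat k - Z.of_nat K)%Z * weight_coef (K - k)) K)%C).
  { apply (constant_term_formula f); trivial.
    intros a' b' c' d' Hdet Hdiv tau Ht; rewrite Hmod by trivial.
    simpl Cpow_Z; ring. }
  assert (HZ : isZ (csum (fun k => a (Z.of_nat k - Z.of_nat K)%Z * weight_coef (K - k))%C K)).
  { apply isZ_csum; intros k Hk.
    apply isZ_weight_term with (c := c (Z.of_nat k - Z.of_nat K)%Z); [lia|].
    replace (- Z.of_nat (K - k))%Z with (Z.of_nat k - Z.of_nat K)%Z by lia.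
    apply Hc; lia. }
  destruct HZ as [z Hz]; exists z; rewrite Hz in Ha.
  apply RtoC_inj; rewrite Hw, Ha, RtoC_mult.
  change (s 0) with 2%Z; unfold CZ; field.
Qed.
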